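(* Let $B\subset\mathbb{R}^2$ be a symmetric oval and let $F\subset\mathbb{R}^2$ be a closed topological disk with rectifiable boundary $\partial F$. Then $$p_B(\partial F)=2\lim_{\lambda\to 0}\lambda N_\lambda(F,B)$$ (in particular the limit, over $\lambda>0$, exists).
   Context: A symmetric oval $B\subset\mathbb{R}^2$ is a compact convex set with non-empty interior, symmetric about its center. $\|\cdot\|_B$ is the norm on $\mathbb{R}^2$ with unit ball $B$ (centered at the origin). $p_B(\gamma)$ is the length of a curve $\gamma$ measured in the norm $\|\cdot\|_B$. A rectifiable curve is the image of a Lipschitz map from a bounded interval into the plane. For $\lambda>0$ let $A_{F,B,\lambda}$ be the family of all sets homothetic to $B$ in the ratio $\lambda$ (i.e. translates of $\lambda B$) which have at least one point in common with $F$ and have only boundary points in common with $F$. $N_\lambda(F,B)$ is the greatest integer $k$ such that $A_{F,B,\lambda}$ contains $k$ sets with pairwise disjoint interiors. *)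

(* Defs.v *)
From HB Require Import structures.
From mathcomp Require Import all_boot all_order all_algebra.
From mathcomp Require Import all_classical all_reals all_analysis.

Set Implicit Arguments.
Unset Strict Implicit.
Unset Printing Implicit Defensive.

Import Order.TTheory GRing.Theory Num.Theory numFieldNormedType.Exports.

Local Open Scope classical_set_scope.
Local Open Scope ring_scope.

(* The canonical norm on [R * R] is the max norm; it only enters through the
   topology and the notion of Lipschitz map, neither of which depends on the
   choice of a norm on the plane. *)

Definition boundary (T : topologicalType) (A : set T) : set T :=
  closure A `\` A°.

Definition homeomorphic (T U : topologicalType) (A : set T) (B : set U) :=
  exists (f : T -> U) (g : U -> T),
    [/\ set_fun A B f, set_fun B A g,
        {in A, cancel f g} /\ {in B, cancel g f},
        {within A, continuous f} & {within B, continuous g}].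

Section Plane.
Variable R : realType.
Local Notation plane := (R * R)%type.

Definition closed_unit_disk : set plane := [set x | x.1 ^+ 2 + x.2 ^+ 2 <= 1].

Definition topological_disk (F : set plane) := homeomorphic closed_unit_disk F.

Definition rectifiable (C : set plane) :=
  exists (I : set R) (f : R -> plane),
    [/\ is_interval I, bounded_set I, [lipschitz f x | x in I] & f @` I = C].

Definition symmetric_oval (c : plane) (B : set plane) :=
  [/\ compact B, convex_set B, B° !=set0 &
      forall x, B x -> B (c + c - x)].

(* Minkowski functional of [B - c], i.e. the norm whose unit ball is [B]
   translated so that its center [c] becomes the origin. *)
Definition oval_norm (c : plane) (B : set plane) (x : plane) : R :=
  inf [set t : R | 0 < t /\ exists2 b, B b & x = t *: (b - c)].

(* Length of [g] on [0, 1]: the supremum of the lengths of inscribed polygons,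
   following [total_variation] with [oval_norm] as the norm. *)
Definition path_length (c : plane) (B : set plane) (g : R -> plane) : \bar R :=
  ereal_sup [set (\sum_(0 <= n < size s)
                    oval_norm c B (g (nth 1 (0 :: s) n.+1) -
                                   g (nth 1 (0 :: s) n)))%:E
            | s in itv_partition 0 1].

Definition simple_closed_path (g : R -> plane) (C : set plane) :=
  [/\ {within `[0, 1], continuous g}, g 0 = g 1,
      {in `[0, 1[ &, injective g} & g @` `[0, 1] = C].

(* Length of a simple closed curve given as a set.  All simple closed
   parametrizations have the same length, so the supremum only discards the
   choice; its value is [-oo] when [C] is not a simple closed curve. *)
Definition closed_curve_length (c : plane) (B C : set plane) : \bar R :=
  ereal_sup [set path_length c B g | g in [set g | simple_closed_path g C]].

Definition homothet (B : set plane) (l : R) (t : plane) : set plane :=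
  [set t + l *: x | x in B].

(* "Only boundary points in common" is read as boundary points of both sets. *)
Definition touching (F B : set plane) (l : R) : set (set plane) :=
  [set A | [/\ exists t, A = homothet B l t, A `&` F !=set0 &
               A `&` F `<=` boundary A `&` boundary F]].

Definition touching_packing (F B : set plane) (l : R) : set nat :=
  [set k | exists A : 'I_k -> set plane,
     (forall i, touching F B l (A i)) /\ trivIset setT (fun i => (A i)°)].

(* The greatest element of [touching_packing F B l]; by convention 0 if there
   is none, which never happens for a symmetric oval [B], a compact [F] and
   [l > 0]. *)
Definition touching_number (F B : set plane) (l : R) : nat :=
  xget 0%N (touching_packing F B l `&` ubound (touching_packing F B l)).

End Plane.

(* Main.v *)
(* Along an arc of the boundary whose length hardly exceeds its chord, all but
   few vertices of a mesh of step proportional to the ratio [l] of the homothets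
   see the curve progress in the direction of the chord at almost full speed (a
   rising sun argument), and near these vertices the curve stays in a strip much
   thinner than [l].  A winding number argument modulo 2 shows that [F] fills one
   side of the strip and misses the other.  The centers of the touching homothets
   are therefore almost aligned, parallel to the chord, and being at distance at
   least [2 * l] from each other there are at most about [N (chord) / (2 * l)] of
   them; conversely that many centers with nearly this spacing can be placed by
   the intermediate value theorem.  The errors are controlled by the differences
   between the lengths of the arcs and of their chords, whose sum is small for a
   fine partition of the boundary into arcs. *)

Require Import Defs.
From HB Require Import structures.
From mathcomp Require Import all_boot all_order all_algebra.
From mathcomp Require Import all_classical all_reals all_analysis.
From mathcomp Require Import ring lra zify.
Import Order.TTheory GRing.Theory Num.Theory numFieldNormedType.Exports.

Set Implicit Arguments.
Unset Strict Implicit.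
Unset Printing Implicit Defensive.

Local Open Scope classical_set_scope.
Local Open Scope ring_scope.

(** * Euclidean structure of the plane *)

Section Euclid.
Variable R : realType.
Local Notation plane := (R * R)%type.
Implicit Types z w e : plane.

(** Straightness is measured with the Euclidean norm although homothets are counted with the norm of
    [B]. The latter may fail to be strictly convex, and then an arc no longer than its chord in that
    norm can be far from straight; a Euclidean excess of length bounds the deviation from the chord
    by Pythagoras. The constant [C] in front of this excess depends on a tolerance [om] and on the
    norm, not on the arc. So the partition is refined once [C] is known, and the ratio [l] is made
    small last. The disk comes with a homeomorphism, which replaces the Jordan curve theorem. Parity
    of winding numbers, coded by continuous square roots, yields invariance of domain, hence the
    boundary as the image of the circle; homotopies carried by the homeomorphism then show that the
    parity is constant inside and constant outside. Rectifiability only provides some Lipschitz map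
    onto the boundary, perhaps not injective, so that the finite length of a simple parametrization
    requires a packing argument of its own. *)

Definition dot z w : R := z.1 * w.1 + z.2 * w.2.
Definition enorm z : R := Num.sqrt (dot z z).
Definition perp z : plane := (- z.2, z.1).
Definition cmul z w : plane := (z.1 * w.1 - z.2 * w.2, z.1 * w.2 + z.2 * w.1).
Definition conjp z : plane := (z.1, - z.2).

Lemma dotvv_ge0 z : 0 <= dot z z.
Proof. by rewrite /dot -!expr2 addr_ge0 ?sqr_ge0. Qed.

Lemma enorm_ge0 z : 0 <= enorm z.
Proof. exact: sqrtr_ge0. Qed.

Lemma sqr_enorm z : enorm z ^+ 2 = dot z z.
Proof. by rewrite /enorm sqr_sqrtr ?dotvv_ge0. Qed.

Lemma dotC z w : dot z w = dot w z.
Proof. rewrite /dot; ring. Qed.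

Lemma dotDr z w e : dot z (w + e) = dot z w + dot z e.
Proof. rewrite /dot /=; ring. Qed.

Lemma dotBr z w e : dot z (w - e) = dot z w - dot z e.
Proof. rewrite /dot /=; ring. Qed.

Lemma dotZr z a w : dot z (a *: w) = a * dot z w.
Proof. rewrite /dot /= /GRing.scale /=; ring. Qed.

Lemma dotNr z w : dot z (- w) = - dot z w.
Proof. rewrite /dot /=; ring. Qed.

Lemma dotr0 z : dot z 0 = 0.
Proof. rewrite /dot /=; ring. Qed.

Lemma dotDl z w e : dot (z + w) e = dot z e + dot w e.
Proof. rewrite /dot /=; ring. Qed.

Lemma dotZl z a w : dot (a *: z) w = a * dot z w.
Proof. rewrite /dot /= /GRing.scale /=; ring. Qed.

Lemma dotvv_eq0 z : (dot z z == 0) = (z == 0).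
Proof.
case: z => x y; rewrite /dot /= -!expr2 paddr_eq0 ?sqr_ge0 // !sqrf_eq0.
by rewrite -pair_eqE.
Qed.

Lemma enorm_eq0 z : (enorm z == 0) = (z == 0).
Proof. by rewrite -sqrf_eq0 sqr_enorm dotvv_eq0. Qed.

Lemma enorm_gt0 z : (0 < enorm z) = (z != 0).
Proof. by rewrite lt_def enorm_ge0 andbT enorm_eq0. Qed.

Lemma enorm0 : enorm 0 = 0.
Proof. by apply/eqP; rewrite enorm_eq0. Qed.

Lemma enormZ a z : enorm (a *: z) = `|a| * enorm z.
Proof.
rewrite /enorm dotZl dotZr mulrA -expr2 sqrtrM ?sqr_ge0 //.
by rewrite sqrtr_sqr.
Qed.

Lemma enormN z : enorm (- z) = enorm z.
Proof. by rewrite -scaleN1r enormZ normrN1 mul1r. Qed.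

Lemma enormB z w : enorm (z - w) = enorm (w - z).
Proof. by rewrite -enormN opprB. Qed.

Lemma enorm_le z a : 0 <= a -> (enorm z <= a) = (dot z z <= a ^+ 2).
Proof. by move=> a0; rewrite -sqr_enorm ler_sqr ?nnegrE ?enorm_ge0. Qed.

Lemma enorm_lt z a : 0 <= a -> (enorm z < a) = (dot z z < a ^+ 2).
Proof. by move=> a0; rewrite -sqr_enorm ltr_sqr ?nnegrE ?enorm_ge0. Qed.

Lemma enorm_perp z : enorm (perp z) = enorm z.
Proof. rewrite /enorm /dot /perp /=; congr Num.sqrt; ring. Qed.

Lemma dot_perp z w : dot (perp z) w = z.1 * w.2 - z.2 * w.1.
Proof. rewrite /dot /=; ring. Qed.

Lemma sqr_dot_perp z w :
  (dot z w) ^+ 2 + (dot (perp z) w) ^+ 2 = dot z z * dot w w.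
Proof. rewrite /dot /=; ring. Qed.

Lemma ler_dot z w : `|dot z w| <= enorm z * enorm w.
Proof.
rewrite -ler_sqr ?nnegrE ?mulr_ge0 ?enorm_ge0 //.
rewrite exprMn !sqr_enorm -sqr_dot_perp real_normK ?num_real //.
by rewrite lerDl sqr_ge0.
Qed.

Lemma ler_enormD z w : enorm (z + w) <= enorm z + enorm w.
Proof.
rewrite enorm_le ?addr_ge0 ?enorm_ge0 // sqrrD !sqr_enorm dotDl !dotDr.
rewrite (dotC w z) mulr2n.
have := le_trans (ler_norm _) (ler_dot z w); lra.
Qed.

Lemma ler_distD_enorm e z w : enorm (z - w) <= enorm (z - e) + enorm (e - w).
Proof. by rewrite (_ : z - w = (z - e) + (e - w)) ?ler_enormD// addrA subrK. Qed.

Lemma ler_dot_unit e z : enorm e = 1 -> `|dot e z| <= enorm z.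
Proof. by move=> e1; have := ler_dot e z; rewrite e1 mul1r. Qed.

Lemma unit_dotE e z : enorm e = 1 ->
  (dot e z) ^+ 2 + (dot (perp e) z) ^+ 2 = enorm z ^+ 2.
Proof. by move=> e1; rewrite sqr_dot_perp -sqr_enorm e1 expr1n mul1r sqr_enorm. Qed.

Lemma unit_decomp e z : enorm e = 1 ->
  z = dot e z *: e + dot (perp e) z *: perp e.
Proof.
move=> e1; have : dot e e = 1 by rewrite -sqr_enorm e1 expr1n.
case: z => x y; rewrite /dot /perp /= /GRing.scale /= => h.
congr (_, _) => /=.
  by rewrite -[LHS]mulr1 -h /GRing.scale /=; ring.
by rewrite -[LHS]mulr1 -h /GRing.scale /=; ring.
Qed.

Lemma enorm_le_coords e z : enorm e = 1 ->
  enorm z <= `|dot e z| + `|dot (perp e) z|.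
Proof.
move=> e1; rewrite {1}(unit_decomp z e1) (le_trans (ler_enormD _ _)) //.
by rewrite !enormZ enorm_perp e1 !mulr1.
Qed.

Lemma normr_pairE z : `|z| = Num.max `|z.1| `|z.2|.
Proof. by []. Qed.

Lemma normr_le_enorm z : `|z| <= enorm z.
Proof.
rewrite normr_pairE ge_max; apply/andP; split.
  rewrite -ler_sqr ?nnegrE ?enorm_ge0 // real_normK ?num_real // sqr_enorm.
  by rewrite /dot -!expr2 lerDl sqr_ge0.
rewrite -ler_sqr ?nnegrE ?enorm_ge0 // real_normK ?num_real // sqr_enorm.
by rewrite /dot -!expr2 lerDr sqr_ge0.
Qed.

Lemma enorm_le_normr z : enorm z <= 2 * `|z|.
Proof.
have h1 : `|z.1| <= `|z| by rewrite normr_pairE le_max lexx.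
have h2 : `|z.2| <= `|z| by rewrite normr_pairE le_max lexx orbT.
have : enorm z <= `|z.1| + `|z.2|.
  rewrite enorm_le ?addr_ge0 // /dot -!expr2 sqrrD !real_normK ?num_real //.
  by rewrite -addrA [_ *+ 2 + _]addrC addrA lerDl mulrn_wge0 // mulr_ge0.
lra.
Qed.

Lemma nbhs_enormP (p : plane) (A : set plane) :
  nbhs p A <-> exists2 d, 0 < d & forall z, enorm (z - p) < d -> A z.
Proof.
split=> [/nbhs_ballP[d /= d0 h]|[d d0 h]].
  exists d => // z hz; apply: h; rewrite -ball_normE /=.
  by rewrite distrC (le_lt_trans (normr_le_enorm _)).
apply/nbhs_ballP; exists (d / 2) => /=; first by rewrite divr_gt0.
move=> z; rewrite -ball_normE /= => hz; apply: h.
rewrite (le_lt_trans (enorm_le_normr _)) // distrC.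
by move: hz; rewrite ltr_pdivlMr // mulrC.
Qed.

Section Continuity.
Variable T : topologicalType.
Implicit Types f g : T -> plane.

Lemma pair_continuous (f g : T -> R) :
  continuous f -> continuous g -> continuous (fun t => (f t, g t) : plane).
Proof.
move=> cf cg t; apply: (@cvg_pair _ _ _ (nbhs t) (nbhs (f t)) (nbhs (g t))).
  exact: cf.
exact: cg.
Qed.

Lemma fst_comp_continuous f : continuous f -> continuous (fun t => (f t).1).
Proof. by move=> cf t; apply: (continuous_comp (cf t)); exact: cvg_fst. Qed.

Lemma snd_comp_continuous f : continuous f -> continuous (fun t => (f t).2).
Proof. by move=> cf t; apply: (continuous_comp (cf t)); exact: cvg_snd. Qed.

Lemma addf_continuous (V : normedModType R) (f g : T -> V) :
  continuous f -> continuous g -> continuous (fun t => f t + g t).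
Proof. by move=> cf cg t; apply: cvgD; [exact: cf|exact: cg]. Qed.

Lemma oppf_continuous (V : normedModType R) (f : T -> V) :
  continuous f -> continuous (fun t => - f t).
Proof. by move=> cf t; apply: cvgN; exact: cf. Qed.

Lemma subf_continuous (V : normedModType R) (f g : T -> V) :
  continuous f -> continuous g -> continuous (fun t => f t - g t).
Proof. by move=> cf cg t; apply: cvgB; [exact: cf|exact: cg]. Qed.

Lemma mulf_continuous (f g : T -> R) :
  continuous f -> continuous g -> continuous (fun t => f t * g t).
Proof. by move=> cf cg t; apply: cvgM; [exact: cf|exact: cg]. Qed.

Lemma invf_continuous (f : T -> R) : (forall t, f t != 0) ->
  continuous f -> continuous (fun t => (f t)^-1).
Proof. by move=> f0 cf t; apply: cvgV => //; exact: cf. Qed.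

Lemma scalef_continuous (f : T -> R) g :
  continuous f -> continuous g -> continuous (fun t => f t *: g t).
Proof. by move=> cf cg t; apply: cvgZ; [exact: cf|exact: cg]. Qed.

Lemma dot_continuous f g :
  continuous f -> continuous g -> continuous (fun t => dot (f t) (g t)).
Proof.
move=> cf cg; apply: addf_continuous; apply: mulf_continuous;
  by [exact: fst_comp_continuous|exact: snd_comp_continuous].
Qed.

Lemma enorm_continuous f : continuous f -> continuous (fun t => enorm (f t)).
Proof.
move=> cf t.
apply: (@continuous_comp _ _ _ (fun t => dot (f t) (f t)) Num.sqrt t).
  exact: dot_continuous.
exact: sqrt_continuous.
Qed.

Lemma cmul_continuous f g :
  continuous f -> continuous g -> continuous (fun t => cmul (f t) (g t)).
Proof.
move=> cf cg.
have [f1 f2] := (fst_comp_continuous cf, snd_comp_continuous cf).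
have [g1 g2] := (fst_comp_continuous cg, snd_comp_continuous cg).
apply: pair_continuous; [apply: subf_continuous|apply: addf_continuous];
  exact: mulf_continuous.
Qed.

Lemma conjp_continuous f :
  continuous f -> continuous (fun t => conjp (f t)).
Proof.
move=> cf; apply: pair_continuous; first exact: fst_comp_continuous.
by apply: oppf_continuous; exact: snd_comp_continuous.
Qed.

End Continuity.
End Euclid.

(** * Winding numbers modulo 2 *)

Section RealLine.
Variable R : realType.

(** Composition with this retraction makes a map given on [0, 1] continuous on the whole line, so
    that no continuity within a subset has to be carried along. *)
Definition clip01 (t : R) : R := Num.max 0 (Num.min t 1).

Lemma clip01_itv t : 0 <= clip01 t <= 1.
Proof.
by rewrite /clip01 le_max lexx /= ge_max ler01 ge_min lexx orbT.
Qed.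

Lemma clip01_id t : 0 <= t <= 1 -> clip01 t = t.
Proof. by case/andP=> t0 t1; rewrite /clip01 min_l // max_r. Qed.

Lemma clip01_continuous : continuous clip01.
Proof.
move=> t; apply: (@continuous_max R R (fun=> 0) (fun t => Num.min t 1) t).
  exact: cvg_cst.
by apply: (@continuous_min R R id (fun=> 1) t); [exact: cvg_id|exact: cvg_cst].
Qed.

Lemma continuous_neq0_same_sign (f : R -> R) (a b : R) : a <= b -> continuous f ->
  (forall t : R, a <= t <= b -> f t != 0) -> 0 < f a * f b.
Proof.
move=> ab cf h.
have [fa fb] : f a != 0 /\ f b != 0 by split; apply: h; rewrite ab lexx.
rewrite ltNge; apply/negP => le0.
have [||t] := @IVT R f a b 0 ab.
- exact: continuous_subspaceT.
- move: fa fb; rewrite !neq_lt => /orP[fa|fa] /orP[fb|fb].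
  + by move: le0; rewrite leNgt nmulr_rgt0 // fb.
  + by rewrite ge_min (ltW fa) /= le_max (ltW fb) orbT.
  + by rewrite ge_min (ltW fb) orbT /= le_max (ltW fa).
  + by move: le0; rewrite leNgt pmulr_rgt0 // fb.
by rewrite in_itv /= => tab /eqP; apply/negP; exact: h.
Qed.

(** The local equivalence makes both the truth set and its complement open, so the truth set is
    clopen in a connected segment. *)
Lemma locally_constant_prop (P : R -> Prop) (a b : R) : a <= b ->
  (forall s, \forall s' \near s, P s' <-> P s) -> P a -> P b.
Proof.
move=> ab loc Pa.
have oP (Q : R -> Prop) : (forall s, \forall s' \near s, Q s' <-> Q s) -> open [set s | Q s].
  move=> locQ; rewrite openE => s /= Qs; apply: filterS (locQ s).
  by move=> s' /= [_ /(_ Qs)].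
have hB : `[a, b] `&` [set s | P s] = `[a, b]%classic.
  apply: (@segment_connected R a b).
  - by exists a; split=> //=; rewrite in_itv /= lexx ab.
  - by exists [set s | P s] => //; exact: oP.
  - exists [set s | P s] => //; rewrite -openC.
    have -> : ~` [set s | P s] = [set s | ~ P s] by [].
    apply: oP => s; apply: filterS (loc s) => s' [h1 h2].
    by split=> h h'; apply: h; [exact: h2|exact: h1].
have : `[a, b]%classic b by rewrite /= in_itv /= lexx ab.
by rewrite -hB => -[].
Qed.

End RealLine.

Section LoopRelation.
Variable R : realType.
Local Notation plane := (R * R)%type.
Implicit Types c r : R -> plane.

(* With [plane] read as the complex numbers, [c1 * conj c2] has a continuous
   square root along the closed path: this says that the nonvanishing loops
   [c1] and [c2] have winding numbers of the same parity. *)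
Definition same_parity c1 c2 := exists r, [/\ continuous r, r 0 = r 1 &
  forall t : R, 0 <= t <= 1 -> cmul (r t) (r t) = cmul (c1 t) (conjp (c2 t))].

Lemma same_parity_refl c : continuous c -> c 0 = c 1 -> same_parity c c.
Proof.
move=> cc c01; exists (fun t => (enorm (c t), 0)); split.
- by apply: pair_continuous; [exact: enorm_continuous|exact: cst_continuous].
- by rewrite c01.
move=> t _; rewrite /cmul /conjp /= -expr2 sqr_enorm /dot; congr pair; ring.
Qed.

Lemma same_parity_sym c1 c2 : same_parity c1 c2 -> same_parity c2 c1.
Proof.
case=> r [cr r01 rE]; exists (fun t => conjp (r t)); split.
- exact: conjp_continuous.
- by rewrite r01.
move=> t /rE [h1 h2]; rewrite /cmul /conjp /=; congr pair.
  by rewrite mulrN mulNr opprK h1 /=; ring.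
have -> : (r t).1 * - (r t).2 + - (r t).2 * (r t).1 =
  - ((r t).1 * (r t).2 + (r t).2 * (r t).1) by ring.
by rewrite h2 /=; ring.
Qed.

Lemma same_parity_trans c1 c2 c3 : continuous c2 -> c2 0 = c2 1 ->
  (forall t, c2 t != 0) ->
  same_parity c1 c2 -> same_parity c2 c3 -> same_parity c1 c3.
Proof.
move=> cc2 c201 c20 [r [cr r01 rE]] [q [cq q01 qE]].
(* The product of the two roots squares to [c1 * conj c3] times the square of [enorm c2]. *)
exists (fun t => (enorm (c2 t))^-1 *: cmul (r t) (q t)); split.
- apply: scalef_continuous; last exact: cmul_continuous.
  apply: invf_continuous; first by move=> t; rewrite enorm_eq0.
  exact: enorm_continuous.
- by rewrite c201 r01 q01.
move=> t t01; have [r1 r2] := rE t t01; have [q1 q2] := qE t t01.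
have n0 : enorm (c2 t) != 0 by rewrite enorm_eq0.
have := sqr_enorm (c2 t); set n := enorm _ in n0 *; rewrite /dot => nE.
case: (r t) r1 r2 => a b /= r1 r2; case: (q t) q1 q2 => a' b' /= q1 q2.
case: (c1 t) r1 r2 => x1 y1 /= r1 r2; case: (c3 t) q1 q2 => x3 y3 /= q1 q2.
case: (c2 t) nE r1 r2 q1 q2 => x2 y2 /= nE r1 r2 q1 q2.
have n2 : n ^+ 2 != 0 by rewrite sqrf_eq0.
rewrite /cmul /conjp /=; congr pair; apply: (mulfI n2).
  transitivity ((a * a - b * b) * (a' * a' - b' * b') -
    (a * b + b * a) * (a' * b' + b' * a')); first by rewrite /GRing.scale /=; field.
  by rewrite r1 r2 q1 q2 nE; ring.
transitivity ((a * a - b * b) * (a' * b' + b' * a') +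
    (a * b + b * a) * (a' * a' - b' * b')); first by rewrite /GRing.scale /=; field.
by rewrite r1 r2 q1 q2 nE; ring.
Qed.

(** Principal branch: on the right half plane the root has a nonzero real part, the square root of
    (|w| + Re w) / 2. It depends on the value of [w] alone, hence closes up whenever [w] does. *)
Lemma half_plane_sqrt (w : R -> plane) : continuous w ->
  (forall t, 0 < (w t).1) ->
  exists r, [/\ continuous r, (forall t t', w t = w t' -> r t = r t') &
    forall t, cmul (r t) (r t) = w t].
Proof.
move=> cw w0.
pose x t := Num.sqrt ((enorm (w t) + (w t).1) / 2).
have x2 t : x t ^+ 2 = (enorm (w t) + (w t).1) / 2.
  by rewrite sqr_sqrtr // divr_ge0 // addr_ge0 ?enorm_ge0 // ltW.
have x0 t : x t != 0.
  by rewrite gt_eqF // sqrtr_gt0 divr_gt0 // ltr_wpDl ?enorm_ge0.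
exists (fun t => (x t, (w t).2 / (2 * x t))); split.
- have cx : continuous x.
    move=> t; apply: (@continuous_comp _ _ _
        (fun t => (enorm (w t) + (w t).1) / 2) Num.sqrt t).
      apply: (@mulf_continuous R R (fun t => enorm (w t) + (w t).1) (fun=> 2^-1)).
        by apply: addf_continuous; [exact: enorm_continuous|exact: fst_comp_continuous].
      exact: cst_continuous.
    exact: sqrt_continuous.
  apply: pair_continuous => //; apply: mulf_continuous.
    exact: snd_comp_continuous.
  apply: invf_continuous; first by move=> t; rewrite mulf_neq0 // pnatr_eq0.
  by apply: mulf_continuous => //; exact: cst_continuous.
- by move=> t t' e; rewrite /x e.
move=> t; rewrite /cmul /=; move: (x2 t) (x0 t) (sqr_enorm (w t)) (w0 t).
have := enorm_ge0 (w t).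
set X := x t; set n := enorm _; rewrite /dot; case: (w t) => a b /=.
move=> n0 X2 X0 nE a0; congr pair; last by field.
have na : n + a != 0 by rewrite gt_eqF // ltr_wpDl.
have -> : b / (2 * X) * (b / (2 * X)) = b * b / (4 * X ^+ 2) by field.
have -> : X * X = X ^+ 2 by [].
rewrite X2; have -> : b * b = n ^+ 2 - a * a by rewrite nE; ring.
by field.
Qed.

(** The inequality forces [c2 * conj c1] into the right half plane, where the principal root is
    available. *)
Lemma same_parity_close c1 c2 : continuous c1 -> continuous c2 ->
  c1 0 = c1 1 -> c2 0 = c2 1 ->
  (forall t : R, 0 <= t <= 1 -> enorm (c2 t - c1 t) < enorm (c1 t)) ->
  same_parity c2 c1.
Proof.
move=> cc1 cc2 e1 e2 h.
pose w t := cmul (c2 (clip01 t)) (conjp (c1 (clip01 t))).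
have cclip (c : R -> plane) : continuous c -> continuous (fun t => c (clip01 t)).
  by move=> cc t; apply: continuous_comp; [exact: clip01_continuous|exact: cc].
have cw : continuous w.
  by apply: cmul_continuous; [|apply: conjp_continuous]; exact: cclip.
have [|r [cr rw rE]] := half_plane_sqrt cw.
  move=> t; have := h _ (clip01_itv t); rewrite enorm_lt ?enorm_ge0 // sqr_enorm.
  rewrite /w /cmul /conjp /dot /=.
  case: (c1 _) => x y; case: (c2 _) => x' y' /= hd.
  nra.
exists r; split => //.
  apply: rw; rewrite /w !clip01_id ?lexx ?ler01 //; by rewrite e1 e2.
by move=> t t01; rewrite rE /w clip01_id.
Qed.

(** Compactness of the loop parameter makes nearby loops uniformly close, so the parity is locally
    constant in [s]. *)
Lemma same_parity_homotopy (H : R -> R -> plane) :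
  continuous (fun p : R * R => H p.1 p.2) ->
  (forall t s, H t s != 0) -> (forall s, H 0 s = H 1 s) ->
  same_parity (H^~ 1) (H^~ 0).
Proof.
move=> cH H0 H01.
have cHs s : continuous (H^~ s).
  move=> t; apply: (@continuous_comp _ _ _ (fun t => (t, s)) (fun p => H p.1 p.2)).
    by apply: (@pair_continuous R R id (fun=> s)); [move=> ?; exact: cvg_id|exact: cst_continuous].
  exact: cH.
apply: (@locally_constant_prop R (fun s => same_parity (H^~ s) (H^~ 0)) 0 1) => //;
  last exact: same_parity_refl.
move=> s.
have : \forall s' \near s, forall t, `[0, 1]%classic t ->
    enorm (H t s' - H t s) < enorm (H t s).
  have := @compact_near_coveringP R `[0, 1]%classic; case=> /(_ (@segment_compact R 0 1)).
  move=> /(_ R (nbhs s) (fun s' t => enorm (H t s' - H t s) < enorm (H t s))) /(_ _) + _.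
  apply=> t _.
  pose D (p : R * R) := enorm (H p.1 s) - enorm (H p.1 p.2 - H p.1 s).
  have cD : continuous D.
    have c1 : continuous (fun p : R * R => H p.1 s).
      move=> p; apply: (@continuous_comp _ _ _ fst (H^~ s) p); last exact: cHs.
      exact: cvg_fst.
    apply: subf_continuous; apply: enorm_continuous => //.
    exact: subf_continuous.
  have D0 : 0 < D (t, s) by rewrite /D /= subrr enorm0 subr0 enorm_gt0.
  have h : \forall p \near ((t, s) : R * R), 0 < D p.
    exact: (cD (t, s) _ (lt_nbhsr D0)).
  change (\forall p \near ((t, s) : R * R),
    enorm (H p.1 p.2 - H p.1 s) < enorm (H p.1 s)).
  by apply: filterS h => p; rewrite /D subr_gt0.
apply: filterS => s' hs'.
have r1 : same_parity (H^~ s') (H^~ s).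
  apply: same_parity_close => // t t01; exact: hs'.
split; apply: same_parity_trans => //.
exact: same_parity_sym.
Qed.

(** A root [r] would satisfy r(t + 1/2)^2 = - r(t)^2, so r(t + 1/2) is r(t) turned by a right angle
    one way or the other. The cross product [s] of the two then never vanishes on [0, 1/2], yet it
    changes sign there because [r 0 = r 1]. *)
Lemma odd_loop_parity c (k : plane) : k != 0 -> (forall t, c t != 0) ->
  (forall t : R, 0 <= t <= 2^-1 -> c (t + 2^-1) = - c t) ->
  ~ same_parity c (fun=> k).
Proof.
move=> k0 c0 codd [r [cr r01 rE]].
pose s t := dot (perp (r t)) (r (t + 2^-1)).
have cs : continuous s.
  have cr' : continuous (fun t : R => r (t + 2^-1)).
    move=> t; apply: (@continuous_comp _ _ _ (fun t : R => t + 2^-1) r); last exact: cr.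
    by apply: cvgD; [exact: cvg_id|exact: cvg_cst].
  apply: dot_continuous => //; apply: pair_continuous.
    by apply: oppf_continuous; exact: snd_comp_continuous.
  exact: fst_comp_continuous.
have := @continuous_neq0_same_sign R s 0 2^-1 _ cs.
have -> : s 2^-1 = - s 0.
  have e : 2^-1 + 2^-1 = 1 :> R by lra.
  by rewrite /s add0r e -r01 !dot_perp; ring.
rewrite mulrN oppr_gt0 => /(_ _)/=; move=> H.
suff : s 0 * s 0 < 0 by rewrite ltNge -expr2 sqr_ge0.
apply: H; first by rewrite invr_ge0.
move=> t /andP[t0 t1]; apply/eqP => st.
have t01 : 0 <= t <= 1 by apply/andP; split=> //; lra.
have t01' : 0 <= t + 2^-1 <= 1 by apply/andP; split; lra.
have [h1 h2] := rE _ t01; have [h1' h2'] := rE _ t01'.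
have : cmul (c t) (conjp k) != 0.
  have := c0 t; rewrite -dotvv_eq0 => ct.
  have := k0; rewrite -dotvv_eq0 => kt; rewrite -dotvv_eq0.
  have -> : dot (cmul (c t) (conjp k)) (cmul (c t) (conjp k)) =
    dot (c t) (c t) * dot k k by rewrite /dot /cmul /conjp /=; ring.
  by rewrite mulf_neq0.
rewrite codd ?t0 // in h1' h2'.
move: st h1 h2 h1' h2'; rewrite /s dot_perp -dotvv_eq0.
rewrite /dot /cmul /conjp /=.
case: (r t) => a b; case: (r (t + _)) => a' b' /=; case: (c t) => x y /=.
set A := x * k.1 - y * - k.2; set B := x * - k.2 + y * k.1.
have -> : - x * k.1 - - y * - k.2 = - A by rewrite /A; ring.
have -> : - x * - k.2 + - y * k.1 = - B by rewrite /B; ring.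
move=> st h1 h2 h1' h2' /negP; apply; apply/eqP.
(* [(a', b')^2 = - (a, b)^2] while [(a', b')] and [(a, b)] are parallel *)
have e1 : (a * a' + b * b') ^+ 2 + (a * b' - b * a') ^+ 2 =
   (a * a + b * b) * (a' * a' + b' * b') by ring.
have e2 : A * (a' * a' - b' * b') + B * (a' * b' + b' * a') =
  (a * a' + b * b') ^+ 2 - (a * b' - b * a') ^+ 2.
  by rewrite -h1 -h2; ring.
move: e2; rewrite h1' h2' st expr0n subr0 => e2.
have := sqr_ge0 (a * a' + b * b').
rewrite -e2 => e3.
have A0 := sqr_ge0 A; have B0 := sqr_ge0 B; nra.
Qed.

(* The square root would have a nonvanishing real part off the window and a
   nonvanishing imaginary part on it, hence the same signs at both ends of the
   window; but the curve changes sides there. *)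
Lemma crossing_parity (g : R -> plane) (p e : plane) (Y a b : R) :
  continuous g -> g 0 = g 1 -> 0 <= a <= b -> b <= 1 -> 0 < Y -> enorm e = 1 ->
  (forall t : R, a <= t <= b -> enorm (g t - p) < Y) ->
  (forall t : R, 0 <= t <= a \/ b <= t <= 1 ->
     dot e (g t - p) != 0 \/ Y < enorm (g t - p)) ->
  dot e (g a - p) < 0 < dot e (g b - p) ->
  ~ same_parity (fun t => g t - (p + Y *: perp e)) (fun t => g t - (p - Y *: perp e)).
Proof.
move=> cg g01 /andP[a0 ab] b1 Y0 e1 inw outw /andP[ga gb] [r [cr r01 rE]].
(* With z = g t - p and w = Y perp e, the product (z - w) conj (z + w) has real part |z|^2 - Y^2 and
   imaginary part - 2 Y (e . z). *)
have key (t : R) : 0 <= t <= 1 ->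
  [/\ (r t).1 ^+ 2 - (r t).2 ^+ 2 = enorm (g t - p) ^+ 2 - Y ^+ 2 &
  (r t).1 * (r t).2 = - Y * dot e (g t - p)].
  move=> /rE[h1 h2]; have : dot e e = 1 by rewrite -sqr_enorm e1 expr1n.
  rewrite sqr_enorm [(r t).1 ^+ 2]expr2 [(r t).2 ^+ 2]expr2 h1.
  have -> : (r t).1 * (r t).2 = ((r t).1 * (r t).2 + (r t).2 * (r t).1) / 2 by field.
  rewrite h2 /dot /perp /conjp /=; case: (g t) => x y; case: (p) => p1 p2 /=.
  case: (e) => u v /= uv; rewrite /GRing.scale /=; split.
    transitivity ((x - p1) * (x - p1) + (y - p2) * (y - p2) - Y * Y * (u * u + v * v)); first by ring.
    by rewrite uv; ring.
  by field.
have c1 := fst_comp_continuous cr; have c2 := snd_comp_continuous cr.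
have re0 (t : R) : 0 <= t <= 1 -> 0 <= t <= a \/ b <= t <= 1 -> (r t).1 != 0.
  move=> t01 /outw out; apply/eqP => r0; have [h1 h2] := key t t01.
  move: h1 h2; rewrite r0 mul0r expr0n sub0r => h1 /eqP.
  rewrite eq_sym mulf_eq0 oppr_eq0 gt_eqF //= => /eqP d0; case: out => [/eqP//|lt].
  have := sqr_ge0 (r t).2; have := enorm_ge0 (g t - p); nra.
have im0 (t : R) : a <= t <= b -> (r t).2 != 0.
  move=> tab; apply/eqP => r0; have [|h1 _] := key t.
    by case/andP: tab => ? ?; apply/andP; split; lra.
  move: h1; rewrite r0 expr0n subr0 => h1; have := inw t tab.
  have := sqr_ge0 (r t).1; have := enorm_ge0 (g t - p); nra.
have s1 : 0 < (r 0).1 * (r a).1.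
  apply: (@continuous_neq0_same_sign R (fun t => (r t).1)) => // t /andP[t0 ta].
  by apply: re0; [apply/andP; split; lra|left; rewrite t0].
have s2 : 0 < (r b).1 * (r 1).1.
  apply: (@continuous_neq0_same_sign R (fun t => (r t).1)) => // t /andP[t0 ta].
  by apply: re0; [apply/andP; split; lra|right; rewrite t0].
have s3 : 0 < (r a).2 * (r b).2.
  exact: (@continuous_neq0_same_sign R (fun t => (r t).2)).
have [|_ ka] := key a; first by rewrite a0 (le_trans ab).
have [|_ kb] := key b; first by rewrite (le_trans a0) // b1.
have l1 : 0 < (r a).1 * (r a).2 by rewrite ka; nra.
have l2 : (r b).1 * (r b).2 < 0 by rewrite kb; nra.
rewrite r01 in s1.
have : 0 < ((r a).1 * (r b).1) * ((r a).2 * (r b).2).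
  rewrite mulr_gt0 //.
  have : 0 < ((r a).1 * (r b).1) * ((r 1).1 ^+ 2).
    have -> : (r a).1 * (r b).1 * (r 1).1 ^+ 2 =
      ((r 1).1 * (r a).1) * ((r b).1 * (r 1).1) by ring.
    exact: mulr_gt0.
  have := sqr_ge0 (r 1).1; nra.
have -> : ((r a).1 * (r b).1) * ((r a).2 * (r b).2) =
  ((r a).1 * (r a).2) * ((r b).1 * (r b).2) by ring.
nra.
Qed.

End LoopRelation.

(** * Invariance of domain and the two sides of the boundary curve *)

Section Circle.
Variable R : realType.
Local Notation plane := (R * R)%type.

Definition ucirc (t : R) : plane := (cos (2 * pi * t), sin (2 * pi * t)).

Lemma ucirc_continuous : continuous ucirc.
Proof.
have c2 : continuous (fun t : R => 2 * pi * t).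
  by apply: mulf_continuous; [exact: cst_continuous|move=> ?; exact: cvg_id].
apply: pair_continuous => t.
  by apply: (@continuous_comp _ _ _ (fun t : R => 2 * pi * t) cos t);
    [exact: c2|exact: continuous_cos].
by apply: (@continuous_comp _ _ _ (fun t : R => 2 * pi * t) sin t);
  [exact: c2|exact: continuous_sin].
Qed.

Lemma enorm_ucirc t : enorm (ucirc t) = 1.
Proof. by rewrite /enorm /dot /= -!expr2 cos2Dsin2 sqrtr1. Qed.

Lemma ucirc_half t : ucirc (t + 2^-1) = - ucirc t.
Proof.
rewrite /ucirc.
have -> : 2 * pi * (t + 2^-1) = 2 * pi * t + pi :> R by field.
by rewrite cosDpi sinDpi.
Qed.

Lemma ucirc01 : ucirc 0 = ucirc 1.
Proof.
have e : 2^-1 + 2^-1 = 1 :> R by lra.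
have <- : ucirc (0 + 2^-1 + 2^-1) = ucirc 0 by rewrite !ucirc_half opprK.
by rewrite add0r e.
Qed.

Lemma ucirc_inj : {in `[0, 1[ &, injective ucirc}.
Proof.
have pi0 := pi_gt0 R.
suff H a b : 0 <= a <= b -> b < 1 -> ucirc a = ucirc b -> a = b.
  move=> a b; rewrite !in_itv /= => /andP[a0 a1] /andP[b0 b1] ab.
  by case: (leP a b) => [l|/ltW l]; [|apply/esym]; apply: H => //; rewrite ?a0 ?b0.
have cos_eq1 (u : R) : 0 <= u <= pi -> cos u = 1 -> u = 0.
  move=> upi cu; apply: cos_inj; rewrite ?cos0 // in_itv //=.
  by rewrite lexx ltW.
move=> /andP[a0 ab] b1 [ec es].
have e1 : cos (2 * pi * (b - a)) = 1.
  by rewrite mulrBr cosB -ec -es -!expr2 cos2Dsin2.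
have [l|l] := leP (2 * pi * (b - a)) pi.
  have : 2 * pi * (b - a) = 0.
    apply: cos_eq1 => //; rewrite l andbT mulr_ge0 ?subr_ge0 //.
    by rewrite mulr_ge0 // ltW.
  by move/eqP; rewrite mulf_eq0 gt_eqF ?mulr_gt0 //= subr_eq0 => /eqP.
(* An angle beyond pi is replaced by its complement to a full turn, where the cosine is
   injective. *)
have e2 : cos (2 * pi * (1 - (b - a))) = 1.
  have -> : 2 * pi * (1 - (b - a)) = pi *+ 2 - 2 * pi * (b - a) by rewrite mulr2n; ring.
  rewrite cosB e1 cos2pi mul1r.
  have -> : sin (pi *+ 2) = 0 :> R by rewrite sin2pi.
  by rewrite mul0r addr0.
have : 2 * pi * (1 - (b - a)) = 0.
  apply: cos_eq1 => //; apply/andP; split; last by nra.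
  by rewrite mulr_ge0 ?mulr_ge0 ?(ltW pi0) //; lra.
move/eqP; rewrite mulf_eq0 gt_eqF ?mulr_gt0 //= => /eqP; lra.
Qed.

Lemma ucirc_surj (z : plane) : enorm z = 1 -> exists2 t, 0 <= t <= 1 & ucirc t = z.
Proof.
have pi0 := pi_gt0 R => z1.
have d1 : z.1 ^+ 2 + z.2 ^+ 2 = 1.
  by have := sqr_enorm z; rewrite z1 expr1n /dot => ->; ring.
have x1 : -1 <= z.1 <= 1 by rewrite -ler_norml -ler_sqr ?nnegrE // real_normK ?num_real //
   expr1n -d1 lerDl sqr_ge0.
have [/andP[a0 api] ca] := acos_def x1.
have sa := sin_acos x1.
have sE : Num.sqrt (1 - z.1 ^+ 2) = `|z.2|.
  by rewrite -d1 addrAC subrr add0r sqrtr_sqr.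
rewrite sE in sa.
pose t := acos z.1 / (2 * pi).
have tE : 2 * pi * t = acos z.1 by rewrite mulrC divfK // gt_eqF // mulr_gt0.
have t01 : 0 <= t <= 2^-1.
  apply/andP; split; first by rewrite divr_ge0 // mulr_ge0 // ltW.
  by rewrite /t ler_pdivrMr ?mulr_gt0 // mulrA mulVf // mul1r.
have [z2|z2] := leP 0 z.2.
  exists t; first by lra.
  by rewrite /ucirc tE ca sa ger0_norm //; case: (z).
exists (1 - t); first by lra.
rewrite /ucirc mulrBr mulr1 tE mulr_natl cosB sinB cos2pi sin2pi ca sa ltr0_norm //.
by rewrite mul1r !mul0r addr0 sub0r mul1r opprK; case: (z).
Qed.

End Circle.

Section Domain.
Variable R : realType.
Local Notation plane := (R * R)%type.
Implicit Types (f : plane -> plane) (F : set plane).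

Lemma comp_cont (T U V : topologicalType) (f : U -> V) (k : T -> U) :
  continuous f -> continuous k -> continuous (fun t => f (k t)).
Proof. by move=> cf ck t; apply: continuous_comp; [exact: ck|exact: cf]. Qed.

(* Brouwer's invariance of domain: sliding from [f (z0 + x) - f z0] to
   [f (z0 + x / 2) - f (z0 - x / 2)] through nonvanishing loops shows that the
   boundary loop winds an odd number of times around [f z0]. *)
Lemma invariance_of_domain f z0 rho : 0 < rho -> continuous f ->
  (forall z w, enorm (z - z0) <= rho -> enorm (w - z0) <= rho ->
     f z = f w -> z = w) ->
  nbhs (f z0) (f @` [set z | enorm (z - z0) <= rho]).
Proof.
move=> rho0 cf finj; apply: contrapT => nK.
have cC := @ucirc_continuous R.
have dK (a : R) t : 0 <= a <= rho -> enorm (z0 + a *: ucirc t - z0) <= rho.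
  by case/andP=> a0 a1; rewrite addrC addKr enormZ enorm_ucirc mulr1 ger0_norm.
have dN (a : R) t : 0 <= a <= rho -> enorm (z0 - a *: ucirc t - z0) <= rho.
  by case/andP=> a0 a1; rewrite addrC addKr enormN enormZ enorm_ucirc mulr1 ger0_norm.
have d0 : enorm (z0 - z0) <= rho by rewrite subrr enorm0 ltW.
have rr : 0 <= rho <= rho by rewrite lexx ltW.
have uneq (a b : R) t : 0 < a + b -> z0 + a *: ucirc t != z0 - b *: ucirc t.
  move=> ab; apply/eqP => /addrI/eqP; rewrite -subr_eq0 opprK -scalerDl.
  by rewrite -enorm_eq0 enormZ enorm_ucirc mulr1 normr_eq0 gt_eqF.
pose c0 t := f (z0 + rho *: ucirc t) - f z0.
have cc0 : continuous c0.
  apply: subf_continuous; last exact: cst_continuous.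
  apply: comp_cont => //; apply: addf_continuous; first exact: cst_continuous.
  by apply: scalef_continuous => //; exact: cst_continuous.
have c00 t : c0 t != 0.
  rewrite subr_eq0; apply/eqP => /finj -/(_ (dK _ _ rr) d0).
  move/eqP; rewrite -subr_eq0 addrC addKr -enorm_eq0 enormZ enorm_ucirc mulr1.
  by rewrite normr_eq0 gt_eqF.
have c001 : c0 0 = c0 1 by rewrite /c0 ucirc01.
have [m m0 hm] : exists2 m, 0 < m & forall t, 0 <= t <= 1 -> m <= enorm (c0 t).
  have [||t _ ht] := @EVT_min R (fun t => enorm (c0 t)) 0 1 => //.
    by apply: continuous_subspaceT; exact: enorm_continuous.
  by exists (enorm (c0 t)); rewrite ?enorm_gt0.
(* The image is not a neighborhood of [f z0], so it misses a point [q] that is closer to [f z0] than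
   the whole boundary loop; replacing [f z0] by [q] then preserves the parity. *)
have [q qm qK] : exists2 q, enorm (q - f z0) < m &
    ~ (f @` [set z | enorm (z - z0) <= rho]) q.
  apply: contrapT => nq; apply: nK; apply/nbhs_enormP; exists m => // q qm.
  by apply: contrapT => qK; apply: nq; exists q.
pose cq t := f (z0 + rho *: ucirc t) - q.
have ccq : continuous cq.
  apply: subf_continuous; last exact: cst_continuous.
  apply: comp_cont => //; apply: addf_continuous; first exact: cst_continuous.
  by apply: scalef_continuous => //; exact: cst_continuous.
have cq01 : cq 0 = cq 1 by rewrite /cq ucirc01.
have cq0 t : cq t != 0.
  rewrite subr_eq0; apply/eqP => e; apply: qK.
  by exists (z0 + rho *: ucirc t) => //=; exact: dK.
have R1 : same_parity cq c0.
  apply: same_parity_close => // t t01.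
  have -> : cq t - c0 t = - (q - f z0).
    by rewrite /cq /c0 !opprB addrC addrA subrK.
  by rewrite enormN; apply: lt_le_trans qm _; exact: hm.
have cclip1 : continuous (fun p : R * R => clip01 p.2).
  by apply: comp_cont; [exact: clip01_continuous|move=> ?; exact: cvg_snd].
have cC1 : continuous (fun p : R * R => ucirc p.1).
  by apply: comp_cont => // => ?; exact: cvg_fst.
have clip1 : clip01 1 = 1 :> R by rewrite clip01_id // ler01 lexx.
have clip0 : clip01 0 = 0 :> R by rewrite clip01_id // ler01 lexx.
(* The image misses [q], so the circle can be shrunk to its center without the loop meeting [q]. *)
have R2 : same_parity cq (fun=> f z0 - q).
  pose H t s := f (z0 + (clip01 s * rho) *: ucirc t) - q.
  have := @same_parity_homotopy R H; rewrite /H clip1 clip0 mul1r mul0r.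
  have -> : (fun t => f (z0 + 0 *: ucirc t) - q) = (fun=> f z0 - q).
    by apply/funext => t; rewrite scale0r addr0.
  apply.
  - apply: subf_continuous; last exact: cst_continuous.
    apply: comp_cont => //; apply: addf_continuous; first exact: cst_continuous.
    apply: scalef_continuous => //; apply: mulf_continuous => //.
    exact: cst_continuous.
  - move=> t s; rewrite subr_eq0; apply/eqP => e; apply: qK.
    exists (z0 + (clip01 s * rho) *: ucirc t) => //=; apply: dK.
    have /andP[s0 s1] := clip01_itv s.
    by rewrite mulr_ge0 ?(ltW rho0) //= ler_piMl // ltW.
  - by move=> s; rewrite ucirc01.
pose co t := f (z0 + (rho / 2) *: ucirc t) - f (z0 - (rho / 2) *: ucirc t).
have r20 : 0 <= rho / 2 <= rho by rewrite divr_ge0 ?ltW //=; lra.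
have R3 : same_parity co c0.
  (* This radius keeps the two points compared at the constant distance [rho], so injectivity
     prevents the difference from vanishing; [s = 0] gives [c0] and [s = 1] the odd loop [co]. *)
  pose a s := rho / (1 + clip01 s).
  pose H t s := f (z0 + a s *: ucirc t) - f (z0 - (clip01 s * a s) *: ucirc t).
  have ha s : 0 < a s <= rho.
    have /andP[s0 s1] := clip01_itv s.
    rewrite divr_gt0 //=; last by lra.
    by rewrite ler_pdivrMr; nra.
  have := @same_parity_homotopy R H; rewrite /H /a clip1 clip0 mul1r mul0r addr0 divr1.
  have -> : (fun t => f (z0 + rho *: ucirc t) - f (z0 - 0 *: ucirc t)) = c0.
    by apply/funext => t; rewrite scale0r subr0.
  apply.
  - have cca : continuous (fun p : R * R => rho / (1 + clip01 p.2)).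
      apply: mulf_continuous; first exact: cst_continuous.
      apply: invf_continuous; first by move=> p; have := clip01_itv p.2; lra.
      by apply: addf_continuous => //; exact: cst_continuous.
    apply: subf_continuous; apply: comp_cont => //.
      apply: addf_continuous; first exact: cst_continuous.
      exact: scalef_continuous.
    apply: subf_continuous; first exact: cst_continuous.
    by apply: scalef_continuous => //; exact: mulf_continuous.
  - move=> t s; have /andP[s0 s1] := clip01_itv s; have /andP[a0 a1] := ha s.
    rewrite subr_eq0; apply/eqP => /finj e.
    have /eqP : z0 + a s *: ucirc t = z0 - (clip01 s * a s) *: ucirc t.
      apply: e; [by apply: dK; rewrite a1 andbT ltW|apply: dN].
      by rewrite -/(a s) mulr_ge0 ?(ltW a0) //= (le_trans _ a1) // ler_piMl // ltW.
    by apply/negP/uneq; rewrite ltr_wpDr // mulr_ge0 // ltW.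
  - by move=> s; rewrite ucirc01.
have k0 : f z0 - q != 0.
  rewrite subr_eq0; apply/eqP => e; apply: qK; exists z0 => //=.
apply: (@odd_loop_parity R co (f z0 - q)) => //.
- move=> t; rewrite subr_eq0; apply/eqP => /finj -/(_ (dK _ _ r20) (dN _ _ r20)).
  by apply/eqP; apply: uneq; rewrite -splitr.
- by move=> t _; rewrite /co ucirc_half !scalerN opprK opprB.
apply: same_parity_trans R2 => //; apply: same_parity_trans R3 _ => //.
exact: same_parity_sym.
Qed.

Lemma within_comp_continuous (T U V : topologicalType) (A : set U) (f : U -> V)
  (k : T -> U) : {within A, continuous f} -> continuous k ->
  (forall t, A (k t)) -> continuous (fun t => f (k t)).
Proof.
move=> /subspace_continuousP cf ck Ak t.
apply: cvg_comp (cf _ (Ak t)) => B /=; rewrite /within /= => h.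
have := ck t _ h; rewrite /nbhs /=; apply: filterS => s; exact.
Qed.

Definition disk_retract (z : plane) : plane := (Num.max 1 (enorm z))^-1 *: z.

Lemma disk_retract_continuous : continuous disk_retract.
Proof.
have m0 (z : plane) : Num.max 1 (enorm z) != 0.
  by rewrite gt_eqF // lt_max ltr01.
apply: scalef_continuous; last by move=> ?; exact: cvg_id.
apply: invf_continuous => // z.
apply: (@continuous_max R _ (fun=> 1) (@enorm R) z); first exact: cvg_cst.
by apply: enorm_continuous => ?; exact: cvg_id.
Qed.

Lemma disk_retract_id z : enorm z <= 1 -> disk_retract z = z.
Proof. by move=> z1; rewrite /disk_retract max_l // invr1 scale1r. Qed.

Lemma enorm_disk_retract z : enorm (disk_retract z) <= 1.
Proof.
have m0 : 0 < Num.max 1 (enorm z) by rewrite lt_max ltr01.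
rewrite /disk_retract enormZ ger0_norm ?invr_ge0 ?(ltW m0) //.
rewrite mulrC ler_pdivrMr // mul1r; by rewrite le_max lexx orbT.
Qed.

Lemma closed_unit_diskE : @closed_unit_disk R = [set z | enorm z <= 1].
Proof.
apply/seteqP; split=> z /=; rewrite enorm_le ?ler01 // /dot -!expr2 expr1n //.
Qed.

(** Precomposing with the radial retraction makes [h] continuous on the whole plane with all its
    values in [F]; only the inverse keeps a continuity restricted to [F]. *)
Lemma disk_parametrization F : topological_disk F ->
  exists h hi : plane -> plane, [/\ continuous h,
   (forall z, F (h z)),
   (forall z, enorm z <= 1 -> hi (h z) = z),
   (forall x, F x -> enorm (hi x) <= 1 /\ h (hi x) = x) &
   {within F, continuous hi}].
Proof.
case=> f [g [fF gF [fg gf] cf cg]]; rewrite closed_unit_diskE in fF gF fg cf.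
have hr z : enorm (disk_retract z) <= 1 := enorm_disk_retract z.
exists (fun z => f (disk_retract z)), g; split => //.
- by apply: within_comp_continuous cf disk_retract_continuous _.
- by move=> z; apply: fF; exact: hr.
- by move=> z z1; rewrite disk_retract_id // fg // inE.
- move=> x Fx; have := gF _ Fx => /= gx1; split=> //.
  by rewrite disk_retract_id // gf // inE.
Qed.

Lemma unit_disk_compact : compact [set z : plane | enorm z <= 1].
Proof.
have -> : [set z : plane | enorm z <= 1] =
    (`[-1, 1]%classic `*` `[-1, 1]%classic) `&` [set z | enorm z <= 1].
  apply/esym/setIidr => z /= z1; have := le_trans (normr_le_enorm z) z1.
  by rewrite normr_pairE ge_max !ler_norml !in_itv /= => /andP[-> ->].
apply: compact_closedI; first by apply: compact_setX; exact: segment_compact.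
apply: (@preimage_closed _ _ (@enorm R) [set x | x <= 1]); last exact: closed_le.
by move=> z _; apply: enorm_continuous => ?; exact: cvg_id.
Qed.

(** * Interior, boundary and sides of a closed topological disk *)

Section Disk.
Variables (F : set plane) (h hi : plane -> plane).
Hypotheses (ch : continuous h) (hF : forall z, F (h z))
  (hK : forall z, enorm z <= 1 -> hi (h z) = z)
  (hiK : forall x, F x -> enorm (hi x) <= 1 /\ h (hi x) = x)
  (chi : {within F, continuous hi}).

Lemma disk_image : F = h @` [set z | enorm z <= 1].
Proof.
apply/seteqP; split=> [x /hiK[h1 h2]|_ [z _ <-]]; last exact: hF.
by exists (hi x).
Qed.

Lemma disk_closed : closed F.
Proof.
apply: compact_closed; first exact: norm_hausdorff.
rewrite disk_image; apply: continuous_compact; last exact: unit_disk_compact.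
exact: continuous_subspaceT.
Qed.

Lemma disk_interior z : enorm z < 1 -> F° (h z).
Proof.
move=> z1; have rho0 : 0 < 1 - enorm z by rewrite subr_gt0.
have hw w : enorm (w - z) <= 1 - enorm z -> enorm w <= 1.
  by move=> hw; rewrite -(subrK z w) (le_trans (ler_enormD _ _)) //; lra.
have : nbhs (h z) (h @` [set w | enorm (w - z) <= 1 - enorm z]).
  apply: invariance_of_domain => // a b /hw a1 /hw b1 e.
  by rewrite -(hK a1) e hK.
by apply: filterS => _ [w _ <-]; exact: hF.
Qed.

(** If [h z] were interior, [hi] would be injective and continuous on a small disk around it, so its
    image would be a neighborhood of [z]. But [hi] takes values in the unit disk, of which [z] is a
    boundary point. The retraction [k] onto the small disk supplies a map defined on the whole
    plane. *)
Lemma disk_circle_interior z : enorm z = 1 -> ~ F° (h z).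
Proof.
move=> z1 /nbhs_enormP[d d0 hd].
pose rho := d / 2; have rho0 : 0 < rho by rewrite divr_gt0.
pose k x := h z + rho *: disk_retract (rho^-1 *: (x - h z)).
have kF x : F (k x).
  apply: hd; rewrite /k addrC addKr enormZ gtr0_norm //.
  by have := enorm_disk_retract (rho^-1 *: (x - h z)); rewrite /rho; nra.
have ck : continuous k.
  apply: addf_continuous; first exact: cst_continuous.
  apply: scalef_continuous; first exact: cst_continuous.
  apply: comp_cont; first exact: disk_retract_continuous.
  apply: scalef_continuous; first exact: cst_continuous.
  by apply: subf_continuous; [move=> ?; exact: cvg_id|exact: cst_continuous].
have kid x : enorm (x - h z) <= rho -> k x = x.
  move=> hx; rewrite /k disk_retract_id.
    by rewrite scalerA mulfV ?gt_eqF // scale1r addrC subrK.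
  by rewrite enormZ gtr0_norm ?invr_gt0 // mulrC ler_pdivrMr // mul1r.
have : nbhs (hi (k (h z))) ((fun x => hi (k x)) @` [set x | enorm (x - h z) <= rho]).
  apply: (@invariance_of_domain (fun x => hi (k x))) => //.
    exact: within_comp_continuous ck kF.
  move=> x y hx hy; rewrite !kid // => e.
  have [_] := hiK (kF x); have [_] := hiK (kF y).
  by rewrite !kid // e => e1 <-.
rewrite kid ?subrr ?enorm0 ?ltW // hK ?z1 //.
move/nbhs_enormP => [r r0 hr].
have : enorm ((1 + r / 2) *: z - z) < r.
  have -> : (1 + r / 2) *: z - z = (r / 2) *: z by rewrite scalerDl scale1r addrC addKr.
  by rewrite enormZ z1 mulr1 gtr0_norm ?divr_gt0 //; lra.
move/hr => [x _ e]; have [+ _] := hiK (kF x); rewrite e enormZ z1 mulr1.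
rewrite ger0_norm; last by lra.
lra.
Qed.

Lemma disk_boundaryE : boundary F = F `\` F°.
Proof.
rewrite /boundary; congr (_ `\` _); apply/esym.
by apply/closure_id; exact: disk_closed.
Qed.

Lemma disk_boundary : boundary F = h @` [set z | enorm z = 1].
Proof.
rewrite disk_boundaryE; apply/seteqP; split=> [x [Fx nx]|_ [z z1 <-]].
  have [h1 h2] := hiK Fx; exists (hi x) => //=; apply/eqP.
  rewrite eq_le h1 leNgt /=; apply/negP => /disk_interior.
  by rewrite h2.
by split; [exact: hF|exact: disk_circle_interior].
Qed.

Lemma disk_boundary_path : simple_closed_path (fun t => h (ucirc t)) (boundary F).
Proof.
split.
- apply: continuous_subspaceT; apply: comp_cont => //; exact: ucirc_continuous.
- by rewrite ucirc01.
- move=> s t hs ht e; apply: ucirc_inj => //.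
  by rewrite -(@hK (ucirc s)) ?enorm_ucirc // e hK // enorm_ucirc.
rewrite disk_boundary; apply/seteqP; split=> [_ [t _ <-]|_ [z z1 <-]].
  by exists (ucirc t) => //=; exact: enorm_ucirc.
by have [t t01 <-] := ucirc_surj z1; exists t => //=; rewrite in_itv.
Qed.

(** Every complex number has a square root; the sign of the imaginary part of [w] decides between
    the two formulas. *)
Lemma constant_loops_parity (k k' : plane) : k != 0 -> k' != 0 ->
  same_parity (fun=> k) (fun=> k').
Proof.
move=> k0 k'0.
suff [r rE] : exists r, cmul r r = cmul k (conjp k').
  by exists (fun=> r); split => //; exact: cst_continuous.
set w := cmul _ _.
have n2 := sqr_enorm w; have n0 := enorm_ge0 w; set n := enorm w in n2 n0 *.
rewrite /dot in n2.
have na : `|w.1| <= n by rewrite (le_trans _ (normr_le_enorm w)) // normr_pairE le_max lexx.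
have [na1 na2] : 0 <= (n + w.1) / 2 /\ 0 <= (n - w.1) / 2.
  by move: na; rewrite ler_norml; split; lra.
pose x := Num.sqrt ((n + w.1) / 2); pose y := Num.sqrt ((n - w.1) / 2).
have x2 : x * x = (n + w.1) / 2 by rewrite -expr2 sqr_sqrtr.
have y2 : y * y = (n - w.1) / 2 by rewrite -expr2 sqr_sqrtr.
have xy : 2 * (x * y) = `|w.2|.
  apply/eqP; rewrite -(@eqrXn2 _ 2) ?mulr_ge0 ?sqrtr_ge0 // real_normK ?num_real //.
  have -> : (2 * (x * y)) ^+ 2 = 4 * (x * x) * (y * y) by ring.
  rewrite x2 y2; apply/eqP.
  have -> : w.2 ^+ 2 = n ^+ 2 - w.1 * w.1 by rewrite n2; ring.
  by field.
have [w2|w2] := leP 0 w.2.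
  exists (x, y); rewrite /cmul /=; rewrite ger0_norm // in xy.
  rewrite x2 y2 [y * x]mulrC; case: (w) xy x2 y2 => a b /= xy _ _.
  by congr pair; [field|rewrite -xy; ring].
exists (x, - y); rewrite /cmul /=; rewrite ltr0_norm // in xy.
rewrite mulrNN x2 y2; case: (w) xy x2 y2 => a b /= xy _ _.
congr pair; first by field.
rewrite -[b]opprK -xy; ring.
Qed.

(** * Winding parity of the boundary curve around interior and exterior points *)

Section Sides.
Variable G : R -> plane.
Hypotheses (cG : continuous G) (GF : forall t, boundary F (G t)) (G01 : G 0 = G 1).

Let GF' t : F (G t).
Proof. by have := GF t; rewrite disk_boundaryE => -[]. Qed.

(** The homeomorphism contracts the curve to [h 0] inside [F], hence without meeting a point outside
    [F]: both loops have the parity of a constant. *)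
Lemma exterior_parity (q q' : plane) : ~ F q -> ~ F q' ->
  same_parity (fun t => G t - q) (fun t => G t - q').
Proof.
move=> nq nq'.
have cst_par (p : plane) : ~ F p -> same_parity (fun t => G t - p) (fun=> h 0 - p).
  move=> np; pose H t s := h (clip01 s *: hi (G t)) - p.
  have := @same_parity_homotopy R H; rewrite /H !clip01_id ?lexx ?ler01 //.
  have -> : (fun t => h (0 *: hi (G t)) - p) = (fun=> h 0 - p).
    by apply/funext => t; rewrite scale0r.
  have -> : (fun t => h (1 *: hi (G t)) - p) = (fun t => G t - p).
    by apply/funext => t; rewrite scale1r; have [_ ->] := hiK (GF' t).
  apply.
  - apply: subf_continuous; last exact: cst_continuous.
    apply: comp_cont => //; apply: scalef_continuous.
      by apply: comp_cont; [exact: clip01_continuous|move=> ?; exact: cvg_snd].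
    apply: within_comp_continuous chi _ _; last by move=> ?; exact: GF'.
    by apply: comp_cont => // => ?; exact: cvg_fst.
  - by move=> t s; rewrite subr_eq0; apply/eqP => e; apply: np; rewrite -e.
  - by move=> s; rewrite G01.
have k0 (p : plane) : ~ F p -> h 0 - p != 0.
  by move=> np; rewrite subr_eq0; apply/eqP => e; apply: np; rewrite -e.
apply: (@same_parity_trans R _ (fun=> h 0 - q)) (cst_par _ nq) _ => //.
- exact: cst_continuous.
- by move=> _; exact: k0.
apply: (@same_parity_trans R _ (fun=> h 0 - q')) => //.
- exact: cst_continuous.
- by move=> _; exact: k0.
- by apply: constant_loops_parity; exact: k0.
exact/same_parity_sym/cst_par.
Qed.

(** The preimages of the two points are joined by a segment of the open disk; its image stays
    interior and so never meets the boundary curve. *)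
Lemma interior_parity (q q' : plane) : F° q -> F° q' ->
  same_parity (fun t => G t - q) (fun t => G t - q').
Proof.
have pre (p : plane) : F° p -> exists2 z, enorm z < 1 & p = h z.
  move=> ip; have Fp := interior_subset ip; have [h1 h2] := hiK Fp.
  exists (hi p) => //; rewrite lt_neqAle h1 andbT; apply/eqP => e.
  by apply: (disk_circle_interior e); rewrite h2.
move=> /pre[z z1 ->] /pre[z' z'1 ->].
pose H t s := G t - h (z' + clip01 s *: (z - z')).
have := @same_parity_homotopy R H; rewrite /H !clip01_id ?lexx ?ler01 //.
have -> : (fun t => G t - h (z' + 0 *: (z - z'))) = (fun t => G t - h z').
  by apply/funext => t; rewrite scale0r addr0.
have -> : (fun t => G t - h (z' + 1 *: (z - z'))) = (fun t => G t - h z).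
  by apply/funext => t; rewrite scale1r [z' + _]addrC subrK.
apply.
- apply: subf_continuous; first by apply: comp_cont => // => ?; exact: cvg_fst.
  apply: comp_cont => //; apply: addf_continuous; first exact: cst_continuous.
  apply: scalef_continuous; last exact: cst_continuous.
  by apply: comp_cont; [exact: clip01_continuous|move=> ?; exact: cvg_snd].
- move=> t s; rewrite subr_eq0; apply/eqP => e.
  have : F° (G t).
    rewrite e; apply: disk_interior.
    have /andP[s0 s1] := clip01_itv s; set a := clip01 s in s0 s1 *.
    have -> : z' + a *: (z - z') = (1 - a) *: z' + a *: z.
      by rewrite scalerBr scalerBl scale1r addrCA addrC.
    rewrite (le_lt_trans (ler_enormD _ _)) // !enormZ !ger0_norm ?subr_ge0 //.
    by have [l|l] := leP a 2^-1; nra.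
  by have := GF t; rewrite disk_boundaryE => -[].
- by move=> s; rewrite G01.
Qed.

(** Off the boundary a point is interior or exterior, and two points of the same kind would have the
    same parity, against [crossing_parity]. *)
Lemma crossing_sides (p e : plane) (Y a b : R) :
  0 <= a <= b -> b <= 1 -> 0 < Y -> enorm e = 1 ->
  (forall t : R, a <= t <= b -> enorm (G t - p) < Y) ->
  (forall t : R, 0 <= t <= a \/ b <= t <= 1 ->
     dot e (G t - p) != 0 \/ Y < enorm (G t - p)) ->
  dot e (G a - p) < 0 < dot e (G b - p) ->
  ~ boundary F (p + Y *: perp e) -> ~ boundary F (p - Y *: perp e) ->
  (F (p + Y *: perp e) <-> ~ F (p - Y *: perp e)).
Proof.
move=> ab b1 Y0 e1 inw outw gab bq bq'.
have := crossing_parity cG G01 ab b1 Y0 e1 inw outw gab.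
have int q : ~ boundary F q -> F q -> F° q.
  by rewrite disk_boundaryE => nb Fq; apply: contrapT => nq; apply: nb.
move=> nr; split=> [Fq Fq'|nFq'].
  by apply: nr; apply: interior_parity; exact: int.
by apply: contrapT => nFq; apply: nr; exact: exterior_parity.
Qed.

End Sides.

(** Membership in [F] is locally constant off the boundary: [F] is closed, and its points off the
    boundary are interior. *)
Lemma segment_same_side (x y : plane) :
  (forall s, 0 <= s <= 1 -> ~ boundary F (x + s *: (y - x))) -> F x -> F y.
Proof.
move=> hb.
have -> : x = x + clip01 0 *: (y - x).
  by rewrite clip01_id ?scale0r ?addr0 // lexx ler01.
have -> : F y = F (x + clip01 1 *: (y - x)).
  by rewrite clip01_id ?scale1r ?lexx ?ler01 // addrC subrK.
apply: (@locally_constant_prop R (fun s => F (x + clip01 s *: (y - x)))) => // s.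
have cc : continuous (fun s => x + clip01 s *: (y - x)).
  apply: addf_continuous; first exact: cst_continuous.
  apply: scalef_continuous; last exact: cst_continuous.
  exact: clip01_continuous.
have [Fs|nFs] := pselect (F (x + clip01 s *: (y - x))).
  have : F° (x + clip01 s *: (y - x)).
    apply: contrapT => ni; apply: (hb _ (clip01_itv s)).
    by rewrite disk_boundaryE.
  move=> iF; have nF : \forall s' \near s, F (x + clip01 s' *: (y - x)) by exact: (cc s _ iF).
  by apply: filterS nF => s'.
have : nbhs (x + clip01 s *: (y - x)) (~` F).
  by apply: open_nbhs_nbhs; split=> //; apply: closed_openC; exact: disk_closed.
move=> iF; have nF : \forall s' \near s, ~ F (x + clip01 s' *: (y - x)) by exact: (cc s _ iF).
by apply: filterS nF => s'.
Qed.

End Disk.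
End Domain.

(** * The norm of an oval and the touching homothets *)

Section PlaneNorm.
Variable R : realType.
Local Notation plane := (R * R)%type.

Definition plane_norm (N : plane -> R) (m M : R) :=
  [/\ 0 < m, 0 < M, (forall (a : R) x, N (a *: x) = `|a| * N x),
   (forall x y, N (x + y) <= N x + N y) &
   forall x, m * enorm x <= N x <= M * enorm x].

(* The homothets of ratio [l] touching [F] are those whose center is at distance
   exactly [l] from [F]. *)
Definition touching_center (N : plane -> R) (F : set plane) (l : R) (q : plane) :=
  (exists2 x, F x & N (x - q) = l) /\ forall x, F x -> l <= N (x - q).

Section Theory.
Variables (N : plane -> R) (m M : R).
Hypothesis hN : plane_norm N m M.

Lemma pnormZ a x : N (a *: x) = `|a| * N x. Proof. by case: hN. Qed.
Lemma pnormD x y : N (x + y) <= N x + N y. Proof. by case: hN. Qed.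
Lemma pnorm_ge x : m * enorm x <= N x. Proof. by case: hN => _ _ _ _ /(_ x)/andP[]. Qed.
Lemma pnorm_le x : N x <= M * enorm x. Proof. by case: hN => _ _ _ _ /(_ x)/andP[]. Qed.
Lemma pnorm_m_gt0 : 0 < m. Proof. by case: hN. Qed.
Lemma pnorm_M_gt0 : 0 < M. Proof. by case: hN. Qed.

Lemma pnorm_ge0 x : 0 <= N x.
Proof. by apply: le_trans (pnorm_ge x); rewrite mulr_ge0 ?enorm_ge0 // ltW // pnorm_m_gt0. Qed.

Lemma pnormN x : N (- x) = N x.
Proof. by rewrite -scaleN1r pnormZ normrN1 mul1r. Qed.

Lemma pnormB x y : N (x - y) = N (y - x).
Proof. by rewrite -pnormN opprB. Qed.

Lemma pnorm0 : N 0 = 0.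
Proof. by rewrite -(scale0r (0 : plane)) pnormZ normr0 mul0r. Qed.

Lemma pnorm_distD z x y : N (x - y) <= N (x - z) + N (z - y).
Proof. by rewrite (_ : x - y = (x - z) + (z - y)) ?pnormD // addrA subrK. Qed.

Lemma pnorm_continuous : continuous N.
Proof.
move=> x; apply/cvgrPdist_lt => e e0.
have := pnorm_M_gt0 => M0.
have : \forall y \near x, enorm (y - x) < e / M.
  by apply/nbhs_enormP; exists (e / M) => //; rewrite divr_gt0.
apply: filterS => y; rewrite ltr_pdivlMr // mulrC => h.
apply: le_lt_trans (le_lt_trans (pnorm_le _) h).
have h1 := pnormD (y - x) x; have h2 := pnormD (x - y) y.
rewrite !subrK (pnormB x) in h1 h2; rewrite ler_distl; lra.
Qed.

Lemma pnorm_dot_le e x : enorm e = 1 ->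
  N x <= `|dot e x| * N e + `|dot (perp e) x| * N (perp e).
Proof.
by move=> e1; rewrite {1}(unit_decomp x e1) (le_trans (pnormD _ _)) // !pnormZ.
Qed.

End Theory.
End PlaneNorm.

Section OvalNorm.
Variable R : realType.
Local Notation plane := (R * R)%type.
Variables (c : plane) (B : set plane).
Hypothesis hB : symmetric_oval c B.
Local Notation N := (oval_norm c B).

Lemma oval_convex x y (a : R) : B x -> B y -> 0 <= a <= 1 ->
  B (a *: x + (1 - a) *: y).
Proof.
move=> Bx By /andP[a0 a1]; case: hB => _ cB _ _.
by have := cB x y (Itv01 a0 a1); rewrite !inE; apply.
Qed.

(** [c + x] is the midpoint of [b + x] and of the reflection of [b - x] in the center. *)
Lemma oval_contains_disk : exists2 d, 0 < d & forall x, enorm x < d -> B (c + x).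
Proof.
case: hB => _ _ [b /nbhs_enormP[d d0 hd]] sB; exists d => // x xd.
have B1 : B (b + x) by apply: hd; rewrite addrC addKr.
have B2 : B (c + c - (b - x)) by apply/sB/hd; rewrite addrC addKr enormN.
have := @oval_convex _ _ 2^-1 B1 B2.
rewrite (_ : 2^-1 *: (b + x) + (1 - 2^-1) *: (c + c - (b - x)) = c + x).
  by apply; lra.
case: (b) (c) (x) => b1 b2 [c1 c2] [x1 x2]; rewrite /GRing.scale /=.
by congr pair => /=; rewrite /GRing.scale /=; field.
Qed.

Let T x := [set t : R | 0 < t /\ exists2 b, B b & x = t *: (b - c)].

Lemma oval_scaleP x t : 0 < t -> T x t <-> B (c + t^-1 *: x).
Proof.
move=> t0; split=> [[_ [b Bb ->]]|Bx].
  by rewrite scalerA mulVf ?gt_eqF // scale1r addrC subrK.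
split=> //; exists (c + t^-1 *: x) => //.
by rewrite addrC addKr scalerA mulfV ?gt_eqF // scale1r.
Qed.

Lemma oval_center : B c.
Proof.
by have [d d0 /(_ 0)] := oval_contains_disk; rewrite enorm0 addr0; apply.
Qed.

Lemma oval_T_lb x : has_lbound (T x).
Proof. by exists 0 => t [/ltW]. Qed.

Lemma oval_norm_le x t : T x t -> N x <= t.
Proof. by move=> ?; apply: ge_inf => //; exact: oval_T_lb. Qed.

Lemma oval_norm_plane_norm : exists m M, plane_norm N m M.
Proof.
have [d d0 hd] := oval_contains_disk.
have [D D0 hD] : exists2 D, 0 < D & forall x, B (c + x) -> enorm x <= D.
  case: hB => /compact_bounded[K' [_ /(_ (`|K'| + 1))]] + _ _ _.
  rewrite (le_lt_trans (ler_norm _)) ?ltrDl // => /(_ isT).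
  set K := `|K'| + 1 => hK.
  exists (2 * (`|K| + `|c|) + 1) => [|x /hK hx].
    by rewrite ltr_wpDl // mulr_ge0 // addr_ge0.
  have : `|x| <= `|K| + `|c|.
    rewrite -(addKr c x) (le_trans (ler_normD _ _)) // normrN addrC lerD2r.
    by apply: le_trans hx (ler_norm _).
  by have := enorm_le_normr x; lra.
have Tn x t : 0 < t -> 2 * enorm x < t * d -> T x t.
  move=> t0 xt; apply/oval_scaleP => //; apply: hd.
  rewrite enormZ gtr0_norm ?invr_gt0 // mulrC ltr_pdivrMr // mulrC.
  by have := enorm_ge0 x; lra.
have T0 x : T x !=set0.
  exists (2 * enorm x / d + 1); apply: Tn.
    by rewrite ltr_wpDl // divr_ge0 ?mulr_ge0 ?enorm_ge0 // ltW.
  have -> : (2 * enorm x / d + 1) * d = 2 * enorm x + d by field; rewrite gt_eqF.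
  by rewrite ltrDl.
have lbT x a : (forall t, T x t -> a <= t) -> a <= N x.
  by move=> h; exact: lb_le_inf (T0 x) h.
have N0 : N 0 <= 0.
  rewrite leNgt; apply/negP => /(@midf_lt _ 0)[]; rewrite add0r => t0.
  apply/negP; rewrite -leNgt; apply: oval_norm_le; apply: Tn => //.
  by rewrite enorm0 mulr0 mulr_gt0.
have Nge0 x : 0 <= N x by apply: (lbT) => t [/ltW].
have NZp (a : R) x : 0 < a -> N (a *: x) <= a * N x.
  move=> a0; rewrite mulrC -ler_pdivrMr //; apply: (lbT) => t [t0 [b Bb xE]].
  rewrite ler_pdivrMr //; apply: oval_norm_le; split; first exact: mulr_gt0.
  by exists b => //; rewrite xE scalerA mulrC.
have NZ (a : R) x : 0 < a -> N (a *: x) = a * N x.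
  move=> a0; apply/eqP; rewrite eq_le NZp //=.
  have := NZp a^-1 (a *: x); rewrite invr_gt0 scalerA mulVf ?gt_eqF // scale1r.
  by move=> /(_ a0); rewrite mulrC ler_pdivlMr // mulrC.
have NN x : N (- x) <= N x.
  apply: (lbT) => t Txt; have [t0 _] := Txt.
  move/(oval_scaleP x t0): Txt => Bx; apply/oval_norm_le/oval_scaleP => //.
  case: hB => _ _ _ /(_ _ Bx); rewrite scalerN opprD addrA.
  by rewrite addrK.
(* [D] is an outer radius of the oval and [d] an inner one; any factor above the 2 of [Tn] would do
   in place of 3. *)
exists D^-1, (3 / d); split.
- by rewrite invr_gt0.
- by rewrite divr_gt0.
- move=> a x; have [a0|a0|->] := ltgtP a 0.
  + rewrite ltr0_norm // -NZ ?oppr_gt0 // scaleNr.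
    apply/eqP; rewrite eq_le NN andbT.
    by have := NN (- (a *: x)); rewrite opprK.
  + by rewrite gtr0_norm // NZ.
  + by rewrite scale0r normr0 mul0r; apply/eqP; rewrite eq_le N0 Nge0.
- move=> x y; rewrite -lerBlDr; apply: (lbT) => s Ts.
  rewrite lerBlDr -lerBlDl; apply: (lbT) => t Tt; rewrite lerBlDl.
  have [s0 _] := Ts; have [t0 _] := Tt.
  move/(oval_scaleP x s0) : Ts => Bx; move/(oval_scaleP y t0) : Tt => By.
  have st0 : 0 < s + t by rewrite addr_gt0.
  apply/oval_norm_le/oval_scaleP => //.
  have := @oval_convex _ _ (s / (s + t)) Bx By.
  rewrite (_ : (s / (s + t)) *: (c + s^-1 *: x) + (1 - s / (s + t)) *: (c + t^-1 *: y) =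
    c + (s + t)^-1 *: (x + y)).
    apply; rewrite divr_ge0 ?(ltW s0) ?(ltW st0) //= ler_pdivrMr // mul1r.
    by rewrite lerDl ltW.
  have st : s + t != 0 by rewrite gt_eqF.
  have sn : s != 0 by rewrite gt_eqF. have tn : t != 0 by rewrite gt_eqF.
  case: (x) (y) (c) => x1 x2 [y1 y2] [c1 c2]; congr pair => /=;
    rewrite /GRing.scale /=; field; by rewrite st sn tn.
- move=> x; apply/andP; split.
    apply: (lbT) => t Txt; have [t0 _] := Txt.
    move/(oval_scaleP x t0) : Txt => /hD.
    by rewrite enormZ gtr0_norm ?invr_gt0 // !ler_pdivrMl // mulrC.
  have [->|x0] := eqVneq x 0; first by rewrite enorm0 mulr0.
  have xp : 0 < enorm x by rewrite enorm_gt0.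
  apply: oval_norm_le; apply: Tn; first by rewrite mulr_gt0 // divr_gt0.
  by rewrite mulrAC divfK ?gt_eqF //; lra.
Qed.

(** Convexity puts every [c + y] with [N y < 1] in the oval; the points of norm 1 are limits of such
    points along their ray, and the oval is closed. *)
Lemma oval_normP x : B (c + x) <-> N x <= 1.
Proof.
have [m [M hN]] := oval_norm_plane_norm.
split=> [Bx|Nx].
  by apply: oval_norm_le; apply/oval_scaleP => //; rewrite invr1 scale1r.
have lt1 y : N y < 1 -> B (c + y).
  move=> Ny; have [|t [t0 Tt] t1] := @inf_lt _ (T y) 1 _ Ny.
    have [|] := boolP (y == 0) => [/eqP ->|y0].
      by exists 1; split => //; exists c; rewrite ?subrr ?scaler0 //; exact: oval_center.
    apply: contrapT => nT.
    have T0 : T y = set0 by apply/seteqP; split=> // t Tt; apply: nT; exists t.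
    have := pnorm_ge hN y; rewrite /oval_norm -/(T y) T0 inf0.
    by rewrite leNgt mulr_gt0 ?enorm_gt0 ?(pnorm_m_gt0 hN).
  have /(oval_scaleP _ t0) By : T y t by split.
  have := @oval_convex _ _ t By oval_center.
  rewrite scalerDr scalerA mulfV ?gt_eqF // scale1r scalerBl scale1r.
  rewrite addrAC addrCA subrr addr0; apply; rewrite !ltW //.
have cB : closed B.
  by apply: compact_closed; [exact: norm_hausdorff|case: hB].
rewrite (closure_id B).1 // => V /nbhs_enormP[d d0 hd].
pose a := 1 - Num.min (2^-1) (d / (2 * (enorm x + 1))).
have e0 : 0 < enorm x + 1 by rewrite ltr_wpDl ?enorm_ge0.
have mn0 : 0 < Num.min (2^-1) (d / (2 * (enorm x + 1))).
  by rewrite lt_min invr_gt0 ltr0n /= divr_gt0 // mulr_gt0.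
have mn2 : Num.min (2^-1) (d / (2 * (enorm x + 1))) <= 2^-1 by rewrite ge_min lexx.
exists (c + a *: x); split.
  apply: lt1; rewrite (pnormZ hN) ger0_norm; last by rewrite /a; lra.
  have := pnorm_ge0 hN x; rewrite /a; nra.
apply: hd; rewrite opprD addrACA subrr add0r -{2}[x]scale1r -scalerBl.
rewrite enormZ /a.
rewrite addrAC subrr add0r normrN gtr0_norm //.
have : Num.min (2^-1) (d / (2 * (enorm x + 1))) <= d / (2 * (enorm x + 1)).
  by rewrite ge_min lexx orbT.
rewrite ler_pdivlMr ?mulr_gt0 //; have := enorm_ge0 x; nra.
Qed.

Section Homothets.
Variables (F : set plane) (l : R).
Hypothesis l0 : 0 < l.
Let NP : exists m M, plane_norm N m M := oval_norm_plane_norm.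

Lemma homothetP t x : homothet B l t x <-> N (x - (t + l *: c)) <= l.
Proof.
have [m [M hN]] := NP.
have -> : x - (t + l *: c) = l *: (l^-1 *: (x - t) - c).
  by rewrite scalerBr scalerA mulfV ?gt_eqF // scale1r opprD addrA.
rewrite (pnormZ hN) gtr0_norm // ger_pMr //; split=> [[b Bb <-]|].
  apply/oval_normP; rewrite addrC subrK addrC addKr scalerA mulVf ?gt_eqF //.
  by rewrite scale1r.
move/oval_normP; rewrite addrC subrK => Bx; exists (l^-1 *: (x - t)) => //.
by rewrite scalerA mulfV ?gt_eqF // scale1r addrC subrK.
Qed.

Lemma homothetE t : homothet B l t = [set x | N (x - (t + l *: c)) <= l].
Proof. by apply/seteqP; split=> x /homothetP. Qed.

Lemma pball_continuous (q : plane) : continuous (fun x : plane => N (x - q)).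
Proof.
have [m [M hN]] := NP; apply: comp_cont; first exact: pnorm_continuous hN.
by apply: subf_continuous; [move=> ?; exact: cvg_id|exact: cst_continuous].
Qed.

Lemma interior_pball q : [set x | N (x - q) <= l]° = [set x | N (x - q) < l].
Proof.
have [m [M hN]] := NP; apply/seteqP; split=> x /=.
  move=> /nbhs_enormP[d d0 hd]; rewrite ltNge; apply/negP => lx.
  have xl : N (x - q) = l.
    apply/eqP; rewrite eq_le lx andbT; apply: hd.
    by rewrite subrr enorm0.
  have x0 : 0 < enorm (x - q).
    rewrite enorm_gt0; apply/eqP => e; move: xl; rewrite e (pnorm0 hN) => e2.
    by move: l0; rewrite -e2 ltxx.
  pose a := d / (2 * enorm (x - q)).
  have a0 : 0 < a by rewrite divr_gt0 // mulr_gt0.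
  have : N (x + a *: (x - q) - q) <= l.
    apply: hd; rewrite addrC addKr enormZ gtr0_norm // /a.
    have -> : d / (2 * enorm (x - q)) * enorm (x - q) = d / 2 by field; rewrite gt_eqF.
    by lra.
  rewrite addrAC -{1}[x - q]scale1r -scalerDl (pnormZ hN) xl.
  by rewrite gtr0_norm ?addr_gt0 // ger_pMl // leNgt ltrDl a0.
move=> xl; have : open [set x | N (x - q) < l].
  apply: (@open_comp _ _ (fun x : plane => N (x - q)) [set y | y < l]); last exact: open_lt.
  by move=> y _; exact: pball_continuous.
move=> oN; have : nbhs x [set x | N (x - q) < l] by apply: open_nbhs_nbhs.
by apply: filterS => y /= /ltW.
Qed.

(** Sliding [y] slightly towards [q] brings it closer to [q] than [l], hence out of [F], so [y] is
    not interior. *)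
Lemma touching_point_boundary q y : F y -> N (y - q) = l ->
  (forall x, F x -> l <= N (x - q)) -> boundary F y.
Proof.
have [m [M hN]] := NP => Fy e hF.
split; first exact: subset_closure.
move=> /nbhs_enormP[d d0 hd].
have y0 : 0 < enorm (y - q).
  rewrite enorm_gt0; apply/eqP => e'; move: e; rewrite e' (pnorm0 hN) => e2.
  by move: l0; rewrite -e2 ltxx.
pose a := Num.min 1 (d / (2 * enorm (y - q))).
have a0 : 0 < a by rewrite lt_min ltr01 divr_gt0 // mulr_gt0.
have a1 : a <= 1 by rewrite ge_min lexx.
have : l <= N (y - a *: (y - q) - q).
  apply/hF/hd; rewrite addrC addKr enormN enormZ gtr0_norm //.
  have : a <= d / (2 * enorm (y - q)) by rewrite ge_min lexx orbT.
  by rewrite ler_pdivlMr ?mulr_gt0 //; lra.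
rewrite addrAC -{1}[y - q]scale1r -scalerBl (pnormZ hN) e ger0_norm ?subr_ge0 //.
by rewrite mulrBl mul1r lerBrDr gerDl pmulr_lle0 // leNgt a0.
Qed.

Lemma touching_of_center q : touching_center N F l q ->
  touching F B l (homothet B l (q - l *: c)).
Proof.
case=> [[x Fx Nx] hF]; rewrite homothetE subrK; split.
- by exists (q - l *: c); rewrite homothetE subrK.
- by exists x => /=; rewrite Nx.
move=> y [/= Ny Fy]; have e : N (y - q) = l by apply/eqP; rewrite eq_le Ny hF.
split; last exact: touching_point_boundary e hF.
split; first exact: subset_closure.
by rewrite interior_pball /= e ltxx.
Qed.

Lemma touching_centerP A : touching F B l A ->
  exists2 q, A° = [set x | N (x - q) < l] & touching_center N F l q.
Proof.
have [m [M hN]] := NP => -[[t ->]]; rewrite homothetE.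
set q := t + l *: c => -[x [Ax Fx]] hb; exists q; first exact: interior_pball.
have hF y : F y -> l <= N (y - q).
  move=> Fy; have [|lt] := leP l (N (y - q)) => //.
  have [|[_ ni] _] := hb y; first by split => //=; exact: ltW.
  by exfalso; apply: ni; rewrite interior_pball.
split=> //; exists x => //.
by apply/eqP; rewrite eq_le hF // andbT.
Qed.

(** The midpoint of the centers is the common point when they are too close; the converse is the
    triangle inequality. *)
Lemma pballs_disjoint q q' :
  ([set x | N (x - q) < l] `&` [set x | N (x - q') < l] = set0) <-> 2 * l <= N (q - q').
Proof.
have [m [M hN]] := NP; split=> [e|lqq].
  rewrite leNgt; apply/negP => lt.
  have : ([set x | N (x - q) < l] `&` [set x | N (x - q') < l]) (2^-1 *: (q + q')).
    split=> /=.
      have -> : 2^-1 *: (q + q') - q = 2^-1 *: (q' - q).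
        by case: (q) (q') => a b [a' b']; congr pair => /=; rewrite /GRing.scale /=; field.
      by rewrite (pnormZ hN) gtr0_norm ?invr_gt0 // (pnormB hN); lra.
    have -> : 2^-1 *: (q + q') - q' = 2^-1 *: (q - q').
      by case: (q) (q') => a b [a' b']; congr pair => /=; rewrite /GRing.scale /=; field.
    by rewrite (pnormZ hN) gtr0_norm ?invr_gt0 //; lra.
  by rewrite e.
apply/seteqP; split=> // x [/= h1 h2].
have := pnorm_distD hN x q q'; rewrite (pnormB hN q x).
by have := lt_le_trans (ltrD h1 h2) (_ : l + l <= 2 * l); lra.
Qed.

(** From here on homothets are replaced by their centers: points at distance exactly [l] from [F],
    pairwise at distance at least [2 * l]. *)
Lemma touching_packingP k : touching_packing F B l k <->
  exists q : 'I_k -> plane, (forall i, touching_center N F l (q i)) /\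
    forall i j, i != j -> 2 * l <= N (q i - q j).
Proof.
split=> [[A [tA dA]]|[q [tq dq]]].
  have /choice[q hq] : forall i, exists q, (A i)° = [set x | N (x - q) < l] /\ touching_center N F l q.
    by move=> i; have [q h1 h2] := touching_centerP (tA i); exists q.
  exists q; split=> [i|i j ij]; first by have [] := hq i.
  apply/pballs_disjoint; have [<- _] := hq i; have [<- _] := hq j.
  exact: (trivIsetP.1 dA).
exists (fun i => homothet B l (q i - l *: c)); split=> [i|].
  exact: touching_of_center.
apply/trivIsetP => i j _ _ ij.
by rewrite !homothetE !subrK !interior_pball; apply/pballs_disjoint/dq.
Qed.

End Homothets.
End OvalNorm.

(** * Packing and counting *)

Section Packing.
Variable R : realType.
Local Notation plane := (R * R)%type.

Lemma truncn_eq_dist (x y : R) : 0 <= x -> 0 <= y ->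
  Num.truncn x = Num.truncn y -> `|x - y| < 1.
Proof.
move=> /truncn_itv/andP[x1 x2] /truncn_itv/andP[y1 y2] e.
rewrite e in x1 x2; rewrite ltr_norml; move: x2 y2; rewrite -natr1.
by move=> x2 y2; apply/andP; split; lra.
Qed.

(** Pigeonhole on cells of length [w]: two points in the same cell would be closer than [w]. *)
Lemma line_packing (I : finType) (x : I -> R) (lo hi w : R) : 0 < w -> lo <= hi ->
  (forall i, lo <= x i <= hi) ->
  (forall i j, i != j -> w <= `|x i - x j|) ->
  #|I|%:R * w <= hi - lo + w.
Proof.
move=> w0 lh xb xw; pose n := Num.truncn ((hi - lo) / w).
have q0 i : 0 <= (x i - lo) / w.
  by rewrite divr_ge0 ?(ltW w0) // subr_ge0; case/andP: (xb i).
have h0 : 0 <= (hi - lo) / w by rewrite divr_ge0 ?(ltW w0) // subr_ge0.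
have lt i : (Num.truncn ((x i - lo) / w) < n.+1)%N.
  rewrite ltnS; apply: le_truncn.
  by rewrite ler_pM2r ?invr_gt0 // lerD2r; case/andP: (xb i).
have inj : injective (fun i => Ordinal (lt i)).
  move=> i j [] /(truncn_eq_dist (q0 i) (q0 j)); rewrite -mulrBl opprB addrA subrK.
  rewrite normrM (gtr0_norm (x := w^-1)) ?invr_gt0 // ltr_pdivrMr // mul1r => lw.
  by apply/eqP; apply: contraTT lw => /xw; rewrite leNgt.
have := leq_card _ inj; rewrite card_ord -(ler_nat R) -natr1 => hn.
have /andP[hn2 _] := truncn_itv h0; rewrite -/n ler_pdivlMr // in hn2.
by apply: le_trans (_ : (n%:R + 1) * w <= _); [rewrite ler_pM2r|rewrite mulrDl mul1r lerD2r].
Qed.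

(** Pigeonhole on square cells of side [w / 2], since the Euclidean distance is at most the sum of
    the coordinate distances. *)
Lemma plane_packing (I : finType) (q : I -> plane) p (r w : R) : 0 < w -> 0 <= r ->
  (forall i, enorm (q i - p) <= r) ->
  (forall i j, i != j -> w <= enorm (q i - q j)) ->
  (#|I| <= (Num.truncn (4 * r / w)).+1 ^ 2)%N.
Proof.
move=> w0 r0 qr qw; set n := (Num.truncn _).+1.
pose f (k : plane -> R) i := (k (q i) - k p + r) / (w / 2).
have w20 : 0 < w / 2 by rewrite divr_gt0.
have f0 k i : `|k (q i) - k p| <= r -> 0 <= f k i.
  by rewrite ler_norml => /andP[? ?]; rewrite divr_ge0 ?(ltW w20) //; lra.
have fn k i : `|k (q i) - k p| <= r -> (Num.truncn (f k i) < n)%N.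
  rewrite ler_norml => /andP[? ?]; rewrite ltnS; apply: le_truncn.
  have -> : 4 * r / w = (2 * r) / (w / 2) by field; rewrite gt_eqF.
  by rewrite ler_pM2r ?invr_gt0 //; lra.
have h1 i : `|(q i).1 - p.1| <= r.
  apply: le_trans (qr i); apply: le_trans (normr_le_enorm _).
  by rewrite normr_pairE le_max lexx.
have h2 i : `|(q i).2 - p.2| <= r.
  apply: le_trans (qr i); apply: le_trans (normr_le_enorm _).
  by rewrite normr_pairE le_max lexx orbT.
have inj : injective (fun i => (Ordinal (fn fst i (h1 i)), Ordinal (fn snd i (h2 i)))).
  move=> i j [].
  move=> /(truncn_eq_dist (f0 fst i (h1 i)) (f0 fst j (h1 j))) e1.
  move=> /(truncn_eq_dist (f0 snd i (h2 i)) (f0 snd j (h2 j))) e2.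
  have H k : `|f k i - f k j| < 1 -> `|k (q i) - k (q j)| < w / 2.
    rewrite /f -mulrBl (_ : k (q i) - k p + r - (k (q j) - k p + r) = k (q i) - k (q j)).
      by rewrite normrM (gtr0_norm (x := _^-1)) ?invr_gt0 // ltr_pdivrMr // mul1r.
    ring.
  apply/eqP; apply: contraT => /qw; rewrite leNgt => /negP[].
  have e0 : enorm ((1, 0) : plane) = 1 by rewrite /enorm /dot /= mulr1 mulr0 addr0 sqrtr1.
  have := enorm_le_coords (q i - q j) e0.
  rewrite /dot /perp /= !mul1r !mul0r addr0 oppr0 mul0r add0r.
  move: (H fst e1) (H snd e2) => /=; lra.
by have := leq_card _ inj; rewrite card_prod card_ord.
Qed.

(** In the application [D k] is the length of the mesh up to the vertex [k] minus its progress along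
    the chord, and a vertex is bad when [D] grows too fast from it on the right or on the left. *)
Definition steep_right (D : nat -> R) n (a : R) k :=
  `[< exists2 j, (k < j <= n)%N & a * (j - k)%:R < D j - D k >].

Definition steep_left (D : nat -> R) (a : R) k :=
  `[< exists2 j, (j < k)%N & a * (k - j)%:R < D k - D j >].

(* Rising sun: each index counted starts a jump over which [D] grows at rate
   more than [a], and the greedy choice makes these jumps disjoint. *)
Lemma count_steep_right (D : nat -> R) (n : nat) (a : R) : 0 < a ->
  (forall k, (k < n)%N -> D k <= D k.+1) ->
  a * (\sum_(0 <= k < n.+1) steep_right D n a k)%N%:R <= D n - D 0%N.
Proof.
move=> a0 Dm.
suff H d k : (n - k <= d)%N -> (k <= n)%N ->
    a * (\sum_(k <= i < n.+1) steep_right D n a i)%N%:R <= D n - D k.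
    by apply: (H n 0%N) => //; rewrite subn0.
elim: d k => [|d IH] k nk kn.
  have -> : k = n by lia.
  rewrite big_nat1 subrr /steep_right.
  by case: asboolP => [[j]|_]; [lia|rewrite mulr0].
have [kn'|kn'] := ltnP k n; last by apply: IH => //; lia.
case: (boolP (steep_right D n a k)) => [/asboolP[j /andP[kj jn] aj]|nP].
  rewrite (big_cat_nat (n := j)) /=; [|lia|lia].
  rewrite natrD mulrDr; have := IH j ltac:(lia) jn.
  have : a * (\sum_(k <= i < j) steep_right D n a i)%N%:R <= a * (j - k)%:R.
    rewrite ler_pM2l // ler_nat -[leqRHS]muln1 -sum_nat_const_nat.
    by apply: leq_sum => i _; case: (steep_right _ _ _ _).
  by move: aj; lra.
rewrite big_ltn; last lia.
rewrite (negbTE nP) add0n; have := IH k.+1 ltac:(lia) kn'; have := Dm _ kn'; lra.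
Qed.

Lemma count_steep_left (D : nat -> R) (n : nat) (a : R) : 0 < a ->
  (forall k, (k < n)%N -> D k <= D k.+1) ->
  a * (\sum_(0 <= k < n.+1) steep_left D a k)%N%:R <= D n - D 0%N.
Proof.
(* Reversing the indices and the sign exchanges right and left and keeps the sequence increasing. *)
move=> a0 Dm; pose D' k := - D (n - k)%N.
have := @count_steep_right D' n a a0 _.
rewrite /D' subnn subn0 opprK [_ + D n]addrC big_nat_rev /= -/D'.
suff -> : (\sum_(0 <= i < n.+1) steep_right D' n a (0 + n.+1 - i.+1))%N =
    (\sum_(0 <= k < n.+1) steep_left D a k)%N.
  apply=> k kn; rewrite lerN2; have -> : (n - k)%N = (n - k.+1).+1 by lia.
  by apply: Dm; lia.
apply: eq_big_nat => i /andP[_ iln]; congr nat_of_bool; apply/asboolP/asboolP.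
  move=> [j /andP[ij jn] h]; exists (n - j)%N; first lia.
  move: h; rewrite /D' opprK addrC.
  have -> : (n - (0 + n.+1 - i.+1))%N = i by lia.
  by have -> : (i - (n - j))%N = (j - (0 + n.+1 - i.+1))%N by lia.
move=> [j ji h]; exists (n - j)%N; first lia.
rewrite /D' opprK addrC.
have -> : (n - (0 + n.+1 - i.+1))%N = i by lia.
have -> : (n - (n - j))%N = j by lia.
by have -> : (n - j - (0 + n.+1 - i.+1))%N = (i - j)%N by lia.
Qed.

Lemma card_steep (D : nat -> R) (n : nat) (a : R) : 0 < a ->
  (forall k, (k < n)%N -> D k <= D k.+1) ->
  a * #|[pred k : 'I_n.+1 | steep_right D n a k || steep_left D a k]|%:R <= 2 * (D n - D 0%N).
Proof.
move=> a0 Dm; have h1 := count_steep_right a0 Dm; have h2 := count_steep_left a0 Dm.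
have : (#|[pred k : 'I_n.+1 | steep_right D n a k || steep_left D a k]| <=
   \sum_(0 <= k < n.+1) steep_right D n a k + \sum_(0 <= k < n.+1) steep_left D a k)%N.
  rewrite -sum1_card big_mkcond !big_mkord -big_split /=.
  apply: leq_sum => i _; rewrite inE.
  by case: (steep_right D n a i); case: (steep_left D a i).
rewrite -(ler_nat R) natrD => h.
have := ler_wpM2l (ltW a0) h; rewrite mulrDr; lra.
Qed.

End Packing.

(** * Lengths of polygons *)

Section Polygons.
Variable R : realType.
Local Notation plane := (R * R)%type.
Implicit Types (nu : plane -> R) (w : seq R).

Section PolygonLength.
Variables (nu : plane -> R) (m M : R) (G : R -> plane).
Hypothesis hnu : plane_norm nu m M.

Fixpoint plen nu G (x : R) w : R :=
  if w is y :: w' then nu (G y - G x) + plen nu G y w' else 0.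

Lemma plen_ge0 x w : 0 <= plen nu G x w.
Proof. by elim: w x => //= y w IH x; rewrite addr_ge0 // (pnorm_ge0 hnu). Qed.

Lemma plen_cat x w w' : plen nu G x (w ++ w') = plen nu G x w + plen nu G (last x w) w'.
Proof. by elim: w x => [|y w IH] x /=; rewrite ?add0r // IH addrA. Qed.

Lemma plen_start x y w : plen nu G x w <= nu (G y - G x) + plen nu G y w.
Proof.
case: w => [|z w] /=; first by rewrite addr0 (pnorm_ge0 hnu).
by rewrite addrA lerD2r addrC (pnorm_distD hnu).
Qed.

Lemma plen_subseq x w w' : subseq w w' -> plen nu G x w <= plen nu G x w'.
Proof.
elim: w' x w => [|y w' IH] x w; first by rewrite subseq0 => /eqP ->.
case: w => [|z w] /=; first by rewrite addr_ge0 ?plen_ge0 // (pnorm_ge0 hnu).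
case: eqP => [-> /IH h|_ /(IH y) /= h]; first by rewrite lerD2l.
by have := plen_start x y (z :: w) => /=; lra.
Qed.

Lemma plen_sum x w : plen nu G x w =
  \sum_(0 <= i < size w) nu (G (nth 1 (x :: w) i.+1) - G (nth 1 (x :: w) i)).
Proof.
elim: w x => [|y w IH] x /=; first by rewrite big_geq.
by rewrite big_nat_recl // IH.
Qed.

End PolygonLength.

Lemma enorm_plane_norm : plane_norm (@enorm R) 1 1.
Proof.
split; rewrite ?ltr01 //; [exact: enormZ|exact: ler_enormD|].
by move=> x; rewrite mul1r lexx.
Qed.

Section ArcLength.
Variables (G : R -> plane) (L : R).
Hypothesis HL : forall w, path <=%R 0 w -> last 0 w <= 1 -> plen (@enorm R) G 0 w <= L.
Local Notation plenE := (plen (@enorm R) G).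

(** Weak inequalities and a free endpoint below [b], unlike in [itv_partition], make chains stable
    under concatenation and truncation. *)
Definition chain (a b : R) w := path <=%R a w && (last a w <= b).

Definition arclen a b := sup [set plenE a w | w in [set w | chain a b w]].

Lemma chain_bounded a b w : 0 <= a -> b <= 1 -> chain a b w -> plenE a w <= L.
Proof.
move=> a0 b1 /andP[pw lw]; apply: le_trans (HL (w := a :: w) _ _) => /=.
- by rewrite lerDr enorm_ge0.
- by rewrite a0.
- exact: le_trans lw b1.
Qed.

Lemma arclen_has_sup a b : 0 <= a -> a <= b -> b <= 1 ->
  has_sup [set plenE a w | w in [set w | chain a b w]].
Proof.
move=> a0 ab b1; split; first by exists 0, [::] => //=; rewrite /chain /= ab.
by exists L => _ [w hw <-]; exact: chain_bounded hw.
Qed.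

Lemma plen_arclen a b w : 0 <= a -> b <= 1 -> chain a b w -> plenE a w <= arclen a b.
Proof.
move=> a0 b1 hw; apply: sup_upper_bound; last by exists w.
apply: arclen_has_sup => //; elim: w a {a0} hw => [|y w IH] a /andP[/=].
  by [].
by case/andP=> ay pw lw; apply: le_trans ay (IH y _); rewrite /chain pw.
Qed.

Lemma arclen_superadd a b c : 0 <= a -> a <= b -> b <= c -> c <= 1 ->
  arclen a b + arclen b c <= arclen a c.
Proof.
move=> a0 ab bc c1; rewrite -lerBrDr; apply: ge_sup.
  by have [] := arclen_has_sup a0 ab (le_trans bc c1).
move=> _ [w /andP[pw lw] <-]; rewrite lerBrDl -lerBrDr; apply: ge_sup.
  by have [] := arclen_has_sup (le_trans a0 ab) bc c1.
move=> _ [w' /andP[pw' lw'] <-]; rewrite lerBrDr addrC.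
apply: le_trans (plen_arclen (w := w ++ b :: w') a0 c1 _).
  by rewrite plen_cat /= lerD2l lerDr enorm_ge0.
by rewrite /chain cat_path last_cat /= pw lw pw'.
Qed.

Lemma chord_arclen a b : 0 <= a -> a <= b -> b <= 1 -> enorm (G b - G a) <= arclen a b.
Proof.
move=> a0 ab b1; have := @plen_arclen a b [:: b] a0 b1; rewrite /= addr0; apply.
by rewrite /chain /= ab lexx.
Qed.

Lemma sum_arclen a s : 0 <= a -> path <=%R a s -> last a s <= 1 ->
  \sum_(0 <= i < size s) arclen (nth 1 (a :: s) i) (nth 1 (a :: s) i.+1)
    <= arclen a (last a s).
Proof.
elim: s a => [|b s IH] a a0 /=.
  move=> _ a1; rewrite big_geq //.
  by have := chord_arclen a0 (lexx a) a1; rewrite subrr enorm0.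
case/andP=> ab ps ls; rewrite big_nat_recl //=.
have b0 := le_trans a0 ab.
have bl : b <= last b s.
  by elim: s b {IH ls ab b0} ps => //= c s IH b /andP[bc /IH]; exact: le_trans.
apply: le_trans (arclen_superadd a0 ab bl ls); rewrite lerD2l.
exact: IH.
Qed.

End ArcLength.

Lemma first_exit (G : R -> plane) (a b mu : R) : continuous G -> a <= b -> 0 < mu ->
  (forall s, a <= s <= b -> enorm (G s - G a) <= mu) \/
  exists2 c, a < c <= b & enorm (G c - G a) = mu /\
     forall s, a <= s <= c -> enorm (G s - G a) <= mu.
Proof.
move=> cG ab mu0; pose f s := enorm (G s - G a).
have cf : continuous f.
  by apply: enorm_continuous; apply: subf_continuous => //; exact: cst_continuous.
have [[s0 s0ab s0mu]|none] := pselect (exists2 s, a <= s <= b & mu < f s); last first.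
  left=> s sab; rewrite leNgt; apply/negP => lt; apply: none; by exists s.
right; pose E := `[a, b]%classic `&` [set s | mu <= f s].
have cE : compact E.
  apply: compact_closedI; first exact: segment_compact.
  apply: (@preimage_closed _ _ f [set x | mu <= x]); last exact: closed_ge.
  by move=> s _; exact: cf.
have E0 : E !=set0 by exists s0; split; rewrite /= ?in_itv //= ltW.
have [|c cE' cmin] := @compact_EVT_min R R id E E0 cE.
  by apply: continuous_subspaceT => ?; exact: cvg_id.
have [cab fc] : a <= c <= b /\ mu <= f c.
  by move: cE'; rewrite inE => -[] /=; rewrite in_itv.
have /andP[ac cb] := cab.
have lt s : a <= s < c -> f s < mu.
  move=> /andP[as_ sc]; rewrite ltNge; apply/negP => h.
  have := cmin s; rewrite inE /E /= in_itv /= as_ (ltW (lt_le_trans sc cb)) => /(_ (conj isT h)).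
  by rewrite leNgt sc.
have fa : f a = 0 by rewrite /f subrr enorm0.
have ac' : a < c.
  rewrite lt_neqAle ac andbT; apply/eqP => e; move: fc; rewrite -e fa.
  by rewrite leNgt mu0.
have fcE : f c = mu.
  have [||s] := @IVT R f a c mu ac.
  - exact: continuous_subspaceT.
  - by rewrite fa ge_min (ltW mu0) /= le_max fc orbT.
  rewrite in_itv /= => /andP[as_ ]; rewrite le_eqVlt => /predU1P[->//|sc] fs.
  by have := lt s; rewrite as_ sc fs ltxx => /(_ isT).
exists c; rewrite ?ac' //; split=> // s /andP[as_]; rewrite le_eqVlt => /predU1P[->|sc].
  by rewrite -fcE.
by apply/ltW/lt; rewrite as_.
Qed.

(** Greedy construction: each vertex is the first exit from the disk of radius [mu] around the
    previous one. Every step adds a chord of length exactly [mu], so the bound on polygons makes [K]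
    steps impossible and the recursion ends. *)
Lemma mesh_exists (G : R -> plane) (b mu : R) : continuous G -> 0 < mu ->
  forall (K : nat) (a : R), a <= b ->
  (forall w, chain a b w -> plen (@enorm R) G a w < K%:R * mu) ->
  exists n (t : nat -> R), [/\ t 0%N = a, (forall k, (k < n)%N -> t k < t k.+1),
    t n <= b, (forall k, (k < n)%N -> enorm (G (t k.+1) - G (t k)) = mu) &
    forall s, a <= s <= b -> exists2 k, (k <= n)%N &
      [/\ t k <= s, ((k < n)%N -> s <= t k.+1) & enorm (G s - G (t k)) <= mu]].
Proof.
move=> cG mu0; elim=> [|K IH] a ab hK.
  by have := hK [::]; rewrite /chain /= ab mul0r ltxx => /(_ isT).
have [near|[c /andP[ac cb] [ec hc]]] := first_exit cG ab mu0.
  exists 0%N, (fun=> a); split=> // s /andP[as_ sb]; exists 0%N => //.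
  by split=> //; apply: near; rewrite as_.
have [|n [t [t0 tm tb tmu tc]]] := IH c cb.
  move=> w /andP[pw lw]; have := hK (c :: w).
  rewrite /chain /= (ltW ac) pw lw => /(_ isT); rewrite ec -natr1 mulrDl mul1r.
  by rewrite addrC ltrD2r.
exists n.+1, (fun k => if k is k'.+1 then t k' else a); split=> //.
- by case=> [|k] // kn; [rewrite t0|exact: tm].
- by case=> [|k] // kn; [rewrite t0|exact: tmu].
move=> s /andP[as_ sb]; have [sc|cs] := leP s c.
  by exists 0%N => //; split=> // [_|]; [rewrite t0|apply: hc; rewrite as_].
have [|k kn [h1 h2 h3]] := tc s; first by rewrite (ltW cs).
by exists k.+1.
Qed.

End Polygons.

(** * Rectifiable simple closed curves *)

Section SimpleCurves.
Variable R : realType.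
Local Notation plane := (R * R)%type.
Variable G : R -> plane.
Hypothesis cG : continuous G.

Let cdist : continuous (fun p : R * R => enorm (G p.1 - G p.2)).
Proof.
apply: enorm_continuous; apply: subf_continuous; apply: comp_cont => // ?;
  [exact: cvg_fst|exact: cvg_snd].
Qed.

Let cabs : continuous (fun p : R * R => `|p.1 - p.2|).
Proof.
move=> p; apply: (@continuous_comp _ _ _ (fun p : R * R => p.1 - p.2) Num.norm).
  by apply: subf_continuous => ?; [exact: cvg_fst|exact: cvg_snd].
exact: norm_continuous.
Qed.

Let square_compact : compact (`[0, 1]%classic `*` `[0, 1]%classic : set (R * R)).
Proof. by apply: compact_setX; exact: segment_compact. Qed.

Lemma compact_positive_min (E : set (R * R)) (f : R * R -> R) : compact E ->
  continuous f -> (forall p, E p -> 0 < f p) ->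
  exists2 d, 0 < d & forall p, E p -> d <= f p.
Proof.
move=> cE cf fpos; have [[p0 Ep0]|E0] := pselect (E !=set0); last first.
  by exists 1 => // p Ep; exfalso; apply: E0; exists p.
have [||c] := @compact_EVT_min _ R f E _ cE.
- by exists p0.
- exact: continuous_subspaceT.
rewrite inE => Ec cmin; exists (f c); first exact: fpos.
by move=> p Ep; apply: cmin; rewrite inE.
Qed.

Lemma curve_unif_continuous (eta : R) : 0 < eta -> exists2 rho, 0 < rho &
  forall s t : R, 0 <= s <= 1 -> 0 <= t <= 1 -> `|s - t| < rho -> enorm (G s - G t) < eta.
Proof.
move=> eta0; pose E := (`[0, 1]%classic `*` `[0, 1]%classic : set (R * R)) `&`
  [set p | eta <= enorm (G p.1 - G p.2)].
have cE : compact E.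
  apply: compact_closedI => //.
  apply: (@preimage_closed _ _ (fun p : R * R => enorm (G p.1 - G p.2)) [set x | eta <= x]);
    last exact: closed_ge.
  by move=> p _; exact: cdist.
have [|d d0 hd] := compact_positive_min cE cabs.
  move=> [s t] [_ /= h]; rewrite normr_gt0 subr_eq0; apply/eqP => e.
  by move: h; rewrite e subrr enorm0 leNgt eta0.
exists d => // s t s01 t01 st; rewrite ltNge; apply/negP => h.
have : d <= `|s - t| by apply: (hd (s, t)); split => //; split; rewrite /= in_itv.
by rewrite leNgt st.
Qed.

Hypothesis G01 : G 0 = G 1.
Hypothesis Ginj : {in `[0, 1[ &, injective G}.

(** The upper bound [1 - rho] keeps the pair away from the closing point, where 0 and 1 have the
    same image; compactness does the rest. *)
Lemma curve_injectivity_modulus (rho : R) : 0 < rho -> exists2 d, 0 < d &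
  forall s t : R, 0 <= s <= 1 -> 0 <= t <= 1 -> rho <= `|s - t| -> `|s - t| <= 1 - rho ->
    d <= enorm (G s - G t).
Proof.
move=> rho0; pose E := (`[0, 1]%classic `*` `[0, 1]%classic : set (R * R)) `&`
  ((fun p => `|p.1 - p.2|) @^-1` `[rho, 1 - rho]%classic).
have cE : compact E.
  apply: compact_closedI => //.
  apply: preimage_closed; last exact: itv_closed.
  by move=> p _; exact: cabs.
have [|d d0 hd] := compact_positive_min cE cdist.
  move=> [s t] [[/= +] +]; rewrite !in_itv /= => /andP[s0 s1] /andP[t0 t1] /andP[h1 h2].
  rewrite enorm_gt0 subr_eq0; apply/eqP => e.
  have st : s != t by apply/eqP => e'; move: h1; rewrite e' subrr normr0 leNgt rho0.
  have wlog_lt (a b : R) : 0 <= a -> a < b -> b <= 1 -> `|a - b| <= 1 - rho -> G a = G b -> False.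
    move=> a0 ab; rewrite le_eqVlt => /predU1P[bE|b1] hab eab.
      rewrite bE in ab hab eab.
      have a00 : a != 0.
        apply/eqP => az; move: hab; rewrite az sub0r normrN1.
        by rewrite leNgt ltrBlDr ltrDl rho0.
      have : a = 0.
        apply: Ginj; rewrite ?in_itv /= ?lexx ?ltr01 ?a0 ?ab //.
        by rewrite G01.
      by move/eqP; rewrite (negbTE a00).
    have : a = b by apply: Ginj => //; rewrite in_itv /= ?a0 ?b1 ?(lt_trans ab) // (le_trans a0 (ltW ab)).
    by move=> e'; move: ab; rewrite e' ltxx.
  case: (ltgtP s t) st => // lt _; first exact: wlog_lt lt t1 h2 e.
  by apply: (wlog_lt t s) => //; rewrite distrC.
exists d => // s t s01 t01 st st'; apply: hd (s, t) _.
by split; [split|]; rewrite /= in_itv /= ?st.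
Qed.

(** The points have projections 0, [D], [2 * D], ... on the chord, by the intermediate value
    theorem. *)
Lemma arc_points (a b D : R) : a <= b -> 0 < D -> exists th : nat -> R,
  (forall j, (j <= Num.truncn (enorm (G b - G a) / D)%R)%N -> a <= th j <= b) /\
  forall j k, (j <= Num.truncn (enorm (G b - G a) / D)%R)%N ->
    (k <= Num.truncn (enorm (G b - G a) / D)%R)%N -> j != k ->
    D <= enorm (G (th j) - G (th k)).
Proof.
move=> ab D0; set v := enorm _; set n := Num.truncn _.
have v0 : 0 <= v by exact: enorm_ge0.
have [vz|vn] := eqVneq v 0.
  exists (fun=> a); split=> [j _|j k]; first by rewrite lexx.
  by rewrite /n vz mul0r truncn0 !leqn0 => /eqP -> /eqP ->.
pose e := v^-1 *: (G b - G a).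
have e1 : enorm e = 1 by rewrite enormZ -/v ger0_norm ?invr_ge0 // mulVf.
pose f s := dot e (G s - G a).
have cf : continuous f.
  by apply: dot_continuous; [exact: cst_continuous|apply: subf_continuous => //; exact: cst_continuous].
have fa : f a = 0 by rewrite /f subrr dotr0.
have fb : f b = v by rewrite /f dotZl -sqr_enorm -/v expr2 mulKf.
have nD : n%:R * D <= v.
  have := truncn_itv (divr_ge0 v0 (ltW D0)) => /andP[+ _].
  by rewrite -/n ler_pdivlMr.
have ex j : exists s, (j <= n)%N -> a <= s <= b /\ f s = j%:R * D.
  have [jn|jn] := leqP j n; last by exists a.
  have jv : j%:R * D <= v by apply: le_trans nD; rewrite ler_pM2r // ler_nat.
  have [||s sab fs] := @IVT R f a b (j%:R * D) ab.
  - exact: continuous_subspaceT.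
  - by rewrite fa fb min_l // max_r // jv andbT mulr_ge0 // ltW.
  by exists s => _; move: sab; rewrite in_itv.
have [th hth] := choice ex; exists th; split=> [j /hth[]//|j k /hth[_ ej] /hth[_ ek] jk].
apply: le_trans (ler_dot_unit _ e1).
have -> : G (th j) - G (th k) = (G (th j) - G a) - (G (th k) - G a).
  by rewrite opprB addrA subrK.
rewrite dotBr -/(f (th j)) -/(f (th k)) ej ek -mulrBl normrM (gtr0_norm D0).
rewrite ler_peMl ?(ltW D0) //.
by case: (ltngtP j k) jk => // lt _; [rewrite distrC|]; rewrite -natrB 1?ltnW //
   normr_nat ler1n subn_gt0.
Qed.

(** [D]-separated points are placed on the arcs under the edges, about [v / D] for a chord of length
    [v]. Their preimages under [f] are [D / K]-separated in an interval of length [2 * A], which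
    bounds their number and hence the length of the polygon. *)
Lemma lipschitz_image_polygons (I : set R) (f : R -> plane) (A K : R) :
  0 <= A -> 0 < K -> (forall x, I x -> `|x| <= A) ->
  (forall x y, I x -> I y -> enorm (f x - f y) <= K * `|x - y|) ->
  (forall t, 0 <= t <= 1 -> exists2 x, I x & f x = G t) ->
  forall w, path <=%R 0 w -> last 0 w <= 1 ->
    plen (@enorm R) G 0 w <= 2 * A * K + 1.
Proof.
move=> A0 K0 IA fK fG w pw lw.
set n := size w; pose tau := nth 1 (0 :: w).
have [taum tau01] : (forall i j, (i <= j <= n)%N -> tau i <= tau j) /\
    (forall i, (i <= n)%N -> 0 <= tau i <= 1).
  have sw : sorted <=%R (0 :: w) by [].
  have mono i j : (i <= j <= n)%N -> tau i <= tau j.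
    case/andP=> ij jn; apply: (sorted_leq_nth le_trans lexx) => //;
    rewrite inE /= ltnS //; exact: leq_trans jn.
  split=> // i iN; apply/andP; split; first exact: (mono 0%N).
  apply: le_trans (mono i n _) _; first by rewrite iN leqnn.
  by rewrite /tau -last_nth.
have n40 : 0 < 4 * (n.+1)%:R :> R by rewrite mulr_gt0.
(* Each edge loses at most two [eta], hence 1/2 in all; the other half of the final 1 pays for
   [D <= 2^-1]. *)
pose eta : R := (4 * (n.+1)%:R)^-1.
have eta0 : 0 < eta by rewrite invr_gt0.
have [rho rho0 hrho] := curve_unif_continuous eta0.
have r20 : 0 < rho / 2 by rewrite divr_gt0.
have [d d0 hd] := curve_injectivity_modulus r20.
pose D := Num.min d (2^-1).
have D0 : 0 < D by rewrite lt_min d0 invr_gt0 ltr0n.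
have [Dd D2] : D <= d /\ D <= 2^-1 by split; rewrite ge_min lexx ?orbT.
(* An edge with a parameter length below [rho] is shorter than [eta] and carries no point. The
   others are trimmed by [rho / 2] at both ends, so that points of different edges have parameters
   at least [rho / 2] apart, also around the loop. *)
pose ok i := rho <= tau i.+1 - tau i.
pose a i := tau i + rho / 2; pose b i := tau i.+1 - rho / 2.
pose v i := enorm (G (b i) - G (a i)).
pose m i := if ok i then (Num.truncn (v i / D)%R).+1 else 0%N.
have abok i : ok i -> a i <= b i by rewrite /ok /a /b; lra.
have ex (i : 'I_n) : exists th : nat -> R,
  (forall j, (j < m i)%N -> a i <= th j <= b i) /\
  forall j k, (j < m i)%N -> (k < m i)%N -> j != k -> D <= enorm (G (th j) - G (th k)).
  rewrite /m; case: ifP => [oki|_]; last by exists (fun=> 0).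
  exact: arc_points (abok i oki) D0.
have [th hth] := choice ex.
have th01 (i : 'I_n) j : (j < m i)%N -> 0 <= th i j <= 1.
  have /andP[t0 _] := tau01 i (ltnW (ltn_ord i)); have /andP[_ t1] := tau01 i.+1 (ltn_ord i).
  by move=> jm; have [/(_ j jm)] := hth i; rewrite /a /b => /andP[? ?] _; apply/andP; split; lra.
pose T : finType := {i : 'I_n & 'I_(m i)}.
have exx (p : T) : exists x, I x /\ f x = G (th (tag p) (tagged p)).
  by have [x Ix fx] := fG _ (th01 _ _ (ltn_ord (tagged p))); exists x.
have [x hx] := choice exx.
have sep (p q : T) : p != q -> D <= enorm (G (th (tag p) (tagged p)) - G (th (tag q) (tagged q))).
  case: p q => [i j] [i' j'] /= pq.
  have [e|ii] := eqVneq i i'.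
    subst i'; have [_] := hth i; apply; rewrite ?ltn_ord //.
    by apply: contra_neq pq => /val_inj ->.
  apply: le_trans Dd _; have [hi _] := hth i; have [hi' _] := hth i'.
  have /andP[x1 x2] := hi _ (ltn_ord j); have /andP[y1 y2] := hi' _ (ltn_ord j').
  have /andP[x3 x4] := th01 _ _ (ltn_ord j); have /andP[y3 y4] := th01 _ _ (ltn_ord j').
  have t0 k : (k <= n)%N -> 0 <= tau k by move=> /tau01/andP[].
  have t1 k : (k <= n)%N -> tau k <= 1 by move=> /tau01/andP[].
  have := t0 i (ltnW (ltn_ord i)); have := t1 i.+1 (ltn_ord i).
  have := t0 i' (ltnW (ltn_ord i')); have := t1 i'.+1 (ltn_ord i').
  move=> u1 u2 u3 u4; rewrite /a /b in x1 x2 y1 y2.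
  apply: hd; rewrite ?x3 ?y3 //.
    case: (ltngtP i i') => [lt|lt|/val_inj/eqP]; last by rewrite (negbTE ii).
      have := taum i.+1 i' _; rewrite lt (ltnW (ltn_ord i')) => /(_ isT) h.
      by rewrite distrC ger0_norm; lra.
    have := taum i'.+1 i _; rewrite lt (ltnW (ltn_ord i)) => /(_ isT) h.
    by rewrite ger0_norm; lra.
  by rewrite ler_norml; apply/andP; split; lra.
have DK : 0 < D / K by rewrite divr_gt0.
have := @line_packing R T x (- A) A (D / K) DK _ _ _.
move=> /(_ _ _ _) H.
have {}H : #|T|%:R * (D / K) <= A - - A + D / K.
  apply: H; first by lra.
    by move=> p; rewrite -ler_norml; apply: IA; have [] := hx p.
  move=> p q pq; rewrite ler_pdivrMr // mulrC.
  have [Ip fp] := hx p; have [Iq fq] := hx q.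
  by apply: le_trans (fK _ _ Ip Iq); rewrite fp fq; exact: sep.
have cT : #|T| = (\sum_(i < n) m i)%N.
  by rewrite card_tagged sumnE big_map big_enum /=; apply: eq_bigr => i _; rewrite card_ord.
have le1 (i : 'I_n) : enorm (G (tau i.+1) - G (tau i)) <= (m i)%:R * D + 2 * eta.
  have /andP[s0 s1] := tau01 i (ltnW (ltn_ord i)); have /andP[t0 t1] := tau01 i.+1 (ltn_ord i).
  have st := taum i i.+1; rewrite leqnSn ltn_ord in st; have {}st := st isT.
  rewrite /m; case: ifP => [oki|/negbT].
    have vD : v i <= (Num.truncn (v i / D)%R).+1%:R * D.
      rewrite -ler_pdivrMr //;
      have /andP[_ /ltW] := truncn_itv (divr_ge0 (enorm_ge0 (G (b i) - G (a i))) (ltW D0)).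
      by [].
    have ha : enorm (G (a i) - G (tau i)) < eta.
      move: oki; rewrite /ok => oki; apply: hrho; rewrite /a ?s0 //; first by apply/andP; split; lra.
      by rewrite addrC addKr gtr0_norm //; lra.
    have hb : enorm (G (tau i.+1) - G (b i)) < eta.
      move: oki; rewrite /ok => oki; apply: hrho; rewrite /b ?t0 //; first by apply/andP; split; lra.
      by rewrite opprB addrC subrK gtr0_norm //; lra.
    have h1 := ler_distD_enorm (G (b i)) (G (tau i.+1)) (G (tau i)).
    have h2 := ler_distD_enorm (G (a i)) (G (b i)) (G (tau i)).
    move: vD; rewrite /v; lra.
  rewrite /ok -ltNge => h; rewrite mul0r add0r.
  have : enorm (G (tau i.+1) - G (tau i)) < eta.
    by apply: hrho; rewrite ?t0 ?s0 // ger0_norm // subr_ge0.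
  by lra.
rewrite (@plen_sum R _ G 0 w) big_mkord.
apply: le_trans (ler_sum _ (fun i _ => le1 i)) _.
rewrite big_split /= -mulr_suml sumr_const card_ord -natr_sum -cT.
have h3 : #|T|%:R * D <= 2 * A * K + D.
  move: H; rewrite mulrA ler_pdivrMr // mulrDl divfK ?gt_eqF //; lra.
have h4 : (2 * eta) *+ n <= 2^-1.
  rewrite -mulr_natr /eta mulrAC ler_pdivrMr //.
  have : (n%:R : R) <= n.+1%:R by rewrite ler_nat.
  by lra.
lra.
Qed.

End SimpleCurves.

(** * Local geometry at the flat points of the curve *)

Ltac natlia := repeat match goal with
  | H : ?T |- _ => lazymatch type of T with Prop => lazymatch T with
      | is_true (leq _ _) => fail
      | is_true (andb (leq _ _) (leq _ _)) => fail
      | @eq nat _ _ => fail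
      | _ => clear H end end end; lia.

Section DualVector.
Variable R : realType.
Local Notation plane := (R * R)%type.
Variables (N : plane -> R) (m M : R).
Hypothesis hN : plane_norm N m M.

(** [n] is a point of the unit ball of [N] where [dot f] is maximal, so that [dot f n] is the
    support function of the oval in the direction [f]; testing with [f] itself gives the lower
    bound. *)
Lemma dual_vector (f : plane) : enorm f = 1 -> exists n : plane,
  [/\ N n <= 1, M^-1 <= dot f n & forall x, dot f x <= dot f n * N x].
Proof.
move=> f1; have m0 := pnorm_m_gt0 hN; have M0 := pnorm_M_gt0 hN.
have Npos z : z != 0 -> 0 < N z.
  move=> z0; apply: lt_le_trans (pnorm_ge hN z).
  by rewrite mulr_gt0 // enorm_gt0.
have u0 (t : R) : ucirc t != 0 by rewrite -enorm_eq0 enorm_ucirc oner_eq0.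
pose g (t : R) := dot f (ucirc t) / N (ucirc t).
have cg : continuous g.
  apply: mulf_continuous.
    by apply: dot_continuous; [exact: cst_continuous|exact: ucirc_continuous].
  apply: invf_continuous; first by move=> t; rewrite gt_eqF // Npos.
  by apply: comp_cont; [exact: pnorm_continuous hN|exact: ucirc_continuous].
have [||t0 _ tmax] := @EVT_max R g 0 1; [exact: ler01|exact: continuous_subspaceT|].
have gm x : dot f x <= g t0 * N x.
  have [->|x0] := eqVneq x 0; first by rewrite dotr0 (pnorm0 hN) mulr0.
  have e0 : 0 < enorm x by rewrite enorm_gt0.
  have [|t t01 te] := @ucirc_surj R ((enorm x)^-1 *: x).
    by rewrite enormZ gtr0_norm ?invr_gt0 // mulVf ?gt_eqF.
  have := tmax t; rewrite in_itv /= t01 => /(_ isT); rewrite {1}/g te dotZr (pnormZ hN).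
  rewrite gtr0_norm ?invr_gt0 // -mulf_div divff ?mul1r ?gt_eqF ?invr_gt0 //.
  by rewrite ler_pdivrMr // Npos.
have gE : dot f ((N (ucirc t0))^-1 *: ucirc t0) = g t0 by rewrite dotZr mulrC.
exists ((N (ucirc t0))^-1 *: ucirc t0); rewrite gE; split=> //.
  by rewrite (pnormZ hN) gtr0_norm ?invr_gt0 ?Npos // mulVf // gt_eqF // Npos.
have f0 : f != 0 by rewrite -enorm_eq0 f1 oner_eq0.
have := gm f; rewrite -sqr_enorm f1 expr1n => h.
have := pnorm_le hN f; rewrite f1 mulr1 => NM.
have g0 : 0 < g t0 by rewrite ltNge; apply/negP => g0; have := Npos f f0; nra.
rewrite -(ler_pM2r M0) mulVf ?gt_eqF // (le_trans h) // ler_wpM2l // ltW //.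
Qed.

End DualVector.

Section Flat.
Variable R : realType.
Local Notation plane := (R * R)%type.
Variables (F : set plane) (h hi : plane -> plane).
Hypotheses (ch : continuous h) (hF : forall z, F (h z))
  (hK : forall z, enorm z <= 1 -> hi (h z) = z)
  (hiK : forall x, F x -> enorm (hi x) <= 1 /\ h (hi x) = x)
  (chi : {within F, continuous hi}).
Variable G : R -> plane.
Hypotheses (cG : continuous G) (GF : forall t, boundary F (G t)) (G01 : G 0 = G 1).
Hypothesis Gonto : forall x, boundary F x -> exists2 t, 0 <= t <= 1 & G t = x.

(* Near [p], up to a strip of half-width [s], the set [F] is the half plane
   with exterior normal [f]. *)
Definition flat (p f : plane) (r s : R) :=
  (forall z, enorm (z - p) < r ->
    (s < dot f (z - p) -> ~ F z) /\ (dot f (z - p) < - s -> F z)) /\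
  (forall x, boundary F x -> enorm (x - p) < r -> `|dot f (x - p)| <= s).

Lemma dotNl (z w : plane) : dot (- z) w = - dot z w.
Proof. by rewrite /dot /=; ring. Qed.

(** The part of the disk above the strip is convex and misses the boundary. *)
Lemma halfdisk_same_side (p f : plane) (r s : R) x y :
  (forall z, boundary F z -> enorm (z - p) < r -> `|dot f (z - p)| <= s) ->
  enorm (x - p) < r -> enorm (y - p) < r ->
  s < dot f (x - p) -> s < dot f (y - p) -> F x -> F y.
Proof.
move=> hs xr yr xs ys; apply: (segment_same_side ch hF hiK) => a /andP[a0 a1] bz.
have E : x + a *: (y - x) - p = (1 - a) *: (x - p) + a *: (y - p).
  by case: (x) (y) (p) => x1 x2 [y1 y2] [p1 p2]; congr pair => /=; rewrite /GRing.scale /=; ring.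
have := hs _ bz; rewrite E dotDr !dotZr.
have : enorm ((1 - a) *: (x - p) + a *: (y - p)) < r.
  apply: le_lt_trans (ler_enormD _ _) _; rewrite !enormZ !ger0_norm ?subr_ge0 //.
  by have [l|l] := leP a 2^-1; nra.
move=> -> /(_ isT); apply/negP; rewrite -ltNge (lt_le_trans _ (ler_norm _)) //.
by have [l|l] := leP a 2^-1; nra.
Qed.

(** The points at height [Y] above and below [p] lie outside the strip, and exactly one of them is
    in [F]; each cap of the disk follows its point. *)
Lemma flat_of_crossing (p e : plane) (r s Y a b : R) : enorm e = 1 ->
  0 <= s -> s < Y -> Y < r ->
  (forall x, boundary F x -> enorm (x - p) < r -> `|dot (perp e) (x - p)| <= s) ->
  0 <= a <= b -> b <= 1 ->
  (forall t : R, a <= t <= b -> enorm (G t - p) < Y) ->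
  (forall t : R, 0 <= t <= a \/ b <= t <= 1 ->
     dot e (G t - p) != 0 \/ Y < enorm (G t - p)) ->
  dot e (G a - p) < 0 < dot e (G b - p) ->
  flat p (perp e) r s \/ flat p (- perp e) r s.
Proof.
move=> e1 s0 sY Yr strip ab b1 inw outw gab; have Y0 := le_lt_trans s0 sY.
have pe1 : enorm (perp e) = 1 by rewrite enorm_perp.
have dpp : dot (perp e) (perp e) = 1 by rewrite -sqr_enorm pe1 expr1n.
have stripN x : boundary F x -> enorm (x - p) < r -> `|dot (- perp e) (x - p)| <= s.
  by move=> bx xr; rewrite dotNl normrN strip.
have [qp qm] : p + Y *: perp e - p = Y *: perp e /\ p - Y *: perp e - p = - (Y *: perp e).
  by split; rewrite addrC addKr.
have [eqp eqm] : enorm (p + Y *: perp e - p) < r /\ enorm (p - Y *: perp e - p) < r.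
  by rewrite qp qm enormN enormZ pe1 mulr1 gtr0_norm.
have [dqp dqm] : dot (perp e) (p + Y *: perp e - p) = Y /\
    dot (- perp e) (p - Y *: perp e - p) = Y.
  by rewrite qp qm dotNl dotNr opprK dotZr dpp mulr1.
have nb1 : ~ boundary F (p + Y *: perp e).
  by move=> /strip -/(_ eqp); rewrite dqp gtr0_norm // leNgt sY.
have nb2 : ~ boundary F (p - Y *: perp e).
  by move=> /stripN -/(_ eqm); rewrite dqm gtr0_norm // leNgt sY.
have := crossing_sides ch hF hK hiK chi cG GF G01 ab b1 Y0 e1 inw outw gab nb1 nb2.
have up z : enorm (z - p) < r -> s < dot (perp e) (z - p) -> (F z <-> F (p + Y *: perp e)).
  by move=> zr zs; split; apply: (halfdisk_same_side strip) => //; rewrite dqp.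
have down z : enorm (z - p) < r -> s < dot (- perp e) (z - p) -> (F z <-> F (p - Y *: perp e)).
  by move=> zr zs; split; apply: (halfdisk_same_side stripN) => //; rewrite dqm.
move=> sides; have [Fp|nFp] := pselect (F (p + Y *: perp e)); [right|left]; split=> // z zr; split.
- by move=> /(down _ zr) e'; rewrite e'; apply/sides.
- by rewrite dotNl ltrN2 => /(up _ zr) ->.
- by move=> /(up _ zr) ->.
rewrite ltrNr -dotNl => hz; apply/(down _ zr) => //.
by apply: contrapT => nF; apply: nFp; apply/sides.
Qed.

Lemma flat_normals_agree (p p' f : plane) (r s : R) : 0 < s -> 8 * s <= r ->
  enorm f = 1 -> enorm (p - p') <= r / 2 -> boundary F p' ->
  flat p f r s -> flat p' (- f) r s -> False.
Proof.
move=> s0 sr f1 pp bp' [fl st] [fl' _].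
have ff : dot f f = 1 by rewrite -sqr_enorm f1 expr1n.
(* Since [p'] is within [s] of the axis of [p], this point is above both strips: outside [F] for the
   first normal and in [F] for the second. The bound [8 * s <= r] keeps it in both disks. *)
pose z := p + (3 * s) *: f.
have s30 : 0 < 3 * s by rewrite mulr_gt0.
have zp : z - p = (3 * s) *: f by rewrite /z addrC addKr.
have ez : enorm (z - p) = 3 * s by rewrite zp enormZ f1 mulr1 gtr0_norm.
have [|nF _] := fl z; first by rewrite ez; lra.
have {}st : `|dot f (p' - p)| <= s by apply: st => //; rewrite enormB; lra.
apply: nF; first by rewrite zp dotZr ff; lra.
have [|_] := fl' z; first by have := ler_distD_enorm p z p'; rewrite ez; lra.
apply; have -> : z - p' = (z - p) - (p' - p) by rewrite opprB addrA subrK.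
rewrite dotNl dotBr zp dotZr ff.
by move: st; rewrite ler_norml => /andP[? ?]; lra.
Qed.

Section Mesh.
Variables (al be mu : R) (n : nat) (t : nat -> R) (e : plane) (kap : R).
Hypotheses (al0 : 0 <= al) (be1 : be <= 1) (mu0 : 0 < mu) (e1 : enorm e = 1).
Hypotheses (t0 : t 0%N = al) (tS : forall k, (k < n)%N -> t k < t k.+1) (tn : t n <= be)
  (tmu : forall k, (k < n)%N -> enorm (G (t k.+1) - G (t k)) = mu)
  (tcover : forall s, al <= s <= be -> exists2 k, (k <= n)%N &
      [/\ t k <= s, ((k < n)%N -> s <= t k.+1) & enorm (G s - G (t k)) <= mu]).

Lemma mesh_mono i j : (i <= j <= n)%N -> t i <= t j.
Proof.
case/andP; elim: j => [|j IH]; first by rewrite leqn0 => /eqP ->.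
rewrite leq_eqVlt => /predU1P[->//|ij jn].
by apply: le_trans (IH ij (ltnW jn)) (ltW (tS jn)).
Qed.

Lemma mesh_dist j k : (j <= k <= n)%N -> enorm (G (t k) - G (t j)) <= mu * (k - j)%:R.
Proof.
case/andP; elim: k => [|k IH]; first by rewrite leqn0 => /eqP ->; rewrite subrr enorm0 mulr0.
rewrite leq_eqVlt => /predU1P[->|jk kn]; first by rewrite subrr subnn enorm0 mulr0.
rewrite subSn // -natr1 mulrDr mulr1 [leRHS]addrC.
apply: le_trans (ler_distD_enorm (G (t k)) _ _) _; rewrite tmu // lerD2l.
exact: IH jk (ltnW kn).
Qed.

Lemma mesh_dist_abs j k : (j <= n)%N -> (k <= n)%N ->
  enorm (G (t j) - G (t k)) <= mu * `|j%:R - k%:R|.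
Proof.
move=> jn kn; have [jk|/ltnW kj] := leqP j k.
  by rewrite enormB distrC -natrB // normr_nat mesh_dist // jk.
by rewrite -natrB // normr_nat mesh_dist // kj.
Qed.

(* The mesh makes progress in the direction [e] at a rate close to its length,
   seen from the vertex [k]. *)
Definition good_vertex k :=
  (forall j, (k <= j <= n)%N ->
     (1 - kap ^+ 2 / 4) * (mu * (j - k)%:R) <= dot e (G (t j) - G (t k))) /\
  (forall j, (j <= k)%N ->
     (1 - kap ^+ 2 / 4) * (mu * (k - j)%:R) <= dot e (G (t k) - G (t j))).

Hypotheses (kap0 : 0 < kap) (kap4 : kap <= 4^-1).

Lemma kap_sqr_le : kap ^+ 2 <= 16^-1.
Proof.
have -> : 16^-1 = 4^-1 ^+ 2 :> R by field.
by rewrite lerXn2r // nnegrE ltW.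
Qed.

Lemma good_vertex_abs j k : good_vertex k -> (j <= n)%N -> (k <= n)%N ->
  (1 - kap ^+ 2 / 4) * (mu * `|j%:R - k%:R|) <= `|dot e (G (t j) - G (t k))|.
Proof.
move=> [gr gl] jn kn; have [jk|/ltnW kj] := leqP j k.
  rewrite distrC -natrB // normr_nat (le_trans (gl j jk)) //.
  by rewrite -[G (t j) - _]opprB dotNr normrN ler_norm.
by rewrite -natrB // normr_nat (le_trans (gr j _)) ?kj // ler_norm.
Qed.

(** If u is the progress, v the deviation and W the mesh length, then u^2 + v^2 <= W^2 and W (1 -
    kap^2 / 4) <= |u|; this gives v^2 <= kap^2 u^2, which explains the rate in [good_vertex]. *)
Lemma good_vertex_cone j k : good_vertex k -> (j <= n)%N -> (k <= n)%N ->
  `|dot (perp e) (G (t j) - G (t k))| <= kap * `|dot e (G (t j) - G (t k))|.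
Proof.
move=> gk jn kn; have h1 := good_vertex_abs gk jn kn.
have := mesh_dist_abs jn kn; set W := mu * _ in h1 *.
have W0 : 0 <= W by rewrite mulr_ge0 // ltW.
rewrite enorm_le // -sqr_enorm -(unit_dotE _ e1).
set u := dot e _ in h1 *; set v := dot (perp e) _ => uv.
rewrite -ler_sqr ?nnegrE ?mulr_ge0 ?(ltW kap0) // exprMn !real_normK ?num_real //.
have k2 := kap_sqr_le.
have k20 : 0 <= kap ^+ 2 by rewrite sqr_ge0.
have c0 : 0 <= 1 - kap ^+ 2 / 4 by lra.
have h2 : (1 - kap ^+ 2 / 4) ^+ 2 * W ^+ 2 <= u ^+ 2.
  rewrite -exprMn -[u ^+ 2]real_normK ?num_real //.
  by rewrite ler_sqr ?nnegrE // mulr_ge0.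
have h3 : 1 <= (1 + kap ^+ 2) * (1 - kap ^+ 2 / 4) ^+ 2.
  move: k2 k20; set x := kap ^+ 2 => x1 x0.
  have -> : (1 + x) * (1 - x / 4) ^+ 2 = 1 + x * (2^-1 - 7 / 16 * x + x ^+ 2 / 16) by field.
  rewrite lerDl mulr_ge0 // addr_ge0 ?divr_ge0 ?sqr_ge0 //; lra.
have h4 : W ^+ 2 <= (1 + kap ^+ 2) * ((1 - kap ^+ 2 / 4) ^+ 2 * W ^+ 2).
  by rewrite mulrA ler_peMl // sqr_ge0.
have h5 := ler_wpM2l (_ : 0 <= 1 + kap ^+ 2) h2.
have {}h5 := h5 (addr_ge0 ler01 k20); lra.
Qed.

(** The half-width of the strip is one step, by which the curve strays from its mesh, plus the
    height [kap * (r + mu)] of the cone at the vertex. *)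
Lemma mesh_flat k r : good_vertex k -> (k <= n)%N -> 16 * mu <= r ->
  (forall s, 0 <= s <= 1 -> s <= al \/ be <= s -> r <= enorm (G s - G (t k))) ->
  flat (G (t k)) (perp e) r (kap * r + 2 * mu) \/
  flat (G (t k)) (- perp e) r (kap * r + 2 * mu).
Proof.
move=> gk kn mur far; set p := G (t k).
have [mu0' al0' be1'] : [/\ 0 < mu, 0 <= al & be <= 1] by [].
have r0 : 0 < r by apply: lt_le_trans mur; rewrite mulr_gt0.
have k2 := kap_sqr_le.
have k20 : 0 <= kap ^+ 2 by rewrite sqr_ge0.
have albe : al <= be.
  by rewrite (le_trans _ tn) // -t0 mesh_mono // leqnn.
(* The ends of the arc are at least 16 steps away, so a window of three steps on both sides fits in;
   one step is lost on the right because the mesh may stop short of [be]. *)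
have kbig : (16 <= k)%N.
  have := far al; rewrite al0 (le_trans albe be1) => /(_ isT (or_introl (lexx _))).
  rewrite -t0 enormB => hr; have := mesh_dist (j := 0) (k := k) _.
  rewrite subn0 kn => /(_ isT) h2.
  rewrite -(ler_nat R) -(ler_pM2l mu0); lra.
have nbig : (15 <= n - k)%N.
  have := far be; rewrite (le_trans al0 albe) be1 => /(_ isT (or_intror (lexx _))) hr.
  have [|j jn [j1 j2 j3]] := tcover (s := be); first by rewrite albe lexx.
  have [jk|kj] := ltnP j k.
    have tkb : t k = be.
      apply/eqP; rewrite eq_le; apply/andP; split.
        by apply: le_trans tn; rewrite mesh_mono // kn leqnn.
      by apply: le_trans (j2 (leq_trans jk kn)) _; apply: mesh_mono; rewrite jk kn.
    by move: hr; rewrite -tkb subrr enorm0 leNgt r0.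
  have h2 := mesh_dist (j := k) (k := j); rewrite kj jn in h2; have {}h2 := h2 isT.
  have h3 := ler_distD_enorm (G (t j)) (G be) (G (t k)).
  suff : (15 <= j - k)%N by natlia.
  rewrite -(ler_nat R) -(ler_pM2l mu0); lra.
have idx3 : ((k - (k - 3)) = 3)%N /\ ((k + 3) - k = 3)%N by natlia.
have [i3 i3'] := idx3.
have [nk1 nk2] : (k - 3 <= n)%N /\ (k + 3 <= n)%N by natlia.
have du x y : `|dot e (x - y)| <= enorm (x - y) := ler_dot_unit _ e1.
have dv x y : `|dot (perp e) (x - y)| <= enorm (x - y).
  by apply: ler_dot_unit; rewrite enorm_perp.
have split_dot f x y : dot f (x - p) = dot f (x - y) + dot f (y - p).
  by rewrite -dotDr addrA subrK.
have muY : 8 * mu <= r / 2 by lra.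
(* Outside this window the mesh has advanced by more than one step along [e], so a curve point
   cannot project onto [p]; inside it the curve stays within 5 steps, less than [r / 2]. *)
apply: (@flat_of_crossing p e r _ (r / 2) (t (k - 3)) (t (k + 3))) => //.
- by rewrite addr_ge0 // mulr_ge0 // ltW.
- have : kap * r <= 4^-1 * r by rewrite ler_pM2r.
  by lra.
- by lra.
- move=> x bx xr; have [s s01 xE] := Gonto bx.
  have sab : al <= s <= be.
    apply/andP; split; rewrite leNgt; apply/negP => lt.
      have := far s s01 (or_introl (ltW lt)); rewrite xE leNgt; by rewrite xr.
    by have := far s s01 (or_intror (ltW lt)); rewrite xE leNgt xr.
  have [j jn [j1 j2 j3]] := tcover sab; rewrite xE in j3.
  have := good_vertex_cone gk jn kn; have := dv x (G (t j)); have := du x (G (t j)).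
  rewrite -/p => h1 h2 h3; rewrite (split_dot (perp e) x (G (t j))).
  have h4 := ler_normD (dot (perp e) (x - G (t j))) (dot (perp e) (G (t j) - p)).
  have h5 := ler_normB (dot e (x - p)) (dot e (x - G (t j))).
  rewrite (split_dot e x (G (t j))) addrC addrA addNr add0r -split_dot in h5.
  have h6 := le_lt_trans (ler_dot_unit (x - p) e1) xr.
  have h7 : kap * `|dot e (G (t j) - p)| <= kap * (r + mu) by rewrite ler_pM2l //; lra.
  have h8 : kap * mu <= 4^-1 * mu by rewrite ler_pM2r.
  apply: le_trans h4 _; apply: le_trans (lerD (le_trans h2 j3) (le_trans h3 h7)) _.
  rewrite [kap * _]mulrDr addrCA lerD2l mulr_natl mulr2n lerD2l (le_trans h8) //.
  by rewrite ler_piMl ?(ltW mu0) // invf_le1 // ler1n.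
- apply/andP; split; last by rewrite mesh_mono //; natlia.
  by rewrite (le_trans al0) // -t0 mesh_mono.
- by rewrite (le_trans _ be1) // (le_trans _ tn) // mesh_mono //; natlia.
- move=> s /andP[s1 s2].
  have sab : al <= s <= be.
    apply/andP; split; first by rewrite (le_trans _ s1) // -t0 mesh_mono.
    by rewrite (le_trans s2) // (le_trans _ tn) // mesh_mono //; natlia.
  have [j jn [j1 j2 j3]] := tcover sab.
  have jk : (j <= k + 3)%N.
    rewrite leqNgt; apply/negP => lt; have := tS (k := (k + 3)%N) ltac:(natlia).
    have := mesh_mono (i := (k + 3).+1) (j := j); rewrite lt jn => /(_ isT); lra.
  have kj : (k - 4 <= j)%N.
    rewrite leqNgt; apply/negP => lt; have := j2 ltac:(natlia).
    have := tS (k := (k - 4)%N) ltac:(natlia).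
    have -> : (k - 4).+1 = (k - 3)%N by natlia.
    have := mesh_mono (i := j.+1) (j := (k - 4)%N); have -> : (j < k - 4 <= n)%N by natlia.
    by move=> /(_ isT); lra.
  apply: le_lt_trans (ler_distD_enorm (G (t j)) _ _) _.
  have := mesh_dist_abs jn kn; rewrite -/p.
  have : mu * `|j%:R - k%:R| <= mu * 4.
    rewrite ler_pM2l // ler_norml; apply/andP; split.
      rewrite lerNl opprB lerBlDl -natrD ler_nat; natlia.
    rewrite lerBlDl -natrD ler_nat; natlia.
  by lra.
- move=> s hs; have [sab|nab] := boolP (al < s < be); last first.
    right; have : s <= al \/ be <= s by move: nab; rewrite negb_and -!leNgt => /orP.
    have s01 : 0 <= s <= 1.
      have a1 : t (k - 3) <= be by rewrite (le_trans _ tn) // mesh_mono //; natlia.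
      have a2 : al <= t (k + 3)%N by rewrite -t0 mesh_mono.
      by case: hs => /andP[? ?]; apply/andP; split; lra.
    by move=> /(far s s01); rewrite -/p; lra.
  left; have /andP[s1 s2] := sab.
  have [|j jn [j1 j2 j3]] := tcover (s := s); first by rewrite !ltW.
  have := le_trans (du (G s) (G (t j))) j3; rewrite ler_norml => /andP[d1 d2].
  have [gr gl] := gk; rewrite (split_dot e _ (G (t j))).
  case: hs => /andP[h1 h2].
    have jk : (j <= k - 3)%N.
      rewrite leqNgt; apply/negP => lt; have := tS (k := (k - 3)%N) ltac:(natlia).
      by have := mesh_mono (i := (k - 3).+1) (j := j); rewrite lt jn => /(_ isT); lra.
    have := gl j ltac:(natlia); rewrite -/p -[p - _]opprB dotNr => g.
    have : mu * 3 <= mu * (k - j)%:R by rewrite ler_pM2l // ler_nat; natlia.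
    set W := mu * (k - j)%:R in g * => W3.
    have : 2^-1 * W <= (1 - kap ^+ 2 / 4) * W by rewrite ler_wpM2r //; lra.
    by move=> g2; rewrite lt_eqF //; lra.
  have kj : (k + 2 <= j)%N.
    rewrite leqNgt; apply/negP => lt; have jn' : (j < n)%N by natlia.
    have := j2 jn'; have := tS (k := (k + 2)%N) ltac:(natlia).
    have -> : (k + 2).+1 = (k + 3)%N by natlia.
    have := mesh_mono (i := j.+1) (j := (k + 2)%N).
    by have -> : (j < k + 2 <= n)%N by [natlia]; move=> /(_ isT); lra.
  have := gr j ltac:(natlia); rewrite -/p => g.
  have : mu * 2 <= mu * (j - k)%:R by rewrite ler_pM2l // ler_nat; natlia.
  set W := mu * (j - k)%:R in g * => W2.
  have : (3/4) * W <= (1 - kap ^+ 2 / 4) * W by rewrite ler_wpM2r //; lra.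
  by move=> g2; rewrite gt_eqF //; lra.
have [gr gl] := gk; apply/andP; split.
  have := gl (k - 3)%N ltac:(natlia); rewrite i3 -/p -[p - _]opprB dotNr.
  have : 0 < (1 - kap ^+ 2 / 4) * (mu * 3) by rewrite mulr_gt0 ?mulr_gt0 //; lra.
  by lra.
have := gr (k + 3)%N ltac:(natlia); rewrite i3' -/p.
have : 0 < (1 - kap ^+ 2 / 4) * (mu * 3) by rewrite mulr_gt0 ?mulr_gt0 //; lra.
by lra.
Qed.

End Mesh.
End Flat.

(** * Centers of touching homothets near a flat point *)

Section Centers.
Variable R : realType.
Local Notation plane := (R * R)%type.
Variables (F : set plane) (N : plane -> R) (m M : R).
Hypotheses (hN : plane_norm N m M) (Fcompact : compact F).

(** The center is at most [l * dot f n] above the contact point. If it were too low, the homothet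
    would reach below the strip, where everything belongs to [F]. *)
Lemma touching_height (p f n x q : plane) (l mu r s : R) :
  flat F p f r s -> enorm f = 1 -> N n <= 1 -> M^-1 <= dot f n ->
  (forall y, dot f y <= dot f n * N y) ->
  0 < l -> 0 < s -> mu <= s -> 2 * (l / m) + mu < r ->
  (forall y, F y -> l <= N (y - q)) -> N (x - q) = l -> enorm (x - p) <= mu ->
  l * dot f n - s <= dot f (q - p) <= l * dot f n + mu.
Proof.
move=> [fl _] f1 n1 nM nd l0 s0 mus lr qF xq xp.
have m0 := pnorm_m_gt0 hN; have M0 := pnorm_M_gt0 hN.
have e_le z : enorm z <= N z / m by rewrite ler_pdivlMr // mulrC (pnorm_ge hN).
set hf := dot f n in nM nd *.
have hf0 : 0 < hf by apply: lt_le_trans nM; rewrite invr_gt0.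
have dxp : `|dot f (x - p)| <= mu by apply: le_trans (ler_dot_unit _ f1) xp.
have dqE : dot f (q - p) = dot f (q - x) + dot f (x - p) by rewrite -dotDr addrA subrK.
have dqx : `|dot f (q - x)| <= l * hf.
  rewrite ler_norml; apply/andP; split.
    by rewrite lerNl -dotNr opprB (le_trans (nd _)) // xq mulrC.
  by rewrite (le_trans (nd _)) // (pnormB hN) xq mulrC.
move: dxp dqx; rewrite !ler_norml => /andP[a1 a2] /andP[b1 b2].
apply/andP; split; last by rewrite dqE; lra.
rewrite leNgt; apply/negP => lt; set D := dot f (q - p) in dqE lt.
(* The midpoint of [D + s] and [l * hf]: below the latter, so [z] is in the open homothet, and above
   the former, so [z] is at a height less than [- s]. *)
pose th := (l * hf + s + D) / 2.
have th0 : 0 <= th by rewrite divr_ge0 //; lra.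
have th1 : th < l * hf by rewrite /th; lra.
pose a := th / hf.
have a0 : 0 <= a by rewrite divr_ge0 // ltW.
have al : a < l by rewrite ltr_pdivrMr.
pose z := q - a *: n.
have Nz : N (z - q) < l.
  rewrite /z addrC addKr (pnormN hN) (pnormZ hN) ger0_norm //.
  by apply: le_lt_trans al; rewrite ler_piMr.
have [|_ Fz] := fl z.
  have h1 := ler_distD_enorm q z p; have h2 := ler_distD_enorm x q p.
  have h3 : enorm (z - q) <= l / m by apply: le_trans (e_le _) _; rewrite ler_pM2r ?invr_gt0 // ltW.
  have h4 : enorm (q - x) <= l / m by apply: le_trans (e_le _) _; rewrite (pnormB hN) xq.
  lra.
suff /qF : F z by rewrite leNgt Nz.
apply: Fz.
have -> : z - p = (q - p) - a *: n by rewrite /z addrAC.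
by rewrite dotBr dotZr -/D -/hf /a divfK ?gt_eqF // /th; lra.
Qed.

Lemma nearest_point (q : plane) : F !=set0 ->
  exists x, F x /\ forall y, F y -> N (x - q) <= N (y - q).
Proof.
move=> F0; have [|x] := @compact_EVT_min _ R (fun x : plane => N (x - q)) F F0 Fcompact.
  apply: continuous_subspaceT; apply: comp_cont; first exact: pnorm_continuous hN.
  by apply: subf_continuous; [move=> ?; exact: cvg_id|exact: cst_continuous].
rewrite inE => Fx xmin; exists x; split=> // y Fy; apply: xmin.
by rewrite inE.
Qed.

(** The distance to [F] from [p + a *: n] is 1-Lipschitz in [a]. It is at most [l] at [a = l]
    because [p] is in [F]; raising [a] by [2 * s * M] raises the height by at least [2 * s], which
    lifts the homothet above the strip. *)
Lemma touching_center_exists (p f n : plane) (l r s : R) :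
  flat F p f r s -> F p -> N n <= 1 -> M^-1 <= dot f n ->
  (forall y, dot f y <= dot f n * N y) ->
  0 < l -> 0 < s -> 2 * s * M <= l -> 3 * (l / m) < r ->
  exists2 a, l <= a <= l + 2 * s * M & touching_center N F l (p + a *: n).
Proof.
move=> [fl _] Fp n1 nM nd l0 s0 sMl lr.
have m0 := pnorm_m_gt0 hN; have M0 := pnorm_M_gt0 hN.
have e_le z : enorm z <= N z / m by rewrite ler_pdivlMr // mulrC (pnorm_ge hN).
set hf := dot f n in nM nd *.
have hf0 : 0 < hf by apply: lt_le_trans nM; rewrite invr_gt0.
have [xm hxm] := choice (fun q => nearest_point q (ex_intro _ p Fp)).
pose D q := N (xm q - q).
have DL q q' : D q <= D q' + N (q' - q).
  rewrite /D; have [_ /(_ _ (hxm q').1)] := hxm q => /le_trans; apply.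
  exact: pnorm_distD hN _ _ _.
pose phi a := D (p + a *: n).
have phiL a b : phi a <= phi b + `|b - a|.
  apply: le_trans (DL _ (p + b *: n)) _; rewrite lerD2l opprD addrACA subrr add0r.
  by rewrite -scalerBl (pnormZ hN) ler_piMr.
have cphi : continuous phi.
  move=> a; apply/cvgrPdist_lt => e e0.
  apply: filterS (nbhsx_ballx a e e0) => b; apply: le_lt_trans.
  have h1 := phiL a b; have h2 := phiL b a; rewrite distrC in h1.
  by rewrite ler_distl; apply/andP; split; lra.
have sM0 : 0 < 2 * s * M by rewrite !mulr_gt0.
have lle : l <= l + 2 * s * M by rewrite lerDl ltW.
have phi1 : phi l <= l.
  rewrite /phi /D; have [_ /(_ p Fp)] := hxm (p + l *: n) => /le_trans; apply.
  by rewrite opprD addrA subrr add0r (pnormN hN) (pnormZ hN) gtr0_norm // ler_piMr // ltW.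
have phi2 : l <= phi (l + 2 * s * M).
  set a := l + _; have a0 : 0 < a by rewrite addr_gt0.
  rewrite leNgt; apply/negP; rewrite /phi /D; set q := p + _; set z := xm q => Nz.
  have Fz : F z by have [] := hxm q.
  have qp : q - p = a *: n by rewrite /q addrC addKr.
  have [|nF _] := fl z.
    apply: le_lt_trans (ler_distD_enorm q _ _) _.
    have h1 : enorm (z - q) < l / m by apply: le_lt_trans (e_le _) _; rewrite ltr_pM2r ?invr_gt0.
    have h2 : enorm (q - p) <= 2 * (l / m).
      apply: le_trans (e_le _) _; rewrite qp (pnormZ hN) gtr0_norm // mulrA ler_pM2r ?invr_gt0 //.
      apply: le_trans (_ : a <= _); first by rewrite ler_piMr // ltW.
      by rewrite /a; lra.
    lra.
  apply: nF Fz; have -> : z - p = (z - q) + (q - p) by rewrite addrA subrK.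
  rewrite dotDr qp dotZr -/hf.
  have := nd (q - z); rewrite (pnormB hN) -[q - z]opprB dotNr => h1.
  have h2 : hf * N (z - q) < hf * l by rewrite ltr_pM2l.
  have h3 : 2 * s <= 2 * s * M * hf.
    by rewrite -mulrA ler_peMr ?mulr_ge0 ?(ltW s0) // mulrC -ler_pdivrMr // div1r.
  have h4 : a * hf = l * hf + 2 * s * M * hf by rewrite /a mulrDl.
  lra.
have [||a] := @IVT R phi l (l + 2 * s * M) l lle.
- exact: continuous_subspaceT.
- by rewrite ge_min phi1 /= le_max phi2 orbT.
rewrite in_itv /= => ab ae; exists a => //.
have [Fx xmin] := hxm (p + a *: n); split; first by exists (xm (p + a *: n)).
by move=> y Fy; rewrite -ae; exact: xmin.
Qed.

End Centers.

(** * Number of bad vertices in a mesh of an arc *)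

Section ArcMesh.
Variable R : realType.
Local Notation plane := (R * R)%type.
Variables (G : R -> plane) (L : R).
Hypothesis cG : continuous G.
Hypothesis HL : forall w, path <=%R 0 w -> last 0 w <= 1 -> plen (@enorm R) G 0 w <= L.

Lemma card_index_between n (P : pred 'I_n.+1) (i j : nat) : (i <= j)%N ->
  (forall k, P k -> (i <= k <= j)%N) -> (#|P| <= (j - i).+1)%N.
Proof.
move=> ij h; rewrite -(ler_nat R) -card_sig.
have ij' : i%:R <= j%:R :> R by rewrite ler_nat.
have := @line_packing R {k | P k} (fun k => (val (val k))%:R) i%:R j%:R 1 ltr01 ij' _ _.
rewrite mulr1 -natrB // natr1; apply=> [k|k k' kk].
  by rewrite !ler_nat h // (valP k).
case: (ltngtP (val (val k)) (val (val k'))) => [lt|lt|e].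
- by rewrite distrC -natrB 1?ltnW // normr_nat ler1n subn_gt0.
- by rewrite -natrB 1?ltnW // normr_nat ler1n subn_gt0.
by move: kk; rewrite -val_eqE /= -val_eqE /= e eqxx.
Qed.

Variables (al be a b mu kap : R) (e : plane).
Hypotheses (al0 : 0 <= al) (ala : al < a) (ab : a <= b) (bbe : b < be) (be1 : be <= 1).
Hypotheses (mu0 : 0 < mu) (kap0 : 0 < kap) (e1 : enorm e = 1).
Hypothesis eE : dot e (G be - G al) = enorm (G be - G al).

Lemma plen_mesh (t : nat -> R) n i d :
  (forall k, (k < n)%N -> t k < t k.+1) ->
  (forall k, (k < n)%N -> enorm (G (t k.+1) - G (t k)) = mu) -> (i + d <= n)%N ->
  [/\ plen (@enorm R) G (t i) [seq t k | k <- iota i.+1 d] = mu * d%:R,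
      path <=%R (t i) [seq t k | k <- iota i.+1 d] &
      last (t i) [seq t k | k <- iota i.+1 d] = t (i + d)%N].
Proof.
move=> tS tmu; elim: d i => [|d IH] i idn; first by rewrite /= mulr0 addn0.
have [|h1 h2 h3] := IH i.+1; first by rewrite addSnnS.
have lt : (i < n)%N by apply: leq_trans idn; rewrite -addSnnS leq_addr.
split=> /=.
- by rewrite h1 tmu // -natr1 mulrDr mulr1 addrC.
- by rewrite h2 ltW // tS.
- by rewrite h3 addSnnS.
Qed.

(** [card_steep] is applied to the deficit of the mesh, whose total is at most the excess of length
    plus one step, at the rate [kap ^+ 2 / 4 * mu]: this is the origin of the factor
    [8 / kap ^+ 2]. *)
Lemma arc_mesh_exists : exists n (t : nat -> R), [/\
   [/\ t 0%N = al, (forall k, (k < n)%N -> t k < t k.+1), t n <= be,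
    (forall k, (k < n)%N -> enorm (G (t k.+1) - G (t k)) = mu) &
    forall s, al <= s <= be -> exists2 k, (k <= n)%N &
      [/\ t k <= s, ((k < n)%N -> s <= t k.+1) & enorm (G s - G (t k)) <= mu]],
   enorm (G be - G (t n)) <= mu &
   mu * #|[pred k : 'I_n.+1 | ~~ (`[< good_vertex G mu n t e kap k >] && (a <= t k <= b))]|%:R
   <= (8 / kap ^+ 2 + 1) * (arclen G al be - enorm (G be - G al))
      + (enorm (G be - G al) - enorm (G b - G a)) + (8 / kap ^+ 2 + 3) * mu].
Proof.
have albe : al <= be by apply: le_trans (ltW ala) (le_trans ab (ltW bbe)).
have b1 : b <= 1 := le_trans (ltW bbe) be1.
have a0 : 0 <= a := le_trans al0 (ltW ala).
have [|n [t [t0 tS tn tmu tc]]] := mesh_exists cG mu0 (K := (Num.truncn (L / mu)).+1) albe.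
  move=> w hw; apply: le_lt_trans (chain_bounded HL al0 be1 hw) _.
  rewrite -ltr_pdivrMr //.
  have L0 : 0 <= L by have := HL (w := [::]); rewrite /= ler01 => /(_ isT isT).
  by have /andP[] := truncn_itv (divr_ge0 L0 (ltW mu0)).
exists n, t; split=> //.
  have [|k kn [k1 k2 k3]] := tc be; first by rewrite albe lexx.
  have [lt|ge] := ltnP k n; last by have <- : k = n by apply/eqP; rewrite eqn_leq kn.
  have -> : t n = be; last by rewrite subrr enorm0 ltW.
  apply/eqP; rewrite eq_le tn (le_trans (k2 lt)) //.
  by apply: (mesh_mono tS); rewrite lt leqnn.
set l := arclen G al be; set c := enorm (G be - G al).
pose u k := dot e (G (t k) - G al).
pose D (k : nat) := mu * k%:R - u k.
have uB j k : u j - u k = dot e (G (t j) - G (t k)).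
  by rewrite /u -dotBr opprB addrA subrK.
have Dm k : (k < n)%N -> D k <= D k.+1.
  move=> kn; rewrite /D -natr1 mulrDr mulr1.
  have := le_trans (ler_norm _) (ler_dot_unit (G (t k.+1) - G (t k)) e1).
  by rewrite tmu // -uB; lra.
have nl : mu * n%:R <= l.
  have [h1 h2 h3] := @plen_mesh t n 0 n tS tmu (leqnn _).
  rewrite t0 in h1 h2 h3; rewrite -h1; apply: (plen_arclen HL al0 be1).
  by rewrite /chain h2 h3 add0n tn.
have un : c - mu <= u n.
  have [|k kn [k1 k2 k3]] := tc be; first by rewrite albe lexx.
  have kE : enorm (G be - G (t n)) <= mu.
    have [lt|ge] := ltnP k n; last by have <- : k = n by apply/eqP; rewrite eqn_leq kn.
    have -> : t n = be; last by rewrite subrr enorm0 ltW.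
    apply/eqP; rewrite eq_le tn (le_trans (k2 lt)) //.
    by apply: (mesh_mono tS); rewrite lt leqnn.
  have := le_trans (ler_norm _) (le_trans (ler_dot_unit _ e1) kE).
  have -> : G be - G (t n) = (G be - G al) - (G (t n) - G al) by rewrite opprB addrA subrK.
  by rewrite dotBr eE -/c -/(u n); lra.
have kk0 : 0 < kap ^+ 2 by rewrite exprn_gt0.
have rate0 : 0 < kap ^+ 2 / 4 * mu by rewrite mulr_gt0 // divr_gt0.
have hst := card_steep rate0 Dm.
have D0 : D 0%N = 0 by rewrite /D /u t0 subrr dotr0 mulr0 subr0.
have Dn : D n <= l - c + mu by rewrite /D; move: nl un; lra.
set S := #|_|%:R in hst.
have hS : mu * S <= (8 / kap ^+ 2) * (l - c + mu).
  rewrite D0 subr0 in hst.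
  rewrite -(ler_pM2l (_ : 0 < kap ^+ 2 / 4)) ?divr_gt0 //.
  have -> : kap ^+ 2 / 4 * (8 / kap ^+ 2 * (l - c + mu)) = 2 * (l - c + mu).
    by field; rewrite gt_eqF.
  by rewrite mulrA; lra.
(* Vertices outside [a, b] are paid for by the lengths of the two end pieces, together at most the
   length of the arc minus the chord from [a] to [b]. *)
pose PL := [pred k : 'I_n.+1 | t k < a]; pose PR := [pred k : 'I_n.+1 | b < t k].
have cL : mu * #|PL|%:R <= arclen G al a + mu.
  have ex : exists i, (i <= n)%N && (t i < a) by exists 0%N; rewrite t0 ala.
  have ub i : (i <= n)%N && (t i < a) -> (i <= n)%N by case/andP.
  case: (ex_maxnP ex ub) => i /andP[ni ti] imax.
  have : (#|PL| <= i.+1)%N.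
    rewrite -[X in (_ <= X.+1)%N]subn0; apply: card_index_between => // k /= tk.
    by apply: imax; rewrite tk andbT -ltnS ltn_ord.
  rewrite -(ler_nat R) -natr1 => hc.
  have [h1 h2 h3] := @plen_mesh t n 0 i tS tmu ni.
  have : mu * i%:R <= arclen G al a.
    rewrite t0 in h1 h2 h3; rewrite -h1.
    apply: (plen_arclen HL al0 (le_trans ab b1)).
    by rewrite /chain h2 h3 add0n ltW.
  have := ler_wpM2l (ltW mu0) hc; rewrite mulrDr mulr1; lra.
have cR : mu * #|PR|%:R <= arclen G b be + mu.
  have [|none] := pselect (exists i, (i <= n)%N && (b < t i)); last first.
    have -> : #|PR| = 0%N.
      apply: eq_card0 => k; rewrite !inE; apply/negbTE/negP => bt; apply: none.
      by exists k; rewrite bt andbT -ltnS ltn_ord.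
    have := chord_arclen HL (le_trans a0 ab) (ltW bbe) be1.
    by have := enorm_ge0 (G be - G b); have := mu0; rewrite mulr0; lra.
  move=> ex; case: (ex_minnP ex) => i /andP[ni ti] imin.
  have : (#|PR| <= (n - i).+1)%N.
    apply: card_index_between => // k /= tk; have kn : (k <= n)%N by rewrite -ltnS.
    by rewrite kn andbT; apply: imin; rewrite tk andbT.
  rewrite -(ler_nat R) -natr1 => hc.
  have [|h1 h2 h3] := @plen_mesh t n i (n - i)%N tS tmu; first by rewrite subnKC.
  have : mu * (n - i)%:R <= arclen G b be.
    apply: le_trans (plen_arclen HL (w := t i :: [seq t k | k <- iota i.+1 (n - i)]) _ be1 _).
    - by rewrite /= h1 lerDr enorm_ge0.
    - exact: le_trans a0 ab.
    - by rewrite /chain /= h2 h3 subnKC // tn ltW.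
  have := ler_wpM2l (ltW mu0) hc; rewrite mulrDr mulr1; lra.
have hLR : arclen G al a + arclen G b be <= l - enorm (G b - G a).
  have h1 := arclen_superadd HL al0 (ltW ala) (le_trans ab (ltW bbe)) be1.
  have h2 := arclen_superadd HL a0 ab (ltW bbe) be1.
  have h3 := chord_arclen HL a0 ab b1.
  rewrite -/l in h1; lra.
set Bad := #|_|%:R.
have hBad : Bad <= S + #|PL|%:R + #|PR|%:R.
  rewrite /Bad /S -!natrD ler_nat.
  have card_predU (A B : pred 'I_n.+1) : (#|[predU A & B]| <= #|A| + #|B|)%N.
    by rewrite -cardUI leq_addr.
  set PS := (X in (_ <= #|pred_of_simpl X| + _ + _)%N).
  apply: leq_trans (_ : #|[predU [predU PS & PL] & PR]| <= _)%N; last first.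
    by apply: leq_trans (card_predU _ _) _; rewrite leq_add2r card_predU.
  apply/subset_leq_card/fintype.subsetP => k; rewrite !inE.
  have [//|] := boolP (b < t k); first by rewrite orbT.
  have [//|] := boolP (t k < a); first by rewrite orbT.
  rewrite -!leNgt => -> -> /=; rewrite andbT !orbF => /negP ng.
  apply: contrapT => /negP.
  rewrite negb_or => /andP[/asboolP nr /asboolP nl'].
  have kn : (k <= n)%N by rewrite -ltnS ltn_ord.
  apply: ng; apply/asboolP; split=> j.
    move=> /andP[kj jn]; rewrite leNgt; apply/negP => lt; apply: nr.
    have kj' : (k < j)%N.
      rewrite ltn_neqAle kj andbT; apply/eqP => ejk; move: lt.
      by rewrite -ejk subnn subrr dotr0 !mulr0 ltxx.
    exists j; first by rewrite kj'.
    move: lt; rewrite -uB /D natrB // => lt.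
    have -> : mu * j%:R - u j - (mu * k%:R - u k) = mu * (j%:R - k%:R) - (u j - u k) by ring.
    by move: lt; set W := mu * _; rewrite -mulrA -/W; lra.
  move=> jk; rewrite leNgt; apply/negP => lt; apply: nl'.
  have kj' : (j < k)%N.
    rewrite ltn_neqAle jk andbT; apply/eqP => ejk; move: lt.
    by rewrite ejk subnn subrr dotr0 !mulr0 ltxx.
  exists j => //.
  move: lt; rewrite -uB /D natrB // => lt.
  have -> : mu * k%:R - u k - (mu * j%:R - u j) = mu * (k%:R - j%:R) - (u k - u j) by ring.
  by move: lt; set W := mu * _; rewrite -mulrA -/W; lra.
have h1 : mu * Bad <= mu * S + mu * #|PL|%:R + mu * #|PR|%:R.
  by rewrite -!mulrDr ler_wpM2l // ltW.
have -> : (8 / kap ^+ 2 + 1) * (l - c) + (c - enorm (G b - G a)) + (8 / kap ^+ 2 + 3) * mu =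
  8 / kap ^+ 2 * (l - c + mu) + (l - enorm (G b - G a)) + 3 * mu by ring.
have := mu0; lra.
Qed.

End ArcMesh.

(** * Counting touching homothets along an arc *)

Section Scales.
Variable R : realType.
Variables (m M om : R).
Hypotheses (m0 : 0 < m) (M0 : 0 < M) (om0 : 0 < om) (om1 : om <= 1).

(* In units of the ratio [l] of the homothets: [rad] is the radius of the disks
   in which the curve is looked at, [mesh] the step of the mesh, and [slope]
   the aperture of the cones at the good vertices. *)
Definition rad : R := 12 / m + 12.
Definition slope : R := om / (4 * rad * (M + 1)).
Definition mesh : R := om / (32 * (M + 1)).
(** The half-width given by [mesh_flat], in units of [l]. *)
Definition strip : R := slope * rad + 2 * mesh.
(** The bound of [plane_packing] for centers within (1/m + 1) l of one vertex and at Euclidean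
    distance at least 2 l / M from each other. *)
Definition fibre : nat := (Num.truncn (2 * M * (m^-1 + 1))).+1 ^ 2.

Lemma rad_ge12 : 12 <= rad.
Proof. by rewrite /rad lerDr divr_ge0 // ltW. Qed.

Lemma radE (l : R) : rad * l = 12 * (l / m) + 12 * l.
Proof. by rewrite /rad mulrDl -mulrA [m^-1 * l]mulrC. Qed.

Lemma rad_gt0 : 0 < rad.
Proof. by apply: lt_le_trans rad_ge12. Qed.

Lemma M1_gt0 : 0 < M + 1.
Proof. by rewrite addr_gt0. Qed.

Lemma slope_gt0 : 0 < slope.
Proof. by rewrite divr_gt0 // mulr_gt0 ?M1_gt0 // mulr_gt0 ?rad_gt0. Qed.

Lemma mesh_gt0 : 0 < mesh.
Proof. by rewrite divr_gt0 // mulr_gt0 ?M1_gt0. Qed.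

(** The factor [rad] in the denominator of [slope] cancels, so the strip is thin whatever the size
    of the disks. *)
Lemma stripE : strip = 5 / 16 * (om / (M + 1)).
Proof.
rewrite /strip /slope /mesh; field.
by rewrite (gt_eqF rad_gt0) (gt_eqF M1_gt0).
Qed.

Lemma om_ratio : 0 < om / (M + 1) <= om /\ M * (om / (M + 1)) <= om.
Proof.
have M1 := M1_gt0; split.
  by rewrite divr_gt0 //= ler_pdivrMr // ler_peMr ?(ltW om0) // lerDr ltW.
by rewrite mulrA ler_pdivrMr // mulrC ler_pM2l // lerDl.
Qed.

Lemma strip_gt0 : 0 < strip.
Proof. by rewrite stripE mulr_gt0 // ?divr_gt0 // M1_gt0. Qed.

Lemma strip_M : 3 * strip * M <= om.
Proof. rewrite stripE; have [/andP[h1 h2] h3] := om_ratio; lra. Qed.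

Lemma strip_le : strip <= 1.
Proof. rewrite stripE; have [/andP[h1 h2] h3] := om_ratio; have := om1; lra. Qed.

Lemma mesh_le_strip : 2 * mesh <= strip.
Proof. by rewrite /strip lerDr mulr_ge0 // ltW ?slope_gt0 ?rad_gt0. Qed.

Lemma mesh_le : mesh <= 32^-1.
Proof.
have -> : mesh = 32^-1 * (om / (M + 1)) by rewrite /mesh; field; rewrite gt_eqF // M1_gt0.
have [/andP[h1 h2] h3] := om_ratio; have := om1; lra.
Qed.

Lemma mesh_M : mesh * M <= om.
Proof.
have -> : mesh = 32^-1 * (om / (M + 1)) by rewrite /mesh; field; rewrite gt_eqF // M1_gt0.
have [/andP[h1 h2] h3] := om_ratio; have := om0; lra.
Qed.

Lemma slope_le : slope <= 48^-1 * om.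
Proof.
have M1 := M1_gt0; have r12 := rad_ge12; have r0 := rad_gt0.
rewrite /slope ler_pdivrMr; last by rewrite mulr_gt0 // mulr_gt0.
have -> : 48^-1 * om * (4 * rad * (M + 1)) = om * (rad / 12 * (M + 1)) by field.
rewrite ler_peMr ?(ltW om0) //.
have := M0; nra.
Qed.

End Scales.

(** Pigeonhole on residues; the class kept has indices at least [P] apart and loses only a factor
    [P] in number. *)
Lemma residue_class n (A : pred 'I_n.+1) (P : nat) : (0 < P)%N ->
  exists r : nat, (#|A| <= P * #|[pred k : 'I_n.+1 | A k && (k %% P == r)]|)%N.
Proof.
case: P => // P _.
pose c (r : 'I_P.+1) := #|[pred k : 'I_n.+1 | A k && (k %% P.+1 == r)%N]|.
case: (@arg_maxnP _ (@ord0 P) xpredT c isT) => r _ rmax; exists (r : nat).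
rewrite -[X in (X <= _)%N]sum1_card.
rewrite (partition_big (fun k : 'I_n.+1 => inord (k %% P.+1)%N : 'I_P.+1) xpredT) //=.
rewrite -[X in (_ <= X * _)%N]card_ord -sum_nat_const.
apply: leq_sum => i _; apply: leq_trans (rmax i isT).
rewrite /c -sum1_card; apply: eq_leq; apply: eq_bigl => k; rewrite !inE.
by congr andb; rewrite -val_eqE /= inordK // ltn_pmod.
Qed.

Lemma dist_in_itv (R : realDomainType) (a w x y : R) :
  a <= x <= a + w -> a <= y <= a + w -> `|x - y| <= w.
Proof.
move=> /andP[x1 x2] /andP[y1 y2].
by rewrite ler_norml; apply/andP; split; lra.
Qed.

Lemma modn_gap (R : realType) (P x y : nat) : (x %% P)%N = (y %% P)%N -> x != y ->
  P%:R <= `|x%:R - y%:R| :> R.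
Proof.
wlog xy : x y / (y < x)%N => [H e ne|e _].
  have [lt|gt|eq] := ltngtP x y; [|exact: H|by rewrite eq eqxx in ne].
  by rewrite distrC H // eq_sym.
rewrite -natrB 1?ltnW // normr_nat ler_nat dvdn_leq ?subn_gt0 //.
by rewrite -eqn_mod_dvd 1?ltnW //; apply/eqP.
Qed.

Section Arc.
Variable R : realType.
Local Notation plane := (R * R)%type.
Variables (F : set plane) (h hi : plane -> plane).
Hypotheses (ch : continuous h) (hF : forall z, F (h z))
  (hK : forall z, enorm z <= 1 -> hi (h z) = z)
  (hiK : forall x, F x -> enorm (hi x) <= 1 /\ h (hi x) = x)
  (chi : {within F, continuous hi}).
Variable G : R -> plane.
Hypotheses (cG : continuous G) (GF : forall t, boundary F (G t)) (G01 : G 0 = G 1).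
Hypothesis Gonto : forall x, boundary F x -> exists2 t, 0 <= t <= 1 & G t = x.
Variables (N : plane -> R) (m M : R).
Hypothesis hN : plane_norm N m M.
Variables (om l : R).
Hypotheses (om0 : 0 < om) (om1 : om <= 1) (l0 : 0 < l).
Let m0 : 0 < m := pnorm_m_gt0 hN.
Let M0 : 0 < M := pnorm_M_gt0 hN.
Local Notation rad := (rad m).
Local Notation slope := (slope m M om).
Local Notation mesh := (mesh M om).
Local Notation strip := (strip m M om).

Variables (al be a b : R) (n : nat) (t : nat -> R) (e : plane).
Hypotheses (al0 : 0 <= al) (be1 : be <= 1) (e1 : enorm e = 1)
  (eE : dot e (G be - G al) = enorm (G be - G al)).
Hypotheses (t0 : t 0%N = al) (tS : forall k, (k < n)%N -> t k < t k.+1) (tn : t n <= be)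
  (tmu : forall k, (k < n)%N -> enorm (G (t k.+1) - G (t k)) = mesh * l)
  (tcover : forall s, al <= s <= be -> exists2 k, (k <= n)%N &
      [/\ t k <= s, ((k < n)%N -> s <= t k.+1) & enorm (G s - G (t k)) <= mesh * l])
  (tend : enorm (G be - G (t n)) <= mesh * l).
Hypothesis far : forall k, (k <= n)%N -> a <= t k <= b ->
  forall s, 0 <= s <= 1 -> s <= al \/ be <= s -> rad * l <= enorm (G s - G (t k)).

Definition ok_vertex k := `[< good_vertex G (mesh * l) n t e slope k >] && (a <= t k <= b).

Let mu0 : 0 < mesh * l. Proof. by rewrite mulr_gt0 // mesh_gt0. Qed.
Let e_le z : enorm z <= N z / m.
Proof. by rewrite ler_pdivlMr // mulrC (pnorm_ge hN). Qed.
Let Ne : m <= N e <= M.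
Proof. by have := pnorm_ge hN e; have := pnorm_le hN e; rewrite e1 !mulr1 => -> ->. Qed.
Let slope4 : slope <= 4^-1.
Proof. have := slope_le m0 M0 om0; have := om1; lra. Qed.

Lemma chord_direction (v : plane) : enorm e = 1 -> dot e v = enorm v -> v = enorm v *: e.
Proof.
move=> e1' ev; have := unit_dotE v e1'; rewrite ev.
rewrite -[in RHS](addr0 (enorm v ^+ 2)) => /addrI/eqP; rewrite sqrf_eq0 => /eqP d0.
by rewrite {1}(unit_decomp v e1') ev d0 scale0r addr0.
Qed.

Lemma ok_vertex_flat k : (k <= n)%N -> ok_vertex k ->
  flat F (G (t k)) (perp e) (rad * l) (strip * l) \/
  flat F (G (t k)) (- perp e) (rad * l) (strip * l).
Proof.
move=> kn /andP[/asboolP gk tab].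
have -> : strip * l = slope * (rad * l) + 2 * (mesh * l).
  by rewrite mulrDl -!mulrA.
apply: (mesh_flat ch hF hK hiK chi cG GF G01 Gonto al0 be1 mu0 e1 t0 tS tn tmu tcover) => //.
- exact: slope_gt0.
- rewrite mulrA ler_pM2r //; have := rad_ge12 m0; have := mesh_le M0 om0 om1; lra.
- exact: far.
Qed.

Lemma ok_vertex_normal k k' f : (k <= n)%N -> (k' <= n)%N -> ok_vertex k -> ok_vertex k' ->
  enorm (G (t k) - G (t k')) <= rad * l / 2 -> (f = perp e \/ f = - perp e) ->
  flat F (G (t k)) f (rad * l) (strip * l) -> flat F (G (t k')) f (rad * l) (strip * l).
Proof.
move=> kn kn' ok ok' close fE fl.
have f1 : enorm f = 1 by case: fE => ->; rewrite ?enormN enorm_perp.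
have s0 : 0 < strip * l by rewrite mulr_gt0 // strip_gt0.
have s8 : 8 * (strip * l) <= rad * l.
  rewrite mulrA ler_pM2r //; have := rad_ge12 m0; have := strip_le m0 M0 om0 om1; lra.
have := flat_normals_agree s0 s8 f1 close (GF _) fl.
by case: (ok_vertex_flat kn' ok') => fl'; case: fE => ->; rewrite ?opprK // => /(_ fl').
Qed.

Lemma ok_vertex_dist k k' : (k <= n)%N -> (k' <= n)%N -> ok_vertex k ->
  3 * enorm (G (t k') - G (t k)) <= 4 * `|dot e (G (t k') - G (t k))|.
Proof.
move=> kn kn' /andP[/asboolP gk _].
have h1 := good_vertex_abs gk kn' kn; have h2 := mesh_dist_abs tmu kn' kn.
have sl0 := slope_gt0 m0 M0 om0.
have k2 := kap_sqr_le sl0 slope4.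
set W := mesh * l * _ in h1 h2.
have W0 : 0 <= W by rewrite mulr_ge0 // ltW.
have : 3 / 4 * W <= (1 - slope ^+ 2 / 4) * W by rewrite ler_wpM2r //; lra.
by lra.
Qed.

(** If the spread along [e] were smaller, the two vertices would be close enough to share a normal.
    The heights of the centers would then differ by at most three strips, worth [om * l] in norm,
    and the distance of the centers would fall below [2 * l]. *)
Lemma touching_pair_spread k k' q q' x x' : (k <= n)%N -> (k' <= n)%N ->
  ok_vertex k -> ok_vertex k' ->
  touching_center N F l q -> touching_center N F l q' -> 2 * l <= N (q - q') ->
  N (x - q) = l -> N (x' - q') = l ->
  enorm (x - G (t k)) <= mesh * l -> enorm (x' - G (t k')) <= mesh * l ->
  (2 - om) * l / N e <= `|dot e (q - q')|.
Proof.
move=> kn kn' ok ok' [_ qF] [_ qF'] qq xq xq' xk xk'.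
set p := G (t k) in xk *; set p' := G (t k') in xk' *.
have /andP[Ne1 Ne2] := Ne; have Ne0 : 0 < N e := lt_le_trans m0 Ne1.
rewrite leNgt; apply/negP => lt.
have qx z y : N (z - y) = l -> enorm (y - z) <= l / m.
  by move=> zy; apply: le_trans (e_le _) _; rewrite (pnormB hN) zy.
have ml1 : mesh * l <= l / 32.
  by rewrite mulrC ler_pM2l // (le_trans (mesh_le M0 om0 om1)).
have qp : enorm (q - p) <= l / m + mesh * l.
  by apply: le_trans (ler_distD_enorm x _ _) _; rewrite lerD // qx.
have qp' : enorm (q' - p') <= l / m + mesh * l.
  by apply: le_trans (ler_distD_enorm x' _ _) _; rewrite lerD // qx.
have w1 : (2 - om) * l / N e <= 2 * (l / m).
  rewrite mulrA ler_pM //.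
  - by rewrite mulr_ge0 ?(ltW l0) //; have := om1; lra.
  - by rewrite invr_ge0 ltW.
  - by rewrite ler_pM2r //; have := om0; lra.
  - by rewrite lef_pV2 // posrE.
have dpp : dot e (p' - p) = - dot e (q - q') + dot e (q - p) - dot e (q' - p').
  rewrite -dotNr -dotDr -dotBr; congr dot.
  by case: (p) (p') (q) (q') => ? ? [? ?] [? ?] [? ?]; congr pair => /=; ring.
have close : enorm (p - p') <= rad * l / 2.
  have h1 := ok_vertex_dist kn kn' ok; rewrite -/p -/p' in h1.
  have h2 : `|dot e (p' - p)| <= 4 * (l / m) + 2 * (mesh * l).
    have g1 := le_trans (ler_dot_unit (q - p) e1) qp.
    have g2 := le_trans (ler_dot_unit (q' - p') e1) qp'.
    move: g1 g2 lt; rewrite dpp !ler_norml ltr_norml => /andP[? ?] /andP[? ?] /andP[? ?].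
    by apply/andP; split; lra.
  rewrite radE enormB; have lm0 : 0 < l / m by rewrite divr_gt0.
  have := l0; move: h1 h2 ml1; set D := `|_|; set E := enorm _; lra.
have [f fE fl] : exists2 f, f = perp e \/ f = - perp e & flat F p f (rad * l) (strip * l).
  by case: (ok_vertex_flat kn ok) => fl; [exists (perp e); [left|]|exists (- perp e); [right|]].
have fl' := ok_vertex_normal kn kn' ok ok' close fE fl.
have f1 : enorm f = 1 by case: fE => ->; rewrite ?enormN enorm_perp.
have [nn [nn1 nnM nnd]] := dual_vector hN f1.
have s0 : 0 < strip * l by rewrite mulr_gt0 // strip_gt0.
have mus : mesh * l <= strip * l.
  by rewrite ler_pM2r //; have := mesh_le_strip m0 M0 om0; have := mesh_gt0 M0 om0; lra.
have big : 2 * (l / m) + mesh * l < rad * l.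
  rewrite radE;  have lm0 : 0 < l / m by rewrite divr_gt0.
  have := l0; lra.
have /andP[a1 a2] := touching_height hN fl f1 nn1 nnM nnd l0 s0 mus big qF xq xk.
have /andP[b1 b2] := touching_height hN fl' f1 nn1 nnM nnd l0 s0 mus big qF' xq' xk'.
have [_ /(_ p' (GF _))] := fl; rewrite enormB => /(_ _).
have rl0 : 0 < rad * l by rewrite mulr_gt0 // rad_gt0.
move=> stp; have {}stp : `|dot f (p' - p)| <= strip * l by apply: stp; lra.
have hv : `|dot f (q - q')| <= 3 * (strip * l).
  have -> : q - q' = (q - p) - (q' - p') - (p' - p).
    by case: (p) (p') (q) (q') => ? ? [? ?] [? ?] [? ?]; congr pair => /=; ring.
  move: stp a1 a2 b1 b2; rewrite -/p' !dotBr !ler_norml => /andP[c1 c2] a1 a2 b1 b2.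
  by apply/andP; split; lra.
have hv' : `|dot (perp e) (q - q')| <= 3 * (strip * l).
  by move: hv; case: fE => ->; rewrite ?dotNl ?normrN.
have Npe : N (perp e) <= M.
  by have := pnorm_le hN (perp e); rewrite enorm_perp e1 mulr1.
have := pnorm_dot_le hN (q - q') e1.
have h1 : `|dot e (q - q')| * N e < (2 - om) * l by rewrite -ltr_pdivlMr.
have h2 : `|dot (perp e) (q - q')| * N (perp e) <= 3 * (strip * l) * M.
  by rewrite ler_pM // (pnorm_ge0 hN).
have h3 : 3 * (strip * l) * M <= om * l.
  have -> : 3 * (strip * l) * M = (3 * strip * M) * l by ring.
  by rewrite ler_pM2r // strip_M.
lra.
Qed.

Definition bad_count := #|[pred k : 'I_n.+1 | ~~ ok_vertex k]|.

(** Each homothet is attached to a mesh vertex near its contact point. A bad vertex carries at most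
    [fibre] of them; those at ok vertices are spread along [e] and obey [line_packing]. *)
Lemma touching_count_arc (I : finType) (q : I -> plane) :
  (forall i, touching_center N F l (q i)) ->
  (forall i, exists2 s, al <= s <= be & N (G s - q i) = l) ->
  (forall i j, i != j -> 2 * l <= N (q i - q j)) ->
  2 * l * #|I|%:R <= (1 + om) * N (G be - G al)
    + 2 * l * ((fibre m M) * bad_count)%N%:R + (6 * M * (m^-1 + 1) + 3) * l.
Proof.
move=> tq xq sep.
have ex i : exists sk : R * 'I_n.+1, N (G sk.1 - q i) = l /\ enorm (G sk.1 - G (t sk.2)) <= mesh * l.
  have [s sab sq] := xq i; have [k kn [_ _ sk]] := tcover sab.
  by exists (s, Ordinal (kn : (k < n.+1)%N)).
have [f hf] := choice ex; pose idx i := (f i).2; pose x i := G (f i).1.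
have /andP[Ne1 Ne2] := Ne; have Ne0 : 0 < N e := lt_le_trans m0 Ne1.
have kn (k : 'I_n.+1) : (k <= n)%N by rewrite -ltnS ltn_ord.
have ml1 : mesh * l <= l / 32.
  by rewrite mulrC ler_pM2l // (le_trans (mesh_le M0 om0 om1)).
have qp i : enorm (q i - G (t (idx i))) <= (m^-1 + 1) * l.
  have [xq1 xk1] := hf i.
  apply: le_trans (ler_distD_enorm (x i) _ _) _.
  have : enorm (q i - x i) <= l / m by apply: le_trans (e_le _) _; rewrite (pnormB hN) xq1.
  by rewrite -/(x i) in xk1; have := l0; lra.
pose gd := [pred i | ok_vertex (idx i)].
have cI : #|I| = (#|gd| + #|[predC gd]|)%N by rewrite cardC.
have cbad : (#|[predC gd]| <= fibre m M * bad_count)%N.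
  rewrite -sum1_card (partition_big idx (fun k : 'I_n.+1 => ~~ ok_vertex k)) //=.
  rewrite mulnC /bad_count -sum_nat_const; apply: leq_sum => k _.
  pose J := {i | idx i == k}.
  have : (#|{: J}| <= fibre m M)%N.
    have := @plane_packing R J (fun j => q (val j)) (G (t k)) ((m^-1 + 1) * l) (2 * l / M).
    have -> : 4 * ((m^-1 + 1) * l) / (2 * l / M) = 2 * M * (m^-1 + 1).
      by field; rewrite (gt_eqF m0) (gt_eqF M0) (gt_eqF l0).
    apply.
    - by rewrite divr_gt0 // mulr_gt0.
    - by rewrite mulr_ge0 ?(ltW l0) // addr_ge0 // invr_ge0 ltW.
    - by move=> j; have := qp (val j); rewrite (eqP (valP j)).
    by move=> i j ij; rewrite ler_pdivrMr // [leRHS]mulrC (le_trans (sep _ _ ij)) // (pnorm_le hN).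
  rewrite card_sig; apply: leq_trans.
  rewrite -[leqRHS]sum1_card big_mkcond [leqRHS]big_mkcond /=.
  by apply: leq_sum => i _; rewrite !inE; case: (idx i == k); rewrite ?andbF // andbT; case: ifP.
pose w := (2 - om) * l / N e.
have om2 : 0 < 2 - om by have := om1; lra.
have w0 : 0 < w by rewrite divr_gt0 // mulr_gt0.
have eE' := eE; set c := enorm (G be - G al) in eE' *.
have c0 : 0 <= c by exact: enorm_ge0.
have NE : N (G be - G al) <= M * c by exact: pnorm_le hN _.
have cNe : N (G be - G al) = c * N e.
  rewrite (chord_direction e1 eE') (pnormZ hN) ger0_norm //.
set X := 3 * (m^-1 + 1) * l.
have hg : #|gd|%:R * w <= c + X + w.
  pose J := {i | ok_vertex (idx i)}.
  have <- : #|{: J}| = #|gd| by rewrite card_sig.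
  have m10 : 0 <= (m^-1 + 1) * l by rewrite mulr_ge0 ?(ltW l0) // addr_ge0 // invr_ge0 ltW.
  have := @line_packing R J (fun j => dot e (q (val j) - G al))
    (- ((m^-1 + 1) * l)) (c + mesh * l + (m^-1 + 1) * l) w w0.
  have mul : mesh * l <= (m^-1 + 1) * l.
    have : l / 32 <= l by have := l0; lra.
    have : 0 <= m^-1 * l by rewrite mulr_ge0 ?invr_ge0 // ltW.
    by lra.
  move=> H; apply: le_trans (H _ _ _) _; last by rewrite /X; lra.
  - have := mu0; lra.
  - move=> j; have /andP[/asboolP[gr gl] _] := valP j.
    have := le_trans (ler_dot_unit _ e1) (qp (val j)).
    have := gl 0%N (leq0n _); rewrite subn0 t0 => g1.
    have := gr n; rewrite kn leqnn => /(_ isT) g2.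
    have sl0 := slope_gt0 m0 M0 om0; have k2 := kap_sqr_le sl0 slope4.
    have sl1 : 0 <= 1 - slope ^+ 2 / 4 by lra.
    have p1 : 0 <= dot e (G (t (idx (val j))) - G al).
      by apply: le_trans g1; rewrite mulr_ge0 // mulr_ge0 // ltW.
    have p2 : 0 <= dot e (G (t n) - G (t (idx (val j)))).
      by apply: le_trans g2; rewrite mulr_ge0 // mulr_ge0 // ltW.
    have := le_trans (ler_dot_unit _ e1) tend; rewrite !ler_norml => /andP[u1 u2] /andP[v1 v2].
    have E1 : dot e (q (val j) - G al) =
        dot e (q (val j) - G (t (idx (val j)))) + dot e (G (t (idx (val j))) - G al).
      by rewrite -dotDr addrA subrK.
    have E2 : c = dot e (G be - G (t n)) + dot e (G (t n) - G (t (idx (val j))))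
        + dot e (G (t (idx (val j))) - G al).
      by rewrite -eE' -!dotDr !addrA !subrK.
    by apply/andP; split; lra.
  move=> i j ij; have [xi ki] := hf (val i); have [xj kj] := hf (val j).
  have -> : dot e (q (val i) - G al) - dot e (q (val j) - G al) = dot e (q (val i) - q (val j)).
    by rewrite -dotBr opprB addrA subrK.
  apply: (touching_pair_spread (kn _) (kn _) (valP i) (valP j) (tq _) (tq _) _ xi xj ki kj).
  exact: sep.
have hg2 : #|gd|%:R * ((2 - om) * l) <= (c + X) * N e + (2 - om) * l.
  have := hg; rewrite -(ler_pM2r Ne0) mulrDl -mulrA /w divfK ?gt_eqF //.
have om10 : 0 < 1 + om by have := om0; lra.
have hg3 := ler_wpM2l (ltW om10) hg2.
have X0 : 0 <= X by rewrite /X mulr_ge0 ?(ltW l0) // mulr_ge0 // addr_ge0 // invr_ge0 ltW.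
(* (1 + om) (2 - om) >= 2 because [om <= 1]: the narrower spacing only costs the factor [1 + om]. *)
have h1 : 2 * l * #|gd|%:R <= (1 + om) * (#|gd|%:R * ((2 - om) * l)).
  have -> : (1 + om) * (#|gd|%:R * ((2 - om) * l)) = ((1 + om) * (2 - om)) * (l * #|gd|%:R) by ring.
  rewrite -mulrA ler_wpM2r ?mulr_ge0 ?(ltW l0) //.
  have := om0; have := om1; nra.
have h2 : (1 + om) * (2 - om) * l <= 3 * l.
  rewrite ler_pM2r //; have := om0; have := om1; nra.
have h3 : (1 + om) * X * N e <= 2 * X * M.
  have h31 : (1 + om) * X <= 2 * X by rewrite ler_wpM2r //; have := om1; lra.
  by apply: ler_pM => //; [rewrite mulr_ge0 // ltW|exact: ltW].
have h4 : 2 * l * #|I|%:R <= 2 * l * #|gd|%:R + 2 * l * (fibre m M * bad_count)%N%:R.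
  rewrite cI natrD mulrDr lerD2l ler_pM2l ?ler_nat // mulr_gt0 //.
have -> : (6 * M * (m^-1 + 1) + 3) * l = 2 * X * M + 3 * l by rewrite /X; ring.
rewrite cNe.
have h5 : (1 + om) * ((c + X) * N e + (2 - om) * l) =
   (1 + om) * (c * N e) + (1 + om) * X * N e + (1 + om) * (2 - om) * l by ring.
lra.
Qed.

Hypothesis Fcompact : compact F.

(** Centers are raised above the ok vertices of one residue class modulo [P], where [P] steps
    advance slightly more than [2 * l] in norm. *)
Lemma touching_family_arc : exists (I : finType) (q : I -> plane) (p : I -> 'I_n.+1), [/\
   forall i, touching_center N F l (q i),
   forall i, a <= t (p i) <= b /\ N (q i - G (t (p i))) <= 2 * l,
   forall i j, i != j -> 2 * l <= N (q i - q j) &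
   (1 - 2 * om) * N (G be - G al) <= 2 * l * #|I|%:R + M * (mesh * l * bad_count%:R)].
Proof.
have /andP[Ne1 Ne2] := Ne; have Ne0 : 0 < N e := lt_le_trans m0 Ne1.
have ms0 := mesh_gt0 M0 om0; have sl0 := slope_gt0 m0 M0 om0.
have st0 := strip_gt0 m0 M0 om0; have stM := strip_M m0 M0 om0.
have k2 := kap_sqr_le sl0 slope4.
have kn (k : 'I_n.+1) : (k <= n)%N by rewrite -ltnS ltn_ord.
set dl := slope ^+ 2 / 4; have dl1 : dl <= om.
  have h1 := slope_le m0 M0 om0; have := om0; have := om1.
  by rewrite /dl expr2; have h2 := sl0; nra.
have dl4 : dl <= 4^-1 by rewrite /dl; lra.
(* The progress in norm along [e] guaranteed for one mesh step, in units of [l]. *)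
pose step := (1 - dl) * mesh * N e.
have dl0 : 0 < 1 - dl by move: dl4; lra.
have step0 : 0 < step by rewrite /step mulr_gt0 // mulr_gt0.
(* Besides the required gap 2, one [strip * M] covers the height difference of the vertices and two
   cover the uncertainty on how far the centers are raised. [P] is the least number of steps
   advancing by more than [w]. *)
pose w := 2 + 3 * strip * M.
have w0 : 0 < w by rewrite /w addr_gt0 // !mulr_gt0.
pose P := (Num.truncn (w / step)).+1.
have /andP[P1 P2] := truncn_itv (divr_ge0 (ltW w0) (ltW step0)).
rewrite ler_pdivlMr // in P1; rewrite ltr_pdivrMr // -/P in P2.
have PE : P%:R = (Num.truncn (w / step))%:R + 1 :> R by rewrite /P -natr1.
have [r hr] := @residue_class n (fun k : 'I_n.+1 => ok_vertex k) P isT.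
pose I := {k : 'I_n.+1 | ok_vertex k && (k %% P == r)%N}.
have okI (i : I) : ok_vertex (val i) by case/andP: (valP i).
(* The dual vector is made a function of the normal, so that vertices with the same normal are
   raised in the same direction. *)
have [nn hnn] : exists nn : plane -> plane, forall f, enorm f = 1 ->
    [/\ N (nn f) <= 1, M^-1 <= dot f (nn f) & forall x, dot f x <= dot f (nn f) * N x].
  have [nn hnn] := choice (fun f : {f : plane | enorm f = 1} => dual_vector hN (svalP f)).
  exists (fun f => if pselect (enorm f = 1) is left f1 then nn (exist _ f f1) else 0) => f f1.
  by case: pselect => // f1'; exact: (hnn (exist _ f f1')).
have s0 : 0 < strip * l by rewrite mulr_gt0.
have exq (i : I) : exists fa : plane * R, [/\ fa.1 = perp e \/ fa.1 = - perp e,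
    flat F (G (t (val i))) fa.1 (rad * l) (strip * l), l <= fa.2 <= l + 2 * (strip * l) * M &
    touching_center N F l (G (t (val i)) + fa.2 *: nn fa.1)].
  have FG x : F (G x) by have := GF x; rewrite (disk_boundaryE ch hF hiK) => -[].
  have [f fE fl] : exists2 f, f = perp e \/ f = - perp e &
      flat F (G (t (val i))) f (rad * l) (strip * l).
    by case: (ok_vertex_flat (kn _) (okI i)) => fl;
      [exists (perp e); [left|]|exists (- perp e); [right|]].
  have f1 : enorm f = 1 by case: fE => ->; rewrite ?enormN enorm_perp.
  have [n1 n2 n3] := hnn f f1.
  have [||x xl xt] := touching_center_exists hN Fcompact fl (FG _) n1 n2 n3 l0 s0.
  - have -> : 2 * (strip * l) * M = (2 * strip * M) * l by ring.
    rewrite ler_piMl ?(ltW l0) //; have := om1.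
    have : 0 < strip * M by rewrite mulr_gt0.
    by move: stM; lra.
  - rewrite radE; have lm0 : 0 < l / m by rewrite divr_gt0.
    by have := l0; lra.
  by exists (f, x).
have [fa hfa] := choice exq.
pose q (i : I) := G (t (val i)) + (fa i).2 *: nn (fa i).1.
have slM : 2 * (strip * l) * M <= l.
  have -> : 2 * (strip * l) * M = (2 * strip * M) * l by ring.
  rewrite ler_piMl ?(ltW l0) //; have := om1.
  have : 0 < strip * M by rewrite mulr_gt0.
  by move: stM; lra.
have f1 i : enorm (fa i).1 = 1.
  by have [[]-> _ _ _] := hfa i; rewrite ?enormN enorm_perp.
have qp i : N (q i - G (t (val i))) <= 2 * l.
  have [_ _ /andP[x1 x2] _] := hfa i; have [n1 _ _] := hnn _ (f1 i).
  rewrite /q addrC addKr (pnormZ hN) ger0_norm; last by rewrite (le_trans (ltW l0)).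
  apply: le_trans (_ : (fa i).2 <= _); first by rewrite ler_piMr // (le_trans (ltW l0)).
  by lra.
exists I, q, val; split.
- by move=> i; have [] := hfa i.
- by move=> i; split=> //; case/andP: (okI i).
- move=> i j ij; set p := G (t (val i)); set p' := G (t (val j)).
  (* Centers are within [2 * l] of their vertices. Vertices at a distance of at least half of
     [rad * l] are at least 6 l + 6 m l apart in norm, which suffices; closer ones share their
     normal. *)
  have [far'|close] := leP (rad * l / 2) (enorm (p - p')).
    have h1 : N (p - p') <= N (q i - q j) + 4 * l.
      have e1' := pnorm_distD hN (q i) p p'; have e2' := pnorm_distD hN (q j) (q i) p'.
      have := qp i; have := qp j; rewrite (pnormB hN (q i)) -/p -/p' => u1 u2.
      by move: e1' e2'; lra.
    have h2 : m * (rad * l / 2) <= N (p - p').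
      by apply: le_trans (pnorm_ge hN _); rewrite ler_pM2l.
    have h3 : m * (rad * l / 2) = 6 * l + 6 * (m * l).
      by rewrite radE; field; rewrite gt_eqF.
    have ml : 0 < m * l by rewrite mulr_gt0.
    have := l0; lra.
  have [fEi fli xi _] := hfa i; have [fEj flj xj _] := hfa j.
  have fij : (fa j).1 = (fa i).1.
    have fl' := ok_vertex_normal (kn _) (kn _) (okI i) (okI j) (ltW close) fEi fli.
    have s8 : 8 * (strip * l) <= rad * l.
      rewrite mulrA ler_pM2r //; have := rad_ge12 m0; have := strip_le m0 M0 om0 om1; lra.
    have r0 : 0 < rad * l by rewrite mulr_gt0 // rad_gt0.
    have h0 : enorm (p' - p') <= rad * l / 2 by rewrite subrr enorm0 divr_ge0 // ltW.
    have := flat_normals_agree s0 s8 (f1 i) h0 (GF _) fl'.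
    by move: flj; case: fEi fEj => -> [] -> //; rewrite ?opprK => flj /(_ flj).
  have rl0 : 0 < rad * l by rewrite mulr_gt0 // rad_gt0.
  have stp : `|dot (perp e) (p - p')| <= strip * l.
    have [_ /(_ p' (GF _))] := fli; rewrite -/p enormB => /(_ _) dh.
    have : `|dot (fa i).1 (p' - p)| <= strip * l by apply: dh; move: close rl0; lra.
    by case: fEi => ->; rewrite ?dotNl ?normrN -[p' - p]opprB dotNr normrN.
  have Npe : N (perp e) <= M.
    by have := pnorm_le hN (perp e); rewrite enorm_perp e1 mulr1.
  have gap : P%:R <= `|(val (val i))%:R - (val (val j))%:R| :> R.
    apply: modn_gap; last by rewrite -val_eqE -val_eqE in ij.
    by case/andP: (valP i) => _ /eqP ->; case/andP: (valP j) => _ /eqP ->.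
  have adv : step * P%:R * l <= `|dot e (p - p')| * N e.
    have /andP[/asboolP gj _] := okI j.
    have := good_vertex_abs gj (kn (val i)) (kn (val j)).
    rewrite -/p -/p' -/dl -(ler_pM2r Ne0); apply: le_trans.
    have -> : step * P%:R * l = (1 - dl) * (mesh * l * P%:R) * N e by rewrite /step; ring.
    by rewrite ler_pM2r // ler_pM2l // ler_pM2l.
  have low : `|dot e (p - p')| * N e <= N (p - p') + strip * l * M.
    have E : dot e (p - p') *: e = (p - p') - dot (perp e) (p - p') *: perp e.
      by rewrite {2}(unit_decomp (p - p') e1) addrK.
    rewrite -(pnormZ hN) E; apply: le_trans (pnormD hN _ _) _.
    rewrite lerD2l (pnormN hN) (pnormZ hN) ler_pM //; exact: pnorm_ge0 hN _.
  have hq : N (p - p') <= N (q i - q j) + 2 * (strip * l) * M.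
    have -> : p - p' = (q i - q j) - ((fa i).2 - (fa j).2) *: nn (fa i).1.
      by rewrite /q fij scalerBl -/p -/p' opprB opprD; apply/eqP; rewrite -subr_eq0; apply/eqP;
        case: (p) (p') (_ *: _) (_ *: _) => ? ? [? ?] [? ?] [? ?]; congr pair => /=; ring.
    apply: le_trans (pnormD hN _ _) _; rewrite lerD2l (pnormN hN) (pnormZ hN).
    have [n1 _ _] := hnn _ (f1 i).
    apply: le_trans (_ : `|(fa i).2 - (fa j).2| <= _); first by rewrite ler_piMr.
    exact: dist_in_itv xi xj.
  have hw : w * l < step * P%:R * l by rewrite ltr_pM2r // mulrC.
  have wE : w * l = 2 * l + 3 * (strip * l * M) by rewrite /w; ring.
  by move: adv low hq hw wE; lra.
have cE : N (G be - G al) = enorm (G be - G al) * N e.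
  by rewrite {1}(chord_direction e1 eE) (pnormZ hN) ger0_norm // enorm_ge0.
rewrite cE; set c := enorm (G be - G al).
have c1 : c <= mesh * l * n.+1%:R.
  apply: le_trans (ler_distD_enorm (G (t n)) _ _) _.
  have := mesh_dist tmu (j := 0) (k := n); rewrite leqnn subn0 t0 => /(_ isT) h1.
  by rewrite -natr1 mulrDr mulr1 [leRHS]addrC lerD.
have cnt : n.+1%:R <= P%:R * #|{: I}|%:R + bad_count%:R :> R.
  rewrite -natrM -natrD ler_nat -[X in (X <= _)%N]card_ord.
  by rewrite -(cardC (fun k : 'I_n.+1 => ok_vertex k)) leq_add // card_sig.
set S := #|{: I}|%:R in cnt *; set bd := bad_count%:R in cnt *.
have S0 : 0 <= S by rewrite ler0n.
have bd0 : 0 <= mesh * l * bd by apply: mulr_ge0; [exact: ltW|exact: ler0n].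
(* [P] steps exceed [w] by at most one step, and [step] is at most [om]. *)
have stepP : step * P%:R <= 2 + 2 * om.
  have h1 : step <= om.
    apply: le_trans (mesh_M M0 om0); rewrite /step -mulrA.
    apply: le_trans (_ : mesh * N e <= _); last by rewrite ler_pM2l.
    rewrite ler_piMl //; first exact: mulr_ge0 (ltW ms0) (ltW Ne0).
    have dlp : 0 <= dl by apply: divr_ge0; [exact: sqr_ge0|].
    by rewrite gerBl.
  rewrite PE [leLHS]mulrC mulrDl mul1r; have wE : w = 2 + 3 * strip * M by [].
  by move: P1 stM h1; rewrite wE; lra.
have cN : c * N e <= (mesh * N e * P%:R) * (l * S) + N e * (mesh * l * bd).
  have -> : mesh * N e * P%:R * (l * S) + N e * (mesh * l * bd) =
    mesh * l * (P%:R * S + bd) * N e by ring.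
  rewrite ler_pM2r //; apply: le_trans c1 _.
  by rewrite ler_pM2l.
have c0 : 0 <= c * N e by apply: mulr_ge0; [exact: enorm_ge0|exact: ltW].
have lS : 0 <= l * S by rewrite mulr_ge0 // ltW.
have MB : N e * (mesh * l * bd) <= M * (mesh * l * bd) by rewrite ler_wpM2r.
have NB : 0 <= N e * (mesh * l * bd) by apply: mulr_ge0 => //; exact: ltW.
have [neg|pos] := leP (1 - 2 * om) 0.
  apply: le_trans (_ : 0 <= _); first by rewrite mulr_le0_ge0.
  by rewrite -mulrA; apply: addr_ge0; [exact: mulr_ge0|exact: mulr_ge0 (ltW M0) bd0].
(* The loss [1 - dl] hidden in [step] is absorbed by [1 - 2 * om], since [dl <= om]. *)
have Z2 : (1 - 2 * om) * (mesh * N e * P%:R) <= 2.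
  rewrite -(ler_pM2l dl0).
  have -> : (1 - dl) * ((1 - 2 * om) * (mesh * N e * P%:R)) = (1 - 2 * om) * (step * P%:R).
    by rewrite /step; ring.
  apply: le_trans (_ : (1 - 2 * om) * (2 + 2 * om) <= _); first by rewrite ler_pM2l.
  have -> : (1 - 2 * om) * (2 + 2 * om) = 2 - 2 * om - 4 * om ^+ 2 by ring.
  have := sqr_ge0 om; move: dl1; lra.
have := ler_wpM2l (ltW pos) cN; have := ler_wpM2r lS Z2.
have : (1 - 2 * om) * (N e * (mesh * l * bd)) <= N e * (mesh * l * bd).
  by rewrite ler_piMl //; have := om0; lra.
rewrite mulrDr [(1 - 2 * om) * (_ * (l * S))]mulrA -[2 * l * S]mulrA; lra.
Qed.

End Arc.
Lemma margin_gap (R : realDomainType) (al be rho s t : R) :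
  0 <= al -> be <= 1 -> 0 < rho -> al + rho <= t <= be - rho ->
  0 <= s <= 1 -> s <= al \/ be <= s ->
  [/\ 0 <= t <= 1, rho <= `|s - t| & `|s - t| <= 1 - rho].
Proof.
move=> al0 be1 rho0 /andP[at' tb] /andP[s0 s1] sab; split.
- by apply/andP; split; lra.
- by case: sab => sab; [rewrite distrC ger0_norm; lra|rewrite ger0_norm; lra].
- by rewrite ler_norml; apply/andP; split; lra.
Qed.

(** * Bounds for one arc, valid for all small ratios *)

Section ArcEstimates.
Variable R : realType.
Local Notation plane := (R * R)%type.
Variables (F : set plane) (h hi : plane -> plane).
Hypotheses (ch : continuous h) (hF : forall z, F (h z))
  (hK : forall z, enorm z <= 1 -> hi (h z) = z)
  (hiK : forall x, F x -> enorm (hi x) <= 1 /\ h (hi x) = x)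
  (chi : {within F, continuous hi}).
Variable G : R -> plane.
Hypotheses (cG : continuous G) (GF : forall t, boundary F (G t)) (G01 : G 0 = G 1).
Hypothesis Gonto : forall x, boundary F x -> exists2 t, 0 <= t <= 1 & G t = x.
Hypothesis Ginj : {in `[0, 1[ &, injective G}.
Variable L : R.
Hypothesis HL : forall w, path <=%R 0 w -> last 0 w <= 1 -> plen (@enorm R) G 0 w <= L.
Variables (N : plane -> R) (m M : R).
Hypothesis hN : plane_norm N m M.
Let m0 : 0 < m := pnorm_m_gt0 hN.
Let M0 : 0 < M := pnorm_M_gt0 hN.

Definition separated_family l (I : finType) (q : I -> plane) :=
  (forall i, touching_center N F l (q i)) /\
  (forall i j, i != j -> 2 * l <= N (q i - q j)).

Lemma chord_unit_vector (v : plane) : exists2 e : plane, enorm e = 1 & dot e v = enorm v.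
Proof.
have [->|v0] := eqVneq v 0.
  exists (ucirc 0); first exact: enorm_ucirc.
  by rewrite dotr0 enorm0.
have v0' : 0 < enorm v by rewrite enorm_gt0.
exists ((enorm v)^-1 *: v).
  by rewrite enormZ gtr0_norm ?invr_gt0 // mulVf ?gt_eqF.
by rewrite dotZl -sqr_enorm expr2 mulrA mulVf ?mul1r ?gt_eqF.
Qed.

Lemma disk_compact : compact F.
Proof.
rewrite (disk_image hF hiK); apply: continuous_compact; last exact: unit_disk_compact.
exact: continuous_subspaceT.
Qed.

Definition arc_upper om C zeta l al be :=
  forall (I : finType) (q : I -> plane), separated_family l q ->
    (forall i, exists2 s, al <= s <= be & N (G s - q i) = l) ->
    2 * l * #|I|%:R <= (1 + om) * N (G be - G al)
      + C * (arclen G al be - enorm (G be - G al)) + zeta.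

(** The clearance [rad m * l] from the rest of the curve is what later separates the families of
    different arcs. *)
Definition arc_lower om C zeta l al be :=
  exists (I : finType) (q : I -> plane) (s : I -> R), [/\ separated_family l q,
    (forall i, [/\ al <= s i <= be, N (q i - G (s i)) <= 2 * l &
       forall s', 0 <= s' <= 1 -> s' <= al \/ be <= s' ->
         rad m * l <= enorm (G s' - G (s i))]) &
    (1 - 2 * om) * N (G be - G al) <= 2 * l * #|I|%:R
       + C * (arclen G al be - enorm (G be - G al)) + zeta].

(** The point is the order of the quantifiers: [C] is fixed before the arc, while the bound on [l]
    may depend on the arc and on [zeta]. *)
Lemma arc_estimates (om : R) : 0 < om -> om <= 1 -> exists2 C, 0 <= C &
  forall al be zeta, 0 <= al -> al < be -> be <= 1 -> 0 < zeta -> \forall l \near 0^'+,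
  arc_upper om C zeta l al be /\ arc_lower om C zeta l al be.
Proof.
move=> om0 om1.
pose kap := slope m M om; pose ms := mesh M om.
have kap0 : 0 < kap by exact: slope_gt0.
have ms0 : 0 < ms by exact: mesh_gt0.
have r0 : 0 < rad m by exact: rad_gt0.
(* Cost of a unit of mesh length lost at bad vertices: the first term serves the upper bound, the
   second the lower bound, and their sum both. *)
pose D := 2 * (fibre m M)%:R / ms + M.
have fb0 : 0 <= 2 * (fibre m M)%:R / ms.
  by apply: divr_ge0; [exact: mulr_ge0|exact: ltW].
have D0 : 0 < D by rewrite /D; have := M0; lra.
pose K1 := 8 / kap ^+ 2 + 1; pose K3 := 8 / kap ^+ 2 + 3.
have K0 : 0 <= 8 / kap ^+ 2 by apply: divr_ge0; [|exact: sqr_ge0].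
have K10 : 0 <= K1 by rewrite /K1; lra.
have K30 : 0 <= K3 by rewrite /K3; lra.
exists (D * K1); first exact: mulr_ge0 (ltW D0) K10.
move=> al be zeta al0 albe be1 ze0.
(* [E] collects the errors proportional to [l]. They take one half of [zeta]; cutting off the ends
   of the arc takes the other half, whence [zeta / (4 * D)] for each end. *)
pose E := D * K3 * ms + (6 * M * (m^-1 + 1) + 3).
have E0 : 0 < E.
  rewrite /E ltr_wpDl //; first exact: mulr_ge0 (mulr_ge0 (ltW D0) K30) (ltW ms0).
  by rewrite addr_gt0 // !mulr_gt0 // addr_gt0 // invr_gt0.
have eta0 : 0 < zeta / (4 * D) by rewrite divr_gt0 // mulr_gt0.
have [rho rho0 hrho] := curve_unif_continuous cG eta0.
pose rh := Num.min (rho / 2) ((be - al) / 2).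
have rh0 : 0 < rh by rewrite lt_min !divr_gt0 ?subr_gt0.
have rhr : rh < rho by rewrite gt_min; apply/orP; left; rewrite ltr_pdivrMr // ltr_pMr // ltr1n.
have rhb : rh <= (be - al) / 2 by rewrite ge_min lexx orbT.
have [d d0 hd] := curve_injectivity_modulus cG G01 Ginj rh0.
(* Points of the trimmed arc stay at a distance of at least [d] from the rest of the curve, so the
   disks of radius [rad * l] see nothing else once [rad * l <= d]. *)
pose a := al + rh; pose b := be - rh.
have ala : al < a by rewrite ltrDl.
have bbe : b < be by rewrite gtrBl.
have ab : a <= b by rewrite /a /b; lra.
have hchord : enorm (G be - G al) - enorm (G b - G a) <= 2 * (zeta / (4 * D)).
  have h1 : enorm (G a - G al) < zeta / (4 * D).
    apply: hrho; [by move: ala ab bbe; lra|by move: ala ab bbe; lra|].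
    by rewrite /a addrAC subrr add0r gtr0_norm.
  have h2 : enorm (G be - G b) < zeta / (4 * D).
    apply: hrho; [by move: ala ab bbe; lra|by move: ala ab bbe; lra|].
    by rewrite /b opprB addrC subrK gtr0_norm.
  have := ler_distD_enorm (G b) (G be) (G al).
  have := ler_distD_enorm (G a) (G b) (G al).
  lra.
have [e e1 eE] := chord_unit_vector (G be - G al).
set arcl := arclen G al be; set c := enorm (G be - G al) in eE hchord *.
near=> l.
have l0 : 0 < l by near: l; exact: nbhs_right_gt.
have lE : l <= zeta / (2 * E) by near: l; apply: nbhs_right_le; rewrite divr_gt0 // mulr_gt0.
have ld : l <= d / rad m by near: l; apply: nbhs_right_le; rewrite divr_gt0.
have mu0 : 0 < ms * l by rewrite mulr_gt0.
have [n [t [[t0 tS tn tmu tcover] tend bad]]] :=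
  arc_mesh_exists cG HL al0 ala ab bbe be1 mu0 kap0 e1 eE.
have far k : (k <= n)%N -> a <= t k <= b ->
    forall s, 0 <= s <= 1 -> s <= al \/ be <= s -> rad m * l <= enorm (G s - G (t k)).
  move=> kn kab s s01 sab; have [k01 sk1 sk2] := margin_gap al0 be1 rh0 kab s01 sab.
  have ld' : rad m * l <= d by rewrite mulrC -ler_pdivlMr.
  exact: le_trans ld' (hd _ _ s01 k01 sk1 sk2).
have {bad} := bad; rewrite -/(bad_count G m M om l a b n t e);
set nb := bad_count _ _ _ _ _ _ _ _ _ _ => bad.
have hbad (D' : R) : 0 <= D' -> D' <= D -> D' * (ms * l * nb%:R) <=
    D * K1 * (arcl - c) + zeta - (6 * M * (m^-1 + 1) + 3) * l.
  move=> D'0 D'D.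
  have X0 : 0 <= ms * l * nb%:R by rewrite mulr_ge0 // ltW.
  have h1 := ler_wpM2r X0 D'D.
  have h2 := ler_wpM2l (ltW D0) bad.
  have h3 := ler_wpM2l (ltW D0) hchord.
  have h4 : D * (2 * (zeta / (4 * D))) = zeta / 2 by field; rewrite gt_eqF.
  have h5 : E * l <= zeta / 2.
    by move: lE; rewrite ler_pdivlMr ?mulr_gt0 // ; lra.
  have h6 : E * l = D * (K3 * (ms * l)) + (6 * M * (m^-1 + 1) + 3) * l by rewrite /E; ring.
  apply: le_trans h1 _; apply: le_trans h2 _.
  have E1 k1 k3 u v w : D * (k1 * u + v + k3 * w) = D * k1 * u + D * v + D * (k3 * w) by ring.
  rewrite -/arcl -/c (E1 K1 K3); move: h3; rewrite h4; lra.
have Q0 : 0 <= (6 * M * (m^-1 + 1) + 3) * l.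
  apply: mulr_ge0; last exact: ltW.
  by rewrite addr_ge0 // !mulr_ge0 ?(ltW M0) // addr_ge0 // invr_ge0 ltW.
split.
  move=> I q [tq sep] xq.
  have := touching_count_arc ch hF hK hiK chi cG GF G01 Gonto hN om0 om1 l0 al0 be1 e1 eE
    t0 tS tn tmu tcover tend far tq xq sep.
  have D'D : 2 * (fibre m M)%:R / ms <= D by rewrite lerDl ltW.
  have := hbad _ fb0 D'D; rewrite -/nb natrM.
  have -> : 2 * (fibre m M)%:R / ms * (ms * l * nb%:R) = 2 * l * ((fibre m M)%:R * nb%:R).
    by field; rewrite gt_eqF.
  rewrite -/arcl -/c; set X := D * K1 * _; set Y := _ * (_ * nb%:R); lra.
have [I [q [p [tq qp sep cnt]]]] := touching_family_arc ch hF hK hiK chi cG GF G01 Gonto hN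
  om0 om1 l0 al0 be1 e1 eE t0 tS tn tmu tcover tend far disk_compact.
exists I, q, (fun i => t (p i)); split=> //.
  move=> i; have [ti Ni] := qp i; split=> //.
    by move: ti => /andP[h1 h2]; rewrite (le_trans (ltW ala) h1) (le_trans h2 (ltW bbe)).
  by apply: far => //; rewrite -ltnS ltn_ord.
have MD : M <= D by rewrite lerDr.
have := hbad _ (ltW M0) MD; move: cnt; rewrite -/nb -/ms -/arcl -/c.
set X := D * K1 * _; set Y := M * _; move: Q0; lra.
Unshelve. all: by end_near.
Qed.

End ArcEstimates.
(** * Partitions of the parameter interval *)

Section Partitions.
Variable R : realType.
Local Notation plane := (R * R)%type.
Variable G : R -> plane.

(** Deleting repeated nodes leaves the length unchanged and adding the endpoint [b] cannot decrease
    it. *)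
Lemma chain_partition a b w : path <=%R a w -> last a w <= b ->
  exists2 s, itv_partition a b s &
    forall (nu : plane -> R) m M, plane_norm nu m M -> plen nu G a w <= plen nu G a s.
Proof.
elim: w a => [|y w IH] a /=.
  move=> _; rewrite le_eqVlt => /predU1P[->|ab].
    by exists [::].
  exists [:: b]; first by split; rewrite /= ?ab.
  by move=> nu m M hnu; rewrite /= addr0 (pnorm_ge0 hnu).
case/andP=> + pw lw; have [s hs le] := IH _ pw lw.
rewrite le_eqVlt => /predU1P[->|ay].
  by exists s => // nu m M hnu; rewrite subrr (pnorm0 hnu) add0r (le _ _ _ hnu).
exists (y :: s) => [|nu m M hnu]; last by rewrite /= lerD2l (le _ _ _ hnu).
by case: hs => ps ls; split=> //=; rewrite ay.
Qed.

Lemma chain_last (a : R) w : path <=%R a w -> a <= last a w.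
Proof. by elim: w a => //= y w IH a /andP[ay /IH]; exact: le_trans. Qed.

Lemma chain_itv (a b : R) w : path <=%R a w -> last a w <= b ->
  forall x : R, x \in w -> a <= x <= b.
Proof.
elim: w a => //= y w IH a /andP[ay pw] lw x.
have yb : y <= b := le_trans (chain_last pw) lw.
rewrite inE => /predU1P[->|/(IH _ pw lw)/andP[yx ->]]; first by rewrite ay.
by rewrite (le_trans ay yx).
Qed.

Lemma common_refinement a b w w' : path <=%R a w -> last a w <= b ->
  path <=%R a w' -> last a w' <= b -> exists2 s, itv_partition a b s &
    forall (nu : plane -> R) m M, plane_norm nu m M ->
      plen nu G a w <= plen nu G a s /\ plen nu G a w' <= plen nu G a s.
Proof.
move=> pw lw pw' lw'; pose v := sort <=%R (w ++ w').
have vab x : x \in v -> a <= x <= b.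
  by rewrite mem_sort mem_cat => /orP[]; exact: chain_itv.
have tr : transitive (<=%R : rel R) by exact: le_trans.
have sub u : path <=%R a u -> subseq u (w ++ w') -> subseq u v.
  move=> /path_sorted su uw; rewrite -(sorted_sort tr su).
  exact: subseq_sort le_total tr _ _ uw.
have pv : path <=%R a v.
  rewrite path_sortedE // sort_le_sorted andbT; apply/allP => x /vab.
  by case/andP.
have ab : a <= b := le_trans (chain_last pw) lw.
have lv : last a v <= b.
  by have := mem_last a v; rewrite inE => /predU1P[->//|/vab/andP[]].
have [s hs le] := chain_partition pv lv; exists s => // nu m M hnu.
by split; apply: le_trans (le _ _ _ hnu); apply: (plen_subseq _ hnu); apply: sub => //;
  [exact: prefix_subseq|exact: suffix_subseq].
Qed.

Lemma nodes_le a (s : seq R) i j : path <=%R a s -> (i <= j <= size s)%N ->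
  nth 1 (a :: s) i <= nth 1 (a :: s) j.
Proof.
move=> ps /andP[ij js]; have tr : transitive (<=%R : rel R) by exact: le_trans.
have := @sorted_leq_nth _ _ tr lexx 1 (a :: s) ps i j.
by rewrite !inE /= !ltnS js (leq_trans ij js) => /(_ isT isT ij).
Qed.

Lemma node_cover a (s : seq R) x : path <=%R a s -> a <= x <= last a s -> s != [::] ->
  exists2 j, (j < size s)%N & nth 1 (a :: s) j <= x <= nth 1 (a :: s) j.+1.
Proof.
elim: s a => //= y s IH a /andP[ay ps] /andP[ax xl] _.
have [xy|yx] := leP x y; first by exists 0%N; rewrite //= ax.
have [|//|j js jx] := IH y ps; first by rewrite (ltW yx).
  by apply/eqP => s0; move: xl yx; rewrite s0 /= leNgt => /negbTE ->.
by exists j.+1.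
Qed.

End Partitions.

(** * Summation over the arcs of a fine partition *)

Section GlobalCount.
Variable R : realType.
Local Notation plane := (R * R)%type.
Variables (F : set plane) (h hi : plane -> plane).
Hypotheses (ch : continuous h) (hF : forall z, F (h z))
  (hK : forall z, enorm z <= 1 -> hi (h z) = z)
  (hiK : forall x, F x -> enorm (hi x) <= 1 /\ h (hi x) = x)
  (chi : {within F, continuous hi}).
Variable G : R -> plane.
Hypotheses (cG : continuous G) (GF : forall t, boundary F (G t)) (G01 : G 0 = G 1).
Hypothesis Gonto : forall x, boundary F x -> exists2 t, 0 <= t <= 1 & G t = x.
Hypothesis Ginj : {in `[0, 1[ &, injective G}.
Variable L : R.
Hypothesis HL : forall w, path <=%R 0 w -> last 0 w <= 1 -> plen (@enorm R) G 0 w <= L.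
Variables (N : plane -> R) (m M : R).
Hypothesis hN : plane_norm N m M.
Hypothesis touch_boundary : forall l q y, 0 < l -> F y -> N (y - q) = l ->
  (forall x, F x -> l <= N (x - q)) -> boundary F y.
Let m0 : 0 < m := pnorm_m_gt0 hN.
Let M0 : 0 < M := pnorm_M_gt0 hN.

Definition norm_length := sup [set plen N G 0 s | s in itv_partition 0 1].
Local Notation P := norm_length.

Lemma plen_norm_le a w : plen N G a w <= M * plen (@enorm R) G a w.
Proof.
elim: w a => [|y w IH] a /=; first by rewrite mulr0.
by rewrite mulrDr lerD // (pnorm_le hN).
Qed.

Lemma partition_chain (s : seq R) : itv_partition 0 1 s ->
  [/\ path <=%R 0 s, last 0 s = 1 & s != [::]].
Proof.
move=> [ps /eqP ls]; split=> //; first by apply: sub_path ps => x y; exact: ltW.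
by apply/eqP => s0; move: ls; rewrite s0 /= => /eqP; rewrite eq_sym oner_eq0.
Qed.

Lemma norm_length_has_sup : has_sup [set plen N G 0 s | s in itv_partition 0 1].
Proof.
split; first by exists (plen N G 0 [:: 1]), [:: 1] => //; split; rewrite /= ?ltr01.
exists (M * L) => _ [s /partition_chain[ps ls _] <-].
by apply: le_trans (plen_norm_le _ _) _; rewrite ler_pM2l // HL // ls.
Qed.

Lemma plen_norm_length s : itv_partition 0 1 s -> plen N G 0 s <= P.
Proof. by move=> hs; apply: (sup_upper_bound norm_length_has_sup); exists s. Qed.

Lemma norm_length_ge0 : 0 <= P.
Proof.
apply: le_trans (plen_norm_length (s := [:: 1]) _); first exact: (plen_ge0 _ hN).
by split; rewrite /= ?ltr01.
Qed.

(** A common refinement makes one partition nearly optimal for both lengths: that of [N], to be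
    computed, and the Euclidean one, which controls the errors. *)
Lemma fine_partition (eps : R) : 0 < eps -> exists s, [/\ itv_partition 0 1 s,
  P - eps <= plen N G 0 s & arclen G 0 1 - eps <= plen (@enorm R) G 0 s].
Proof.
move=> eps0.
have [_ [s1 /partition_chain[p1 l1 _] <-] h1] := sup_adherent eps0 norm_length_has_sup.
have [_ [w2 /andP[p2 l2] <-] h2] :=
  sup_adherent eps0 (arclen_has_sup HL (lexx 0) ler01 (lexx 1)).
have l1' : last 0 s1 <= 1 by rewrite l1.
have [s hs ref] := common_refinement G p1 l1' p2 l2.
exists s; split=> //.
  by apply: ltW (lt_le_trans h1 _); have [] := ref _ _ _ hN.
by apply: ltW (lt_le_trans h2 _); have [] := ref _ _ _ (enorm_plane_norm R).
Qed.

Lemma nodes_sum (s : seq R) : itv_partition 0 1 s ->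
  let tau := nth 1 (0 :: s) in
  [/\ forall j, (j < size s)%N -> [/\ 0 <= tau j, tau j < tau j.+1 & tau j.+1 <= 1],
   \sum_(j < size s) N (G (tau j.+1) - G (tau j)) = plen N G 0 s,
   \sum_(j < size s) enorm (G (tau j.+1) - G (tau j)) = plen (@enorm R) G 0 s &
   \sum_(j < size s) arclen G (tau j) (tau j.+1) <= arclen G 0 1].
Proof.
move=> hs tau; have [ps ls s0] := partition_chain hs.
have t1 : tau (size s) = 1 by rewrite /tau -[size s]/((size (0 :: s)).-1) nth_last.
split.
- move=> j js; split.
  + by have := nodes_le (i := 0) (j := j) ps; apply; rewrite /= ltnW.
  + by case: hs => /(pathP 1)/(_ j js).
  + by rewrite -t1; apply: nodes_le => //; rewrite js leqnn.
- by rewrite plen_sum big_mkord.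
- by rewrite plen_sum big_mkord.
rewrite -ls -(big_mkord xpredT (fun j => arclen G (tau j) (tau j.+1))).
by apply: (sum_arclen HL) => //; rewrite ls.
Qed.

Local Notation family := (separated_family F N).

(** Order of the choices: [om] from the length, [C] from [om], a partition whose Euclidean excess is
    small against [C], [zeta] small against the number of arcs, and [l] last. *)
Lemma arc_decomposition (eps : R) : 0 < eps -> exists om C zeta s, [/\ itv_partition 0 1 s, 0 <= C,
  (1 + om) * plen N G 0 s + C * (arclen G 0 1 - plen (@enorm R) G 0 s)
    + (size s)%:R * zeta <= P + eps,
  P - eps <= (1 - 2 * om) * plen N G 0 s - C * (arclen G 0 1 - plen (@enorm R) G 0 s)
    - (size s)%:R * zeta &
  \forall l \near 0^'+, forall j : 'I_(size s),
    let al := nth 1 (0 :: s) j in let be := nth 1 (0 :: s) j.+1 in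
    arc_upper F G N om C zeta l al be /\ arc_lower F G N m om C zeta l al be].
Proof.
move=> eps0; have P0 := norm_length_ge0.
have share x y : 0 < y -> 0 < x -> x * (eps / (y * x)) = eps / y.
  by move=> y0 x0; field; rewrite !gt_eqF.
pose om := Num.min 1 (eps / (8 * (P + 1))).
have P1 : 0 < P + 1 by rewrite ltr_wpDl.
have om0 : 0 < om by rewrite lt_min ltr01 divr_gt0 // mulr_gt0.
have om1 : om <= 1 by rewrite ge_min lexx.
have omP : om * (P + 1) <= eps / 8.
  by rewrite -(share (P + 1) 8) // mulrC ler_pM2l // ge_min lexx orbT.
have [C C0 hC] := arc_estimates ch hF hK hiK chi cG GF G01 Gonto Ginj HL hN om0 om1.
have C1 : 0 < C + 1 by rewrite ltr_wpDl.
pose ep1 := eps / (4 * (C + 1)).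
have ep10 : 0 < ep1 by rewrite divr_gt0 // mulr_gt0.
have Cep : (C + 1) * ep1 = eps / 4 by rewrite share.
have [s [hs sP sE]] := fine_partition ep10.
pose zeta := eps / (4 * (size s).+1%:R).
have z0 : 0 < zeta by rewrite divr_gt0 // mulr_gt0 // ltr0n.
have zk : (size s)%:R * zeta <= eps / 4.
  by rewrite -(share (size s).+1%:R 4) ?ltr0n // ler_pM2r // ler_nat.
have Ca : C * (arclen G 0 1 - plen (@enorm R) G 0 s) <= C * ep1.
  by rewrite ler_wpM2l //; lra.
have sPP := plen_norm_length hs.
have oN : om * plen N G 0 s <= om * P by rewrite ler_pM2l.
exists om, C, zeta, s; split=> //.
- by move: Cep Ca omP zk; rewrite mulrDl [om * (_ + _)]mulrDr; lra.
- move: Cep Ca omP zk; rewrite mulrDl [om * (_ + _)]mulrDr.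
  rewrite [(1 - _) * _]mulrBl mul1r -mulrA; lra.
apply: filter_forall => j.
by have [tauP _ _ _] := nodes_sum hs; have [t0 t1 t2] := tauP j (ltn_ord j); exact: hC.
Qed.

(** Every contact point is on the boundary, hence on some arc, which distributes the family over the
    arcs. *)
Lemma family_upper (eps : R) : 0 < eps -> \forall l \near 0^'+,
  forall (I : finType) (q : I -> plane), family l q -> 2 * l * #|I|%:R <= P + eps.
Proof.
move=> eps0; have [om [C [zeta [s [hs C0 budget _ hall]]]]] := arc_decomposition eps0.
have [tauP sN sC sA] := nodes_sum hs; have [ps ls s0] := partition_chain hs.
set tau := nth 1 (0 :: s) in tauP sN sC sA hall.
near=> l.
have l0 : 0 < l by near: l; exact: nbhs_right_gt.
have hl (j : 'I_(size s)) : arc_upper F G N om C zeta l (tau j) (tau j.+1) /\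
    arc_lower F G N m om C zeta l (tau j) (tau j.+1).
  by move: j; near: l; exact: hall.
move=> I q [tq sep].
have ex i : exists sj : R * 'I_(size s),
    tau sj.2 <= sj.1 <= tau sj.2.+1 /\ N (G sj.1 - q i) = l.
  have [[x Fx xq] qF] := tq i.
  have [t t01 tx] := Gonto (touch_boundary l0 Fx xq qF).
  have [||j js jt] := node_cover ps (x := t); rewrite ?ls //.
  by exists (t, Ordinal js); rewrite tx.
have [f hf] := choice ex; pose J i := (f i).2.
have cI : #|I|%:R = \sum_(j < size s) #|{: {i | J i == j}}|%:R :> R.
  rewrite -natr_sum; congr (_%:R); rewrite -sum1_card (partition_big J xpredT) //=.
  apply: eq_bigr => j _; rewrite card_sig -sum1_card; apply: eq_bigl => i.
  by rewrite !inE.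
rewrite cI mulr_sumr.
apply: le_trans (_ : \sum_(j < size s) ((1 + om) * N (G (tau j.+1) - G (tau j)) +
   C * (arclen G (tau j) (tau j.+1) - enorm (G (tau j.+1) - G (tau j))) + zeta) <= _).
  apply: ler_sum => j _; have [up _] := hl j.
  apply: (up _ (fun i => q (val i))); first by split=> [i|i i' ii]; [exact: tq|exact: sep].
  move=> i; have [h1 h2] := hf (val i); exists (f (val i)).1 => //.
  by move: h1; rewrite -/(J (val i)) (eqP (valP i)).
rewrite !big_split /= -!mulr_sumr sumrB sN sC sumr_const card_ord -[zeta *+ _]mulr_natl.
have h3 := ler_wpM2l C0 (lerB sA (lexx (plen (@enorm R) G 0 s))).
lra.
Unshelve. all: by end_near.
Qed.

Lemma family_lower (eps : R) : 0 < eps -> \forall l \near 0^'+,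
  exists (I : finType) (q : I -> plane), family l q /\ P - eps <= 2 * l * #|I|%:R.
Proof.
move=> eps0; have [om [C [zeta [s [hs C0 _ budget hall]]]]] := arc_decomposition eps0.
have [tauP sN sC sA] := nodes_sum hs; have [ps ls s0] := partition_chain hs.
set tau := nth 1 (0 :: s) in tauP sN sC sA hall.
near=> l.
have l0 : 0 < l by near: l; exact: nbhs_right_gt.
have hl (j : 'I_(size s)) : arc_upper F G N om C zeta l (tau j) (tau j.+1) /\
    arc_lower F G N m om C zeta l (tau j) (tau j.+1).
  by move: j; near: l; exact: hall.
have ex (j : 'I_(size s)) : exists Iqs : {I : finType & ((I -> plane) * (I -> R))%type},
    let q := (projT2 Iqs).1 in let t := (projT2 Iqs).2 in
    [/\ family l q, (forall i, [/\ tau j <= t i <= tau j.+1, N (q i - G (t i)) <= 2 * l &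
         forall s', 0 <= s' <= 1 -> s' <= tau j \/ tau j.+1 <= s' ->
           rad m * l <= enorm (G s' - G (t i))]) &
      (1 - 2 * om) * N (G (tau j.+1) - G (tau j)) <= 2 * l * #|projT1 Iqs|%:R
       + C * (arclen G (tau j) (tau j.+1) - enorm (G (tau j.+1) - G (tau j))) + zeta].
  have [_ [I [q [t H]]]] := hl j.
  by exists (existT (fun I : finType => ((I -> plane) * (I -> R))%type) I (q, t)).
have [Iqs hI] := choice ex.
pose I j := projT1 (Iqs j); pose q j : I j -> plane := (projT2 (Iqs j)).1.
pose t j : I j -> R := (projT2 (Iqs j)).2.
exists {j : 'I_(size s) & I j}, (fun u => q (tag u) (tagged u)); split.
  split=> [[j i]|].
    by have [[tq _] _ _] := hI j; exact: tq.
  (* By the clearance, contact vertices of different arcs are at least 12 l + 12 m l apart in norm,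
     while centers are within [2 * l] of them. *)
  have apart (u v : {j : 'I_(size s) & I j}) : (tag u < tag v)%N ->
      2 * l <= N (q _ (tagged u) - q _ (tagged v)).
    move=> uv'; have [_ /(_ (tagged u))[tu qu _] _] := hI (tag u).
    have [_ /(_ (tagged v))[tv qv far] _] := hI (tag v).
    set p := G (t _ (tagged u)) in qu *; set p' := G (t _ (tagged v)) in qv *.
    have h0 : rad m * l <= enorm (p - p').
      apply: far.
        have [t0 _ _] := tauP _ (ltn_ord (tag u)); have [_ _ t1] := tauP _ (ltn_ord (tag u)).
        by move: tu => /andP[h1 h2]; rewrite (le_trans t0 h1) (le_trans h2 t1).
      left; move: tu => /andP[_ h2]; apply: le_trans h2 _.
      by apply: nodes_le => //; rewrite uv' /= ltnW.
    have h1 : m * (rad m * l) <= N (p - p').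
      by apply: le_trans (pnorm_ge hN _); rewrite ler_pM2l.
    have h2 : m * (rad m * l) = 12 * l + 12 * (m * l).
      by rewrite radE; field; rewrite gt_eqF.
    have ml : 0 < m * l by rewrite mulr_gt0.
    have := pnorm_distD hN (q _ (tagged u)) p p'.
    have := pnorm_distD hN (q _ (tagged v)) (q _ (tagged u)) p'.
    have := pnormB hN p (q _ (tagged u)); move: qu qv; lra.
  move=> u v uv; have [lt|gt|eq] := ltngtP (tag u) (tag v); first exact: apart.
    by rewrite (pnormB hN); exact: apart.
  move: u v uv eq => [j i] [j' i'] /= uv /val_inj jj; move: jj i' uv => <- i' uv.
  have [[_ sep] _ _] := hI j; apply: sep; apply: contraNneq uv => ->; exact: eqxx.
have -> : #|{: {j : 'I_(size s) & I j}}|%:R = \sum_(j < size s) #|I j|%:R :> R.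
  by rewrite card_tagged sumnE big_map big_enum natr_sum.
have : \sum_(j < size s) ((1 - 2 * om) * N (G (tau j.+1) - G (tau j))) <=
  \sum_(j < size s) (2 * l * #|I j|%:R + C * (arclen G (tau j) (tau j.+1)
     - enorm (G (tau j.+1) - G (tau j))) + zeta).
  by apply: ler_sum => j _; have [] := hI j.
rewrite !big_split /= -!mulr_sumr sumrB sN sC sumr_const card_ord -[zeta *+ _]mulr_natl.
have h3 := ler_wpM2l C0 (lerB sA (lexx (plen (@enorm R) G 0 s))).
lra.
Unshelve. all: by end_near.
Qed.

End GlobalCount.
(** * The limit *)
Section Limit.
Variable R : realType.
Local Notation plane := (R * R)%type.
Variables (c : plane) (B F : set plane) (h hi : plane -> plane).
Hypothesis hB : symmetric_oval c B.
Hypotheses (ch : continuous h) (hF : forall z, F (h z))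
  (hK : forall z, enorm z <= 1 -> hi (h z) = z)
  (hiK : forall x, F x -> enorm (hi x) <= 1 /\ h (hi x) = x)
  (chi : {within F, continuous hi}).
Variable g : R -> plane.
Hypothesis hg : simple_closed_path g (boundary F).
Hypothesis hrect : rectifiable (boundary F).
Local Notation N := (oval_norm c B).
Local Notation G := (fun t => g (clip01 t)).

Lemma nat_set_max (Q : set nat) : Q !=set0 -> has_ubound Q -> exists k, Q k /\ ubound Q k.
Proof.
move=> [k0 Qk0] [b hb].
have ex : exists k, `[< Q k >] by exists k0; apply/asboolP.
have ub k : `[< Q k >] -> (k <= b)%N by move=> /asboolP /hb.
case: (ex_maxnP ex ub) => k /asboolP Qk kmax; exists k; split=> // j Qj.
by apply: kmax; apply/asboolP.
Qed.

Let clipE t : 0 <= t <= 1 -> G t = g t. Proof. by move=> t01; rewrite /= clip01_id. Qed.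

Let cG : continuous G.
Proof.
case: hg => cg _ _ _; apply: (within_comp_continuous cg (@clip01_continuous R)) => t.
by rewrite /= in_itv /= clip01_itv.
Qed.

Let GF t : boundary F (G t).
Proof. by case: hg => _ _ _ <-; exists (clip01 t); rewrite //= in_itv /= clip01_itv. Qed.

Let G01 : G 0 = G 1.
Proof. by case: hg => _ g01 _ _; rewrite !clipE ?lexx ?ler01. Qed.

Let Gonto x : boundary F x -> exists2 t, 0 <= t <= 1 & G t = x.
Proof.
by case: hg => _ _ _ <- [t]; rewrite /= in_itv /= => t01 <-; exists t; rewrite // clipE.
Qed.

Let Ginj : {in `[0, 1[ &, injective G}.
Proof.
case: hg => _ _ gi _ s t s01 t01; rewrite !clipE; first exact: gi.
  by move: t01; rewrite in_itv /= => /andP[-> /ltW].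
by move: s01; rewrite in_itv /= => /andP[-> /ltW].
Qed.

Let bounded_polygons : exists L, forall w, path <=%R 0 w -> last 0 w <= 1 ->
  plen (@enorm R) G 0 w <= L.
Proof.
have [I [f [_ bI lf fI]]] := hrect.
case: bI => A' [_ /(_ (`|A'| + 1))]; rewrite (le_lt_trans (ler_norm _)) ?ltrDl // => /(_ isT) IA.
case: lf => K' [_ /(_ (`|K'| + 1))]; rewrite (le_lt_trans (ler_norm _)) ?ltrDl // => /(_ isT) fK.
(* The factor 2 on the Lipschitz constant passes from the max norm to [enorm]. *)
exists (2 * (`|A'| + 1) * (2 * (`|K'| + 1)) + 1).
have K0 : 0 < `|K'| + 1 by rewrite ltr_wpDl.
apply: (@lipschitz_image_polygons _ _ cG G01 Ginj I f) => //.
  move=> x y Ix Iy; apply: le_trans (enorm_le_normr _) _.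
  by rewrite -mulrA ler_pM2l //; exact: (fK (x, y)).
by move=> t _; have := GF t; rewrite -fI => -[x Ix <-]; exists x.
Qed.

Lemma path_length_norm_length : path_length c B g = (norm_length G N)%:E.
Proof.
have [m [M hN]] := oval_norm_plane_norm hB; have [L HL] := bounded_polygons.
have [h1 h2] := norm_length_has_sup HL hN.
rewrite /norm_length -ereal_sup_EFin //; congr ereal_sup; rewrite image_comp.
apply: eq_imagel => s hs /=; congr EFin; rewrite plen_sum.
have [ps ls _] := partition_chain hs.
have t1 : nth 1 (0 :: s) (size s) = 1 by rewrite -[size s]/((size (0 :: s)).-1) nth_last.
have t01 n : (n <= size s)%N -> 0 <= nth 1 (0 :: s) n <= 1.
  move=> ns; have := nodes_le (i := 0) (j := n) ps; have := nodes_le (i := n) (j := size s) ps.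
  by rewrite t1 leqnn ns => -> // -> //; rewrite ns.
apply: eq_big_nat => n /andP[_ ns]; rewrite !clipE ?t01 //; exact: ltnW.
Qed.

Lemma touching_number_limit :
  2 * (l * (touching_number F B l)%:R) @[l --> 0^'+] --> norm_length G N.
Proof.
have [m [M hN]] := oval_norm_plane_norm hB; have [L HL] := bounded_polygons.
set P := norm_length G N.
have touchb (l : R) q y : 0 < l -> F y -> N (y - q) = l ->
  (forall x, F x -> l <= N (x - q)) -> boundary F y by move=> l0; exact: touching_point_boundary.
apply/cvgrPdist_le => eps eps0; near=> l.
have l0 : 0 < l by near: l; exact: nbhs_right_gt.
have up (I : finType) (q : I -> plane) : separated_family F N l q -> 2 * l * #|I|%:R <= P + eps.
  move: I q; near: l.
  exact: (family_upper ch hF hK hiK chi cG GF G01 Gonto Ginj HL hN touchb eps0).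
have [I [q [[tq sep] low]]] : exists (I : finType) (q : I -> plane),
    separated_family F N l q /\ P - eps <= 2 * l * #|I|%:R.
  near: l.
  exact: (family_lower ch hF hK hiK chi cG GF G01 Gonto Ginj HL hN eps0).
have upQ k : touching_packing F B l k -> 2 * l * k%:R <= P + eps.
  by move=> /(touching_packingP hB _ l0)[q' hq]; have := up _ q' hq; rewrite card_ord.
have QI : touching_packing F B l #|I|.
  apply/(touching_packingP hB _ l0); exists (fun i => q (enum_val i)); split=> // i j ij.
  by apply: sep; apply: contraNneq ij => /enum_val_inj ->.
(* The packing numbers form a nonempty bounded set, so [touching_number] is a true maximum and not
   the default 0. *)
have [|k [Qk kmax]] := nat_set_max (ex_intro _ _ QI).
  exists (Num.truncn ((P + eps) / (2 * l))) => k /upQ kP.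
  have : k%:R <= (P + eps) / (2 * l) by rewrite ler_pdivlMr ?mulr_gt0 // mulrC.
  by move/le_truncn; rewrite natrK.
have [Qt tmax] : (touching_packing F B l `&` ubound (touching_packing F B l))
    (touching_number F B l) by apply: (@xgetPex _ 0%N); exists k.
have := upQ _ Qt; have : 2 * l * #|I|%:R <= 2 * l * (touching_number F B l)%:R.
  by rewrite ler_pM2l ?mulr_gt0 // ler_nat; exact: tmax.
move: low; rewrite -mulrA ler_norml => h1 h2 h3; apply/andP; split; lra.
Unshelve. all: by end_near.
Qed.

End Limit.

Theorem theorem2 (R : realType) (c : R * R) (B F : set (R * R))
    (hB : symmetric_oval c B)
    (hF : topological_disk F)
    (hrect : rectifiable (boundary F)) :
  cvg (l * (touching_number F B l)%:R @[l --> 0^'+]) /\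
  closed_curve_length c B (boundary F) =
    (2 * lim (l * (touching_number F B l)%:R @[l --> 0^'+]))%:E.
Proof.
have [h [hi [ch FH hK hiK chi]]] := disk_parametrization hF.
have conv g : simple_closed_path g (boundary F) ->
    l * (touching_number F B l)%:R @[l --> 0^'+] -->
      2^-1 * norm_length (fun t => g (clip01 t)) (oval_norm c B).
  move=> hg; have lim2 := touching_number_limit hB ch FH hK hiK chi hg hrect.
  have -> : (fun l => l * (touching_number F B l)%:R) =
      (fun l => 2^-1 * (2 * (l * (touching_number F B l)%:R))).
    by apply/funext => l; rewrite mulKf ?pnatr_eq0.
  by apply: cvgM => //; exact: cvg_cst.
(* The boundary has a simple closed parametrization, so the supremum in [closed_curve_length] is not
   over the empty set. *)
have path0 := disk_boundary_path ch FH hK hiK chi.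
split; first by apply/cvg_ex; eexists; exact: conv path0.
rewrite /closed_curve_length -[RHS]ereal_sup1; congr ereal_sup.
(* The counting function does not depend on [g], so uniqueness of the limit shows that all
   parametrizations have the same length. *)
have value g : simple_closed_path g (boundary F) -> path_length c B g =
    (2 * lim (l * (touching_number F B l)%:R @[l --> 0^'+]))%:E.
  move=> hg; rewrite (path_length_norm_length hB hg hrect) (cvg_lim _ (conv g hg)) //.
  by rewrite mulrA mulfV ?mul1r ?pnatr_eq0.
apply/seteqP; split=> [_ [g hg <-]|_ ->]; first exact: value.
by exists (fun t => h (ucirc t)) => //; exact: value.
Qed.
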